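(* Let $A\in C^\infty_{\mathbb R}(S^1)$ and let $h_t$ be a smooth path in $\mathrm{Diff}_+(S^1)$ with $h_0=\mathrm{id}$ and initial vector field $A$. Then the operator-norm derivative $$\dot J_A=\left.\frac{d}{dt}\right|_{t=0}J_{h_t}\in\mathrm B(H^{1/2}(S^1))$$ is the bounded extension to $H^{1/2}(S^1)$ of the operator initially defined on $C^\infty(S^1)$ (modulo constants) by $$\dot J_A=[M_A\partial_\theta,H]=M_A\partial_\theta H-HM_A\partial_\theta .$$
   Context: $\mathrm{Diff}_+(S^1)$ is the (Fréchet Lie) group of orientation-preserving $C^\infty$ diffeomorphisms of $S^1$. A smooth path $h_t$ in it (real $t$ near $0$, $h_0=\mathrm{id}$) has initial vector field $A\in C^\infty_{\mathbb R}(S^1)$ if, with angular lifts $h_t(e^{i\theta})=e^{i\varphi_t(\theta)}$, $\varphi_t(\theta+2\pi)=\varphi_t(\theta)+2\pi$, one has $\varphi_t(\theta)=\theta+tA(\theta)+o(t)$ in $C^\infty(S^1)$. $H^{1/2}(S^1)$ is the Hilbert space of (classes modulo constants of) complex-valued functions $u$ on $S^1$ with $\|u\|_{H^{1/2}}^2=\sum_{n\ne0}|n||\widehat u(n)|^2<\infty$. The Hilbert transform is $H\bigl(\sum_{n\ne0}u_ne^{in\theta}\bigr)=-i\sum_{n\ne0}\operatorname{sgn}(n)u_ne^{in\theta}$. For $h\in\mathrm{Diff}_+(S^1)$, $V_hu=u\circ h$ is bounded and invertible on $H^{1/2}(S^1)$, and $J_h=V_hHV_h^{-1}$. The operator-norm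 derivative $\dot J_A$ of $t\mapsto J_{h_t}$ at $t=0$ exists and depends only on $A$. $M_A\partial_\theta$ is the densely defined operator on $H^{1/2}(S^1)$ with $(M_A\partial_\theta)f=Af'$ for $f\in C^\infty(S^1)$, where $f'=df/d\theta$ and the result is taken modulo constants. $\mathrm B(E)$ denotes the bounded linear operators on $E$. *)

(* Defs.v *)
From HB Require Import structures.
From mathcomp Require Import all_boot all_order all_algebra.
From mathcomp Require Import complex.
From mathcomp Require Import all_classical all_reals all_analysis.
Import Order.TTheory GRing.Theory Num.Theory.
Import numFieldTopology.Exports numFieldNormedType.Exports.

Set Implicit Arguments.
Unset Strict Implicit.
Unset Printing Implicit Defensive.

Local Open Scope classical_set_scope.
Local Open Scope ring_scope.

Section Circle.
Variable R : realType.

Definition S1 := {z : R[i] | `|z| == 1}.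

Lemma expi_subproof (t : R) : `|Complex (cos t) (sin t)| == 1.
Proof. by rewrite normc_def /= cos2Dsin2 sqrtr1. Qed.

(* e^(it) *)
Definition expi (t : R) : S1 := exist _ (Complex (cos t) (sin t)) (expi_subproof t).

(* A function on the circle seen as a 2pi-periodic function of the angle. *)
Definition ang (T : Type) (u : S1 -> T) : R -> T := fun t => u (expi t).

Definition smooth (g : R -> R) : Prop :=
  forall (n : nat) (x : R), derivable (derive1n n g) x 1.

Definition smoothR (a : S1 -> R) : Prop := smooth (ang a).

Definition smoothC (f : S1 -> R[i]) : Prop :=
  smooth (fun t => complex.Re (ang f t)) /\ smooth (fun t => complex.Im (ang f t)).

Definition cderive (g : R -> R[i]) (t : R) : R[i] :=
  Complex (derive1 (fun s => complex.Re (g s)) t)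
          (derive1 (fun s => complex.Im (g s)) t).

Definition period : set R := `[0, 2 * pi].

Definition cint (g : R -> R[i]) : R[i] :=
  Complex (\int[lebesgue_measure]_(t in period) complex.Re (g t))
          (\int[lebesgue_measure]_(t in period) complex.Im (g t)).

(* (2pi)^-1 * \int_0^(2pi) u(e^(it)) e^(-int) dt *)
Definition fourier (u : S1 -> R[i]) (n : int) : R[i] :=
  ((2 * pi)^-1)%:C%C *
  cint (fun t => ang u t * val (expi (- (n%:~R * t)))).

Definition sqnormc (z : R[i]) : R := complex.Re z ^+ 2 + complex.Im z ^+ 2.

End Circle.

Arguments period : clear implicits.

Section HalfSobolev.
Variable R : realType.
Notation C := R[i].
Notation fct := (S1 R -> C).

(* Equality in H^(1/2): almost everywhere, modulo an additive constant. *)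
Definition eqH (u v : fct) : Prop :=
  exists c : C, {ae (@lebesgue_measure R),
    forall t : R, period R t -> ang u t = ang v t + c}.

Definition sqnormH (u : fct) : \bar R :=
  \esum_(n in [set n : int | n != 0])
    ((`|n|%N)%:R * sqnormc (fourier u n))%:E.

Definition L2 (u : fct) : Prop :=
  [/\ measurable_fun (period R) (fun t => complex.Re (ang u t)),
      measurable_fun (period R) (fun t => complex.Im (ang u t)) &
      lebesgue_measure.-integrable (period R)
        (fun t => (sqnormc (ang u t))%:E)].

(* Representatives of the elements of H^(1/2)(S^1).  The space itself is the
   quotient of H12 by eqH; operators act on representatives and are required to
   be compatible with eqH. *)
Definition H12 (u : fct) : Prop := L2 u /\ (sqnormH u < +oo)%E.

Definition normH (u : fct) : R := Num.sqrt (fine (sqnormH u)).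

Definition bounded_op (T : fct -> fct) : Prop :=
  [/\ forall u, H12 u -> H12 (T u),
      forall u v, H12 u -> H12 v -> eqH u v -> eqH (T u) (T v),
      forall (a : C) u v, H12 u -> H12 v ->
        eqH (T (a *: u + v)) (a *: T u + T v) &
      exists M : R, forall u, H12 u -> normH (T u) <= M * normH u].

Definition op_norm (T : fct -> fct) : \bar R :=
  ereal_sup [set (normH (T u))%:E | u in [set u | H12 u /\ normH u <= 1]].

(* D is the derivative at 0, in operator norm, of a path of bounded operators
   defined near 0. *)
Definition is_op_derivative0 (J : R -> fct -> fct) (D : fct -> fct) : Prop :=
  [/\ \forall t \near (0 : R), bounded_op (J t),
      bounded_op D &
      op_norm (fun u => (t^-1)%:C%C *: (J t u - J 0 u) - D u)
        @[t --> (0 : R)^'] --> 0%E].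

(* The representative of the Hilbert transform of u is only chosen up to
   almost everywhere equality. *)
Definition Hilb (u : fct) : fct :=
  xget 0 [set v : fct | H12 v /\
    forall n : int, fourier v n = - Complex 0 1 * (sgz n)%:~R * fourier u n].

Definition V (h : S1 R -> S1 R) (u : fct) : fct := u \o h.

(* When h is bijective, Vinv h u = u \o h^-1 is the only v with V h v = u. *)
Definition Vinv (h : S1 R -> S1 R) (u : fct) : fct :=
  xget 0 [set v : fct | V h v = u].

Definition J (h : S1 R -> S1 R) (u : fct) : fct := V h (Hilb (Vinv h u)).

(* Domain of M_A d/dtheta: the classes of smooth functions. *)
Definition smooth_class (u : fct) : Prop := exists2 f, smoothC f & eqH f u.

(* M_A d/dtheta on the class of u: A f' for a smooth representative f, which is
   unique up to a constant.  The value is irrelevant outside smooth_class. *)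
Definition MAd (A : S1 R -> R) (u : fct) : fct :=
  xget 0 [set v : fct | exists f, [/\ smoothC f, eqH f u &
    forall t, ang v t = (ang A t)%:C%C * cderive (ang f) t]].

Definition commMAdH (A : S1 R -> R) (u : fct) : fct :=
  MAd A (Hilb u) - Hilb (MAd A u).

(* T is a bounded operator extending [M_A d/dtheta, H], initially defined on
   C^oo modulo constants; the first conjunct says that the commutator is
   defined there. *)
Definition is_bounded_extension_comm (A : S1 R -> R) (T : fct -> fct) : Prop :=
  bounded_op T /\
  forall f, smoothC f -> smooth_class (Hilb f) /\ eqH (T f) (commMAdH A f).

End HalfSobolev.

Section Diffeomorphisms.
Variable R : realType.

Definition smooth_lift (h : S1 R -> S1 R) (phi : R -> R) : Prop :=
  [/\ smooth phi,
      forall t, phi (t + 2 * pi) = phi t + 2 * pi &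
      forall t, h (expi t) = expi (phi t)].

(* Smooth bijections with smooth inverse; the orientation is encoded by the
   degree 1 condition on the lifts. *)
Definition diffp (h : S1 R -> S1 R) : Prop :=
  exists k : S1 R -> S1 R,
    [/\ cancel h k, cancel k h,
        exists phi, smooth_lift h phi &
        exists psi, smooth_lift k psi].

(* (phi (t + s) - phi t) / s tends to B as s tends to 0, in the C^oo topology:
   uniform convergence of all derivatives with respect to the angle. *)
Definition Coo_derivative (phi : R -> R -> R) (t : R) (B : R -> R) : Prop :=
  forall (k : nat) (e : R), 0 < e ->
    \forall s \near (0 : R)^', forall x : R,
      `|derive1n k (fun y => s^-1 * (phi (t + s) y - phi t y) - B y) x| <= e.

(* Smooth curve near 0 in the Frechet Lie group Diff_+(S^1), modelled on
   C^oo(S^1): Phi j is the j-th t-derivative of a path of lifts. *)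
Definition smooth_path (h : R -> S1 R -> S1 R) : Prop :=
  exists2 eps : R, 0 < eps &
    (forall t, `|t| < eps -> diffp (h t)) /\
    exists Phi : nat -> R -> R -> R,
      (forall t, `|t| < eps -> smooth_lift (h t) (Phi 0%N t)) /\
      (forall (j : nat) t, `|t| < eps ->
         smooth (Phi j t) /\ Coo_derivative (Phi j) t (Phi j.+1 t)).

Definition initial_field (h : R -> S1 R -> S1 R) (A : S1 R -> R) : Prop :=
  exists phi : R -> R -> R,
    [/\ \forall t \near (0 : R), smooth_lift (h t) (phi t),
        phi 0 = id &
        Coo_derivative phi 0 (ang A)].

End Diffeomorphisms.

(* Main.v *)
Require Import Defs.
From HB Require Import structures.
From mathcomp Require Import all_boot all_order all_algebra.
From mathcomp Require Import complex.
From mathcomp Require Import all_classical all_reals all_analysis.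
From mathcomp Require Import measurable_realfun.
From mathcomp Require Import ring lra.
Import Order.TTheory GRing.Theory Num.Theory.
Import numFieldTopology.Exports numFieldNormedType.Exports.

Set Implicit Arguments.
Unset Strict Implicit.
Unset Printing Implicit Defensive.

Local Open Scope classical_set_scope.
Local Open Scope ring_scope.

(** An element of H^(1/2) is given by its real and imaginary parts, two real
    2pi-periodic functions of the angle, and everything is done on these.

    The squared norm of H^(1/2) is a Dirichlet energy.  By Douglas' formula
    ([energye_ge], [energye_cvg]), up to a constant it is the integral over the
    torus of (f x - f y)^2 k(x, y), where k(x, y) = 1 / (2 (1 - cos (x - y))).
    For a bounded function m on the torus let E[m](f, g) be the integral of
    (f x - f y) (g x - g y) k(x, y) m(x, y).  The Hilbert transform is
    characterized by 2pi <H f, w'> = - E[1](f, w) for all smooth w, and every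
    symbol m defines in the same way an operator T_m by
    2pi <T_m f, w'> = - E[m](f, w).  Testing against a suitable trigonometric
    polynomial w and using the Cauchy-Schwarz inequality for E shows that T_m f
    has finite energy and that the norm of T_m is at most sup |m|
    ([has_symbol_coef_le]); the Riesz-Fischer theorem provides T_m f
    ([has_symbol_exists]).  Norm estimates for operators thus become uniform
    estimates for symbols.

    If phi is a lift of h, a change of variables in E shows that J_h has the
    symbol phi'(x) phi'(y) (1 - cos (x - y)) / (1 - cos (phi x - phi y)), the
    quotient of the pulled back kernel by the kernel ([invariance],
    [conjugation_symbol]).  For phi = x + s a(x) this symbol is
    1 + s (a'(x) + a'(y) - (a x - a y) sin (x - y) / (1 - cos (x - y))) + O(s^2),
    uniformly on the torus, with a constant that depends only on sup |a'|
    ([symbol_estimate]).  For the given path, a = (phi_s - id) / s tends to A in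
    C^1, so the difference quotients of the symbols converge uniformly and
    those of the operators J_(h_s) converge in norm.  The limit is the operator
    whose symbol is the coefficient of s above, with a = A.

    It remains to recognize the commutator.  The change of variables says that
    E[m_s](f o phi_s, w o phi_s) = E[1](f, w) for phi_s = x + s A(x) with symbol
    m_s.  Differentiating at s = 0 gives
    E[m'](f, w) + E[1](A f', w) + E[1](f, A w') = 0 for smooth f and w
    ([infinitesimal_invariance]).  The second term is - 2pi <H (A f'), w'>, and
    the third is - 2pi <H f, (A w')'> = 2pi <A (H f)', w'> because H f is smooth
    ([smooth_conj]).  Hence A (H f)' - H (A f') has the symbol m'
    ([commutator_symbol]), as the derivative of J_(h_s) has. *)

(** * Lifts of circle maps and change of variables *)

Section Periods.
Variable R : realType.
Implicit Types (f g : R -> R) (x y : R).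
Local Notation mu := (@lebesgue_measure R).
Local Notation P := (period R).
Local Notation tau := (2 * @pi R).

Lemma tau_gt0 : 0 < tau. Proof. by rewrite mulr_gt0 ?pi_gt0. Qed.

Lemma measurable_period : measurable (P : set (measurableTypeR R)). Proof. exact: measurable_itv. Qed.

Lemma period_measure : mu P = tau%:E.
Proof.
rewrite /period lebesgue_measure_itv /= lte_fin tau_gt0.
by rewrite -EFinB subr0.
Qed.

Definition per (T : Type) (f : R -> T) := forall x, f (x + tau) = f x.

Lemma per_int (T : Type) (f : R -> T) (k : int) x :
  per f -> f (x + k%:~R * tau) = f x.
Proof.
move=> pf; have pn n y : f (y + n%:R * tau) = f y.
  elim: n y => [|n IH] y; first by rewrite mul0r addr0.
  by rewrite -natr1 mulrDl mul1r addrA pf.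
case: k => n; first exact: pn.
rewrite NegzE mulrNz mulNr -[in RHS](subrK (n.+1%:R * tau) x) pn.
by rewrite pmulrn.
Qed.

(** The representative of an angle in the fundamental domain [0, 2pi[. *)
Definition fold x := x - (Num.floor (x / tau))%:~R * tau.

Lemma fold_per (T : Type) (f : R -> T) x : per f -> f (fold x) = f x.
Proof. by move=> pf; rewrite /fold -mulNr -mulrNz per_int. Qed.

Lemma fold_itv x : 0 <= fold x < tau.
Proof.
have /andP[h1 h2] := floor_itv (x / tau); rewrite /fold.
rewrite subr_ge0 -ler_pdivlMr ?tau_gt0// h1/= ltrBlDr.
rewrite -[X in _ < X + _]mul1r -mulrDl -ltr_pdivrMr ?tau_gt0//.
by rewrite addrC intrD in h2 *.
Qed.

Lemma fold_period x : P (fold x).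
Proof. by have /andP[a b] := fold_itv x; rewrite /period/= in_itv/= a ltW. Qed.

Lemma measurable_fold : measurable_fun setT fold.
Proof.
apply: measurable_funB => //; apply: measurable_funM => //.
apply: nondecreasing_measurable => // x y xy.
by rewrite ler_int le_floor// ler_wpM2r// invr_ge0 ltW// tau_gt0.
Qed.

(** Composition with [fold] gives the function back, so nothing is lost by
    controlling it on one period. *)
Lemma per_measurable d (T : measurableType d) (f : R -> T) :
  per f -> measurable_fun P f -> measurable_fun setT f.
Proof.
move=> pf mf; rewrite (_ : f = f \o fold); last first.
  by apply/funext => x; rewrite /= fold_per.
apply: (measurable_comp measurable_period) mf measurable_fold.
by move=> _ [x _ <-]; exact: fold_period.
Qed.

(** Lifts of orientation preserving C^1 diffeomorphisms of the circle. *)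
Definition circle_lift (phi dphi : R -> R) :=
  [/\ forall x, is_derive x 1 phi (dphi x), continuous dphi,
      forall x, 0 < dphi x & forall x, phi (x + tau) = phi x + tau].

Section Substitution.
Variables (phi dphi : R -> R).
Hypothesis philift : circle_lift phi dphi.

Lemma circle_lift_continuous : continuous phi.
Proof.
case: philift => d _ _ _ x; have dx := d x.
by apply: differentiable_continuous; apply/derivable1_diffP; exact: ex_derive.
Qed.

Lemma circle_lift_lt : {mono phi : x y / x < y}.
Proof.
have h x y : x < y -> phi x < phi y.
  move=> xy; have [||c cxy e] := @MVT R phi dphi x y xy.
  - by case: philift.
  - exact/continuous_subspaceT/circle_lift_continuous.
  - rewrite -subr_gt0 e mulr_gt0 ?subr_gt0//; by case: philift.
by apply: leW_mono; apply: le_mono.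
Qed.

Lemma circle_lift_le : {mono phi : x y / x <= y}.
Proof. by move=> x y; rewrite !leNgt circle_lift_lt. Qed.

Lemma circle_lift_int (k : int) x : phi (x + k%:~R * tau) = phi x + k%:~R * tau.
Proof.
pose g y := phi y - y.
have pg : per g by case: philift => _ _ _ h y; rewrite /g h; ring.
have := per_int k x pg; rewrite /g => h.
by rewrite -[LHS](subrK (x + k%:~R * tau)) h; ring.
Qed.

Lemma circle_lift_onto y : exists x, phi x = y.
Proof.
pose k := Num.floor ((y - phi 0) / tau).
have /andP[h1 h2] := floor_itv ((y - phi 0) / tau).
pose a := k%:~R * tau; pose b := a + tau.
have Ea : phi a = phi 0 + k%:~R * tau by rewrite -[a]add0r circle_lift_int.
have Eb : phi b = phi 0 + (k + 1)%:~R * tau.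
  by rewrite -circle_lift_int; congr phi; rewrite /b /a; ring.
have ab : a <= b by rewrite /b lerDl ltW// tau_gt0.
have [||x _ <-] := @IVT R phi a b y ab; last by exists x.
  exact/continuous_subspaceT/circle_lift_continuous.
have l : phi a <= phi b by rewrite circle_lift_le.
rewrite (min_idPl l) (max_idPr l) Ea Eb.
rewrite -lerBrDl -ler_pdivlMr ?tau_gt0// h1/=.
by rewrite -lerBlDl -ler_pdivrMr ?tau_gt0// ltW.
Qed.

Let nu (B : set (measurableTypeR R)) : \bar R :=
  (\int[mu]_(x in phi @^-1` B) (dphi x)%:E)%E.

Let mdphi D : measurable_fun D (EFin \o dphi).
Proof.
apply: measurable_funTS; apply/measurable_EFinP.
by apply: continuous_measurable_fun; case: philift.
Qed.

Let mphi : measurable_fun setT phi.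
Proof. by apply: continuous_measurable_fun; exact: circle_lift_continuous. Qed.

Let mpre B : measurable B -> measurable (phi @^-1` B).
Proof. by move=> mB; rewrite -[X in measurable X]setTI; exact: mphi. Qed.

Let dphi_ge0 x : (0 <= (dphi x)%:E)%E.
Proof. by rewrite lee_fin ltW//; case: philift. Qed.

Let nu0 : nu set0 = 0%E.
Proof. by rewrite /nu preimage_set0 integral_set0. Qed.

Let nu_ge0 B : (0 <= nu B)%E.
Proof. by apply: integral_ge0 => x _; exact: dphi_ge0. Qed.

Let nu_sigma_additive : semi_sigma_additive nu.
Proof.
move=> F mF tF mUF; rewrite /nu; apply: cvg_toP.
  apply: ereal_nondecreasing_is_cvgn => m n mn.
  by apply: lee_sum_nneg_natr => // k _ _; exact: nu_ge0.
rewrite preimage_bigcup ge0_integral_bigcup//=.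
- by move=> k; exact: (mpre (mF k)).
- exact: mdphi.
- by move=> i j _ _ [x [/= a b]]; apply: tF => //; exists (phi x).
Qed.

HB.instance Definition _ := isMeasure.Build _ _ _ nu nu0 nu_ge0 nu_sigma_additive.

Let preimage_itv_lift (c d : R) b0 b1:
  phi @^-1` [set` Interval (BSide b0 (phi c)) (BSide b1 (phi d))] =
  [set` Interval (BSide b0 c) (BSide b1 d)].
Proof.
apply/seteqP; split=> x /=; rewrite !in_itv /=;
  by case: b0; case: b1; rewrite /= ?circle_lift_lt ?circle_lift_le.
Qed.

Let nu_itv X : ocitv X -> mu X = nu X.
Proof.
move=> [[a b] _ <-] /=; rewrite /nu.
have [a' <-] := circle_lift_onto a; have [b' <-] := circle_lift_onto b.
rewrite preimage_itv_lift.
rewrite lebesgue_measure_itv/= lte_fin circle_lift_lt; case: ifPn => ab; last first.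
  rewrite set_itv_ge ?integral_set0// bnd_simp; exact: ab.
rewrite integral_itv_obnd_cbnd; last exact: mdphi.
case: philift => d c _ _.
rewrite (@continuous_FTC2 _ _ phi)//.
- exact: continuous_subspaceT.
- split.
  + by move=> x _; have dx := d x; exact: ex_derive.
  + by apply: cvg_at_right_filter; exact: circle_lift_continuous.
  + by apply: cvg_at_left_filter; exact: circle_lift_continuous.
- by move=> x _; have dx := d x; rewrite derive1E derive_val.
Qed.

Let nuE B : measurable B -> mu B = nu B.
Proof. exact: (lebesgue_measure_unique nu_itv). Qed.

Import HBNNSimple.

(** The measure with density dphi on the line is carried by phi to Lebesgue
    measure, because the two agree on intervals; simple functions and monotone
    convergence do the rest. *)
Let integral_lift (G : R -> \bar R) (D : set R) : measurable D ->
  measurable_fun setT G -> (forall x, 0 <= G x)%E ->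
  (\int[mu]_(x in D) G x =
   \int[mu]_(x in phi @^-1` D) (G (phi x) * (dphi x)%:E))%E.
Proof.
move=> mD mG G0.
pose h := nnsfun_approx measurableT mG.
have hG x : (h n x)%:E @[n --> \oo] --> G x.
  exact: (@cvg_nnsfun_approx _ _ _ _ measurableT _ mG (fun x _ => G0 x)).
have hnd x : nondecreasing_seq (fun n => (h n x)%:E).
  by move=> m n mn; rewrite lee_fin; exact/lefP/nd_nnsfun_approx.
have mh n D' : measurable_fun D' (fun x => (h n x)%:E).
  by apply: measurable_funTS; apply/measurable_EFinP.
have mhp n D' : measurable_fun D' (fun x => (h n (phi x))%:E).
  by apply: measurable_funTS; apply/measurable_EFinP; exact: measurableT_comp.
have e1 := @cvg_monotone_convergence _ _ _ mu D mD (fun n x => (h n x)%:E)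
   (fun n => mh n D) (fun n x _ => ltac:(by rewrite lee_fin)) (fun x _ => hnd x).
have e2 := @cvg_monotone_convergence _ _ _ mu _ (mpre mD)
   (fun n x => ((h n (phi x))%:E * (dphi x)%:E)%E).
rewrite -(_ : (\int[mu]_(x in D) limn (fun n => (h n x)%:E))%E = (\int[mu]_(x in D) G x)%E); last first.
  by apply: eq_integral => x _; apply/cvg_lim => //; exact: hG.
rewrite -(_ : (\int[mu]_(x in phi @^-1` D) limn (fun n => (h n (phi x))%:E * (dphi x)%:E))%E =
  (\int[mu]_(x in phi @^-1` D) (G (phi x) * (dphi x)%:E))%E); last first.
  apply: eq_integral => x _; apply/cvg_lim => //; apply: cvgeZr => //; exact: hG.
move/cvg_lim : e1 => <- //.
have {}e2 := e2 _ _ _; move: e2 => /(_ _ _ _)/cvg_lim <- //; last 3 first.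
- move=> n; apply: emeasurable_funM; [exact: mhp|exact: mdphi].
- by move=> n x _; apply: mule_ge0 => //; rewrite lee_fin.
- by move=> x _ m n mn; rewrite lee_wpmul2r ?dphi_ge0//; exact: hnd.
apply: congr_lim; apply/funext => n.
transitivity (\int[mu]_(x in D)
   (\sum_(y \in range (h n)) (y * \1_(h n @^-1` [set y]) x)%:E))%E.
  by apply: eq_integral => t tE; rewrite /= fimfunE -fsumEFin.
rewrite ge0_integral_fsum//; last 2 first.
- move=> y; apply/measurable_EFinP; apply: measurable_funM => //.
  apply: measurable_indic; rewrite -[X in measurable X]setTI.
  exact: (measurable_funP (h n)).
- by move=> m y Ey; exact: nnfun_muleindic_ge0.
transitivity (\int[mu]_(x in phi @^-1` D) (\sum_(y \in range (h n))
    (y * \1_(h n @^-1` [set y]) (phi x))%:E * (dphi x)%:E))%E; last first.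
  apply: eq_integral => x xE.
  rewrite -ge0_mule_fsuml => [|y]; last exact: nnfun_muleindic_ge0.
  by rewrite fsumEFin // -(fimfunE _ (phi x)).
have mi (y : R) D' : measurable_fun D' (fun x => (y * \1_(h n @^-1` [set y]) (phi x))%:E).
  apply: measurable_funTS; apply/measurable_EFinP; apply: measurable_funM => //.
  by apply: measurableT_comp => //.
rewrite ge0_integral_fsum//; last 3 first.
- exact: mpre.
- by move=> y; apply: emeasurable_funM; [exact: mi|exact: mdphi].
- by move=> m y Ey; rewrite mule_ge0 ?dphi_ge0// nnfun_muleindic_ge0.
apply: eq_fsbigr => r rhn.
have r0 : 0 <= r by move: rhn; rewrite inE => -[t _ <-].
have mhr : measurable (h n @^-1` [set r]).
  rewrite -[X in measurable X]setTI; exact: (measurable_funP (h n)).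
under eq_integral do rewrite EFinM.
rewrite ge0_integralZl//; last first.
  by apply/measurable_EFinP; exact: measurable_indic.
rewrite [X in (_ * X)%E](_ : _ = nu (h n @^-1` [set r] `&` D)); last first.
  by rewrite integral_indic//; apply: nuE; exact: measurableI.
under [RHS]eq_integral do rewrite EFinM -muleA.
rewrite ge0_integralZl//; last 3 first.
- exact: mpre.
- apply: emeasurable_funM; last exact: mdphi.
  apply: measurable_funTS; apply/measurable_EFinP.
  by apply: measurableT_comp => //.
- by move=> x _; apply: mule_ge0 => //; rewrite lee_fin.
congr (_ * _)%E; rewrite /nu preimage_setI setIC integral_mkcondr.
apply: eq_integral => x _; rewrite epatch_indic muleC; congr (_ * _)%E.
Qed.

Lemma ge0_integral_lift (G : R -> \bar R) (a b : R) :
  measurable_fun setT G -> (forall x, 0 <= G x)%E ->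
  (\int[mu]_(x in `[phi a, phi b]) G x =
   \int[mu]_(x in `[a, b]) (G (phi x) * (dphi x)%:E))%E.
Proof. by move=> mG G0; rewrite integral_lift// preimage_itv_lift. Qed.

End Substitution.

Lemma circle_lift_shift c : circle_lift (fun x => x + c) (cst 1).
Proof.
split => //; last by move=> x; rewrite addrAC.
- by move=> x; rewrite -[X in is_derive _ _ _ X]addr0; exact: is_deriveD.
- by move=> x; exact: cst_continuous.
Qed.

Lemma ge0_integral_shift (G : R -> \bar R) (a b c : R) :
  measurable_fun setT G -> (forall x, 0 <= G x)%E ->
  (\int[mu]_(x in `[(a + c)%R, (b + c)%R]) G x =
   \int[mu]_(x in `[a, b]) G (x + c)%R)%E.
Proof.
move=> mG G0; rewrite (ge0_integral_lift (circle_lift_shift c))//.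
by apply: eq_integral => x _; rewrite mule1.
Qed.

Lemma ge0_integral_itvD (G : R -> \bar R) (a b e : R) :
  measurable_fun setT G -> (forall x, 0 <= G x)%E -> a <= b -> b <= e ->
  (\int[mu]_(x in `[a, e]) G x =
   \int[mu]_(x in `[a, b]) G x + \int[mu]_(x in `[b, e]) G x)%E.
Proof.
move=> mG G0 ab be; rewrite (@itv_bndbnd_setU _ _ _ (BRight b)) ?bnd_simp//.
have mGS D : measurable_fun D G by exact: measurable_funTS.
rewrite ge0_integral_setU//=.
- by rewrite integral_itv_obnd_cbnd.
- exact: mGS.
- apply/disj_setPS => y [/=]; rewrite 2!in_itv/= => /andP[_ yx] /andP[].
  by rewrite ltNge yx.
Qed.

(** Cutting at a multiple of the period moves the part of the interval beyond
    it to the beginning of the fundamental domain. *)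
Lemma ge0_integral_period (G : R -> \bar R) (c : R) :
  measurable_fun setT G -> (forall x, 0 <= G x)%E -> per G ->
  (\int[mu]_(x in `[c, (c + tau)%R]) G x = \int[mu]_(x in P) G x)%E.
Proof.
move=> mG G0 pG.
have -> : (\int[mu]_(x in `[c, (c + tau)%R]) G x =
  \int[mu]_(x in `[fold c, (fold c + tau)%R]) G x)%E.
  pose k := (Num.floor (c / tau))%:~R * tau.
  rewrite [in LHS](_ : c = fold c + k); last by rewrite /fold subrK.
  rewrite [fold c + k + tau]addrAC ge0_integral_shift//.
  apply: eq_integral => x _; exact: per_int.
have /andP[d0 dt] := fold_itv c; move: (fold c) d0 dt => d d0 dt.
have mGS D : measurable_fun D G by exact: measurable_funTS.
have sp (a b e : R) := @ge0_integral_itvD G a b e mG G0.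
rewrite (sp d tau)//; [|exact: ltW|by rewrite lerDr].
rewrite /period (sp 0 d tau)//; last exact: ltW.
rewrite [X in (_ + X)%E](_ : _ = (\int[mu]_(x in `[0%R, d]) G x)%E); last first.
  rewrite -[X in `[X, _]%classic]add0r.
  by rewrite ge0_integral_shift//; apply: eq_integral => x _; exact: pG.
by rewrite addeC.
Qed.

Lemma ge0_integral_circle_lift (phi dphi : R -> R) (G : R -> \bar R) :
  circle_lift phi dphi ->
  measurable_fun setT G -> (forall x, 0 <= G x)%E -> per G ->
  (\int[mu]_(x in P) G x = \int[mu]_(x in P) (G (phi x) * (dphi x)%:E))%E.
Proof.
move=> l mG G0 pG; rewrite -(ge0_integral_period (phi 0)) //.
have -> : phi 0 + tau = phi tau by case: l => _ _ _ <-; rewrite add0r.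
by rewrite (ge0_integral_lift l).
Qed.

Local Notation itg f := (mu.-integrable P (EFin \o f)).

Lemma integrable_circle_lift (phi dphi f : R -> R) :
  circle_lift phi dphi -> measurable_fun setT f -> per f ->
  itg f -> itg (fun x => f (phi x) * dphi x).
Proof.
move=> l mf pf /integrableP[_ fi]; apply/integrableP; split.
  apply: measurable_funTS; apply/measurable_EFinP; apply: measurable_funM.
    apply: measurableT_comp => //; apply: continuous_measurable_fun.
    exact: (circle_lift_continuous l).
  by apply: continuous_measurable_fun; case: l.
rewrite (ge0_integral_circle_lift l) in fi; last 3 first.
- by do 2 apply: measurableT_comp => //.
- by move=> x; exact: abse_ge0.
- by move=> x /=; rewrite pf.
apply: le_lt_trans fi; rewrite le_eqVlt; apply/orP; left; apply/eqP.
apply: eq_integral => x _ /=; rewrite normrM EFinM; congr (_ * _%:E)%E.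
by rewrite ger0_norm// ltW//; case: l.
Qed.

Lemma integral_circle_lift (phi dphi f : R -> R) :
  circle_lift phi dphi -> measurable_fun setT f -> per f ->
  \int[mu]_(x in P) f x = \int[mu]_(x in P) (f (phi x) * dphi x).
Proof.
move=> l mf pf; rewrite /Rintegral; congr fine.
have d0 x : 0 <= dphi x by rewrite ltW//; case: l.
have mef : measurable_fun setT (EFin \o f) by exact/measurable_EFinP.
rewrite integralE [RHS]integralE.
congr (_ - _)%E.
- have := ge0_integral_circle_lift l (measurable_funepos mef) (@funepos_ge0 _ _ _).
  move=> -> => [|x]; last by rewrite !funeposE /= pf.
  apply: eq_integral => x _.
  by rewrite !funeposE /= -!EFin_max -EFinM maxr_pMl ?mul0r//.
- have := ge0_integral_circle_lift l (measurable_funeneg mef) (@funeneg_ge0 _ _ _).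
  move=> -> => [|x]; last by rewrite !funenegE /= pf.
  apply: eq_integral => x _.
  by rewrite !funenegE /= -!EFin_max -EFinM maxr_pMl ?mul0r// mulNr.
Qed.

End Periods.

Arguments measurable_period : clear implicits.

(** * Fourier coefficients of square integrable periodic functions *)

Section SquareIntegrable.
Variable R : realType.
Implicit Types (f g : R -> R) (x y : R).
Local Notation mu := (@lebesgue_measure R).
Local Notation P := (period R).
Local Notation tau := (2 * @pi R).
Local Notation itg f := (mu.-integrable P (EFin \o f)).

Lemma measurable_fst_comp f : measurable_fun setT f ->
  measurable_fun setT (fun z : R * R => f z.1).
Proof. by move=> mf; apply: measurableT_comp. Qed.

Lemma measurable_snd_comp f : measurable_fun setT f ->
  measurable_fun setT (fun z : R * R => f z.2).
Proof. by move=> mf; apply: measurableT_comp. Qed.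

Lemma measurable_abs_EFin (D : set R) f :
  measurable_fun setT f -> measurable_fun D (fun x => `|(f x)%:E|%E).
Proof.
move=> mf; apply: measurable_funTS; apply: (measurableT_comp (f := abse)) => //.
exact/measurable_EFinP.
Qed.

Lemma measurable_integral_fst (F : R * R -> \bar R) :
  measurable_fun setT F -> (forall z, 0 <= F z)%E ->
  measurable_fun setT (fun y : R => \int[mu]_x F (x, y))%E.
Proof. exact: (@measurable_fun_fubini_tonelli_G _ _ (measurableTypeR R) (measurableTypeR R) R mu F). Qed.

Lemma measurable_integral_snd (F : R * R -> \bar R) :
  measurable_fun setT F -> (forall z, 0 <= F z)%E ->
  measurable_fun setT (fun x : R => \int[mu]_y F (x, y))%E.
Proof. exact: (@measurable_fun_fubini_tonelli_F _ _ (measurableTypeR R) (measurableTypeR R) R mu F). Qed.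

Lemma measurable_section_fst d (T : measurableType d) (F : R * R -> T) y :
  measurable_fun setT F -> measurable_fun setT (fun x : R => F (x, y)).
Proof. by move=> mF; apply: measurableT_comp mF _; exact: pair2_measurable. Qed.

Lemma measurable_section_snd d (T : measurableType d) (F : R * R -> T) x :
  measurable_fun setT F -> measurable_fun setT (fun y : R => F (x, y)).
Proof. by move=> mF; apply: measurableT_comp mF _; exact: pair1_measurable. Qed.

Lemma itg_patch f : itg f -> mu.-integrable setT (EFin \o (f \_ P)).
Proof.
move=> fi; have := @integrable_mkcond _ _ _ mu P (EFin \o f) (measurable_period R).
by move=> [/(_ fi) h _]; rewrite -restrict_EFin.
Qed.

Lemma patch_indic f x : (f \_ P) x = f x * \1_P x.
Proof. by rewrite patchE indicE; case: (_ \in _); rewrite ?mulr1 ?mulr0. Qed.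

Lemma measurable_indic_period : measurable_fun setT (\1_P : R -> R).
Proof. by apply: measurable_indic; exact: measurable_period. Qed.

Lemma itg_le f g : measurable_fun setT f -> (forall x, P x -> `|f x| <= g x) ->
  itg g -> itg f.
Proof.
move=> mf fg ig; apply: le_integrable ig; first exact: measurable_period.
- by apply: measurable_funTS; apply/measurable_EFinP.
- by move=> x Px /=; rewrite lee_fin (le_trans (fg _ Px))// ler_norm.
Qed.

Lemma itg_cst (c : R) : itg (cst c).
Proof.
apply/integrableP; split; first by apply/measurable_EFinP; exact: measurable_cst.
rewrite (_ : (fun x => _) = cst `|c|%:E)// integral_cst; last exact: measurable_period.
by rewrite [X in (_ * X)%E]period_measure ltry.
Qed.

Lemma itg_bounded f (M : R) : measurable_fun setT f ->
  (forall x, `|f x| <= M) -> itg f.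
Proof. by move=> mf fM; exact: (itg_le mf _ (itg_cst M)). Qed.

Lemma itgD f g : itg f -> itg g -> itg (fun x => f x + g x).
Proof. by move=> fi gi; apply: (integrableD _ fi gi); exact: measurable_period. Qed.

Lemma itgZ (c : R) f : itg f -> itg (fun x => c * f x).
Proof. by move=> fi; apply: (integrableZl _ c fi); exact: measurable_period. Qed.

(** Periodic functions on the line standing for square integrable functions on
    the circle. *)
Definition L2p f :=
  [/\ per f, measurable_fun setT f & itg (fun x => f x ^+ 2)].

Definition ip f g := \int[mu]_(x in P) (f x * g x).

Lemma ipC f g : ip f g = ip g f.
Proof. by apply: eq_Rintegral => x _; rewrite mulrC. Qed.

Lemma L2pM f g : L2p f -> L2p g -> itg (fun x => f x * g x).
Proof.
move=> [_ mf fi] [_ mg gi]; apply: (itg_le _ _ (itgD fi gi)).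
- exact: measurable_funM.
- move=> x _; rewrite normrM -(real_normK (num_real (f x))).
  rewrite -(real_normK (num_real (g x))).
  have := sqr_ge0 (`|f x| - `|g x|); have := normr_ge0 (f x).
  have := normr_ge0 (g x); nra.
Qed.

Lemma L2p_bounded f (M : R) : per f -> measurable_fun setT f ->
  (forall x, `|f x| <= M) -> L2p f.
Proof.
move=> pf mf fM; split=> //; apply: (@itg_bounded _ (M ^+ 2)).
  exact: measurable_funX.
by move=> x; rewrite normrX ler_pXn2r// nnegrE (le_trans _ (fM x)).
Qed.

Lemma L2p_cst c : L2p (cst c).
Proof. by apply: (@L2p_bounded _ `|c|) => // x. Qed.

Lemma L2p_itg f : L2p f -> itg f.
Proof.
move=> hf; have := L2pM hf (L2p_cst 1).
by rewrite (_ : (fun x => _) = f)//; apply/funext => x; rewrite /= mulr1.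
Qed.

Lemma L2pD f g : L2p f -> L2p g -> L2p (fun x => f x + g x).
Proof.
move=> hf hg; have [pf mf fi] := hf; have [pg mg gi] := hg; split.
- by move=> x; rewrite pf pg.
- exact: measurable_funD.
- have := itgD (itgD fi gi) (itgZ 2 (L2pM hf hg)).
  by congr integrable; apply/funext => x /=; congr EFin; ring.
Qed.

Lemma L2pZ c f : L2p f -> L2p (fun x => c * f x).
Proof.
move=> [pf mf fi]; split.
- by move=> x; rewrite pf.
- exact: measurable_funM.
- have := itgZ (c ^+ 2) fi.
  by congr integrable; apply/funext => x /=; rewrite exprMn.
Qed.

Lemma L2pN f : L2p f -> L2p (fun x => - f x).
Proof.
move=> /(L2pZ (-1)); congr L2p.
by apply/funext => x; rewrite mulN1r.
Qed.

Lemma L2pB f g : L2p f -> L2p g -> L2p (fun x => f x - g x).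
Proof. by move=> hf /L2pN; exact: L2pD. Qed.

Lemma L2p_sum n (F : nat -> R -> R) : (forall i, L2p (F i)) ->
  L2p (fun x => \sum_(i < n) F i x).
Proof.
move=> hF; elim: n => [|n IH].
  have := L2p_cst 0; congr L2p.
  by apply/funext => x; rewrite big_ord0.
have := L2pD IH (hF n); congr L2p.
by apply/funext => x; rewrite big_ord_recr.
Qed.

Lemma ipDl f g h : L2p f -> L2p g -> L2p h ->
  ip (fun x => f x + g x) h = ip f h + ip g h.
Proof.
move=> hf hg hh; rewrite /ip -RintegralD; [|exact: measurable_period|exact: L2pM..].
by apply: eq_Rintegral => x _; rewrite mulrDl.
Qed.

Lemma ipZl c f h : L2p f -> L2p h -> ip (fun x => c * f x) h = c * ip f h.
Proof.
move=> hf hh; rewrite /ip -RintegralZl; [|exact: measurable_period|exact: L2pM].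
by apply: eq_Rintegral => x _; rewrite mulrA.
Qed.

Lemma ipNl f h : L2p f -> L2p h -> ip (fun x => - f x) h = - ip f h.
Proof.
move=> hf hh; rewrite -mulN1r -ipZl//.
by congr ip; apply/funext => x; rewrite mulN1r.
Qed.

Lemma ipBl f g h : L2p f -> L2p g -> L2p h ->
  ip (fun x => f x - g x) h = ip f h - ip g h.
Proof. by move=> hf hg hh; rewrite (ipDl hf (L2pN hg) hh) ipNl. Qed.

Lemma ip_suml n (F : nat -> R -> R) h : (forall i, L2p (F i)) -> L2p h ->
  ip (fun x => \sum_(i < n) F i x) h = \sum_(i < n) ip (F i) h.
Proof.
move=> hF hh; elim: n => [|n IH].
  rewrite big_ord0 -[RHS](mul0r (ip h h)) -ipZl//.
  by congr ip; apply/funext => x; rewrite big_ord0 mul0r.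
rewrite big_ord_recr /= -IH -ipDl//; last exact: L2p_sum.
by congr ip; apply/funext => x; rewrite big_ord_recr.
Qed.

Lemma ipDr f g h : L2p f -> L2p g -> L2p h ->
  ip h (fun x => f x + g x) = ip h f + ip h g.
Proof. by move=> *; rewrite ipC ipDl// !(ipC h). Qed.

Lemma ipZr c f h : L2p f -> L2p h -> ip h (fun x => c * f x) = c * ip h f.
Proof. by move=> *; rewrite ipC ipZl// !(ipC h). Qed.

Lemma ipBr f g h : L2p f -> L2p g -> L2p h ->
  ip h (fun x => f x - g x) = ip h f - ip h g.
Proof. by move=> *; rewrite ipC ipBl// !(ipC h). Qed.

Lemma ip_ge0 f : 0 <= ip f f.
Proof. by apply: Rintegral_ge0 => x _; rewrite -expr2 sqr_ge0. Qed.

Lemma ip_cst c : ip (cst c) (cst 1) = c * tau.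
Proof.
rewrite /ip (@eq_Rintegral _ _ _ mu P (cst c)); last first.
  by move=> x _; rewrite /= mulr1.
by rewrite Rintegral_cst; [rewrite [X in fine X]period_measure|exact: measurable_period].
Qed.

Lemma is_derive_continuous f (df : R -> R) :
  (forall x, is_derive x 1 f (df x)) -> continuous f.
Proof.
move=> d x; have dx := d x.
by apply: differentiable_continuous; apply/derivable1_diffP; exact: ex_derive.
Qed.

Lemma derive_LRcontinuous f (df : R -> R) a b :
  (forall x, is_derive x 1 f (df x)) -> derivable_oo_LRcontinuous f a b.
Proof.
move=> d; split.
- by move=> x _; have dx := d x; exact: ex_derive.
- by apply: cvg_at_right_filter; exact: (is_derive_continuous d).
- by apply: cvg_at_left_filter; exact: (is_derive_continuous d).
Qed.

Lemma derive1_is f (df : R -> R) :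
  (forall x, is_derive x 1 f (df x)) -> f^`()%classic = df.
Proof. by move=> d; apply/funext => x; have dx := d x; rewrite derive1E derive_val. Qed.

Lemma Rintegral_FTC f (df : R -> R) a b : a < b ->
  (forall x, is_derive x 1 f (df x)) -> continuous df ->
  \int[mu]_(x in `[a, b]) df x = f b - f a.
Proof.
move=> ab d c; rewrite /Rintegral (@continuous_FTC2 _ df f)//.
- exact: continuous_subspaceT.
- exact: derive_LRcontinuous.
- by move=> x _; rewrite (derive1_is d).
Qed.

(** On the circle the boundary terms cancel. *)
Lemma ip_parts f g (df dg : R -> R) : per f -> per g ->
  (forall x, is_derive x 1 f (df x)) -> (forall x, is_derive x 1 g (dg x)) ->
  continuous df -> continuous dg -> ip df g = - ip f dg.
Proof.
move=> pf pg d1 d2 c1 c2.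
have := @Rintegration_by_parts R f g df dg 0 tau (tau_gt0 R).
move=> /(_ (continuous_subspaceT c1) (derive_LRcontinuous 0 tau d1)
   (fun x _ => congr1 (fun h => h x) (derive1_is d1)) (continuous_subspaceT c2)
   (derive_LRcontinuous 0 tau d2)
   (fun x _ => congr1 (fun h => h x) (derive1_is d2))).
rewrite -[X in f X]add0r -[X in g X]add0r pf pg subrr sub0r.
by rewrite /ip /period => ->; rewrite opprK.
Qed.

Lemma per_continuous_bounded f : per f -> continuous f ->
  exists2 M : R, 0 <= M & forall x, `|f x| <= M.
Proof.
move=> pf cf; have := @segment_compact R 0 tau.
move=> /(continuous_compact (continuous_subspaceT cf)) /compact_bounded.
move=> [M [_ hM]]; have M1 : M < `|M| + 1 by rewrite (le_lt_trans (ler_norm _))// ltrDl.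
exists (`|M| + 1); first by rewrite addr_ge0.
move=> x; rewrite -(fold_per x pf); apply: (hM _ M1).
by exists (fold x) => //; exact: fold_period.
Qed.

Lemma L2p_continuous f : per f -> continuous f -> L2p f.
Proof.
move=> pf cf; have [M _ hM] := per_continuous_bounded pf cf.
by apply: (@L2p_bounded _ M) => //; exact: continuous_measurable_fun.
Qed.

Definition cosn (n : nat) x := cos (n%:R * x).
Definition sinn (n : nat) x := sin (n%:R * x).

Lemma per_cosn n : per (cosn n).
Proof.
move=> x; rewrite /cosn mulrDr; elim: n (n%:R * x) => [|n IH] y.
  by rewrite mul0r addr0.
have h z : cos (z + tau) = cos z by rewrite mulr_natl cosD2pi.
by rewrite -natr1 mulrDl mul1r addrA h IH.
Qed.

Lemma per_sinn n : per (sinn n).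
Proof.
move=> x; rewrite /sinn mulrDr; elim: n (n%:R * x) => [|n IH] y.
  by rewrite mul0r addr0.
have h z : sin (z + tau) = sin z by rewrite mulr_natl sinD2pi.
by rewrite -natr1 mulrDl mul1r addrA h IH.
Qed.

Lemma is_derive_cosn n x : is_derive x 1 (cosn n) (- n%:R * sinn n x).
Proof.
have h : is_derive x 1 (fun y => n%:R * y) (n%:R : R).
  by rewrite -[X in is_derive _ _ _ X]mulr1; exact: is_deriveZ.
have := is_derive1_comp (is_derive_cos (n%:R * x)) h.
by rewrite mulrC /sinn mulNr mulrN.
Qed.

Lemma is_derive_sinn n x : is_derive x 1 (sinn n) (n%:R * cosn n x).
Proof.
have h : is_derive x 1 (fun y => n%:R * y) (n%:R : R).
  by rewrite -[X in is_derive _ _ _ X]mulr1; exact: is_deriveZ.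
have := is_derive1_comp (is_derive_sin (n%:R * x)) h.
by rewrite mulrC.
Qed.

Lemma continuous_cosn n : continuous (cosn n).
Proof. exact: (is_derive_continuous (is_derive_cosn n)). Qed.

Lemma continuous_sinn n : continuous (sinn n).
Proof. exact: (is_derive_continuous (is_derive_sinn n)). Qed.

Lemma L2p_cosn n : L2p (cosn n).
Proof. by apply: L2p_continuous; [exact: per_cosn|exact: continuous_cosn]. Qed.

Lemma L2p_sinn n : L2p (sinn n).
Proof. by apply: L2p_continuous; [exact: per_sinn|exact: continuous_sinn]. Qed.
Hint Resolve L2p_cosn L2p_sinn : core.

Lemma continuous_scale (c : R) f : continuous f -> continuous (fun x => c * f x).
Proof. by move=> cf x; apply: cvgMr; exact: cf. Qed.

Definition ccoef f n := ip f (cosn n).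
Definition scoef f n := ip f (sinn n).

Lemma ccoef_derive f (df : R -> R) n : per f ->
  (forall x, is_derive x 1 f (df x)) -> continuous df ->
  ccoef df n = n%:R * scoef f n.
Proof.
move=> pf d c; rewrite /ccoef (ip_parts pf (per_cosn n) d (is_derive_cosn n) c); last first.
  exact/continuous_scale/continuous_sinn.
rewrite ipZr; first by rewrite mulNr opprK.
  exact: L2p_sinn.
by apply: L2p_continuous => //; exact: is_derive_continuous d.
Qed.

Lemma scoef_derive f (df : R -> R) n : per f ->
  (forall x, is_derive x 1 f (df x)) -> continuous df ->
  scoef df n = - n%:R * ccoef f n.
Proof.
move=> pf d c; rewrite /scoef (ip_parts pf (per_sinn n) d (is_derive_sinn n) c); last first.
  exact/continuous_scale/continuous_cosn.
rewrite ipZr; first by rewrite mulNr.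
  exact: L2p_cosn.
by apply: L2p_continuous => //; exact: is_derive_continuous d.
Qed.

Lemma ccoef_cosn_rec m n : m%:R * scoef (sinn m) n = n%:R * ccoef (cosn m) n.
Proof.
have := scoef_derive n (per_cosn m) (is_derive_cosn m) (continuous_scale (c := - m%:R) (@continuous_sinn m)).
rewrite /scoef /ccoef ipZl// !mulNr => /eqP; rewrite eqr_opp => /eqP ->.
by [].
Qed.

Lemma ccoef_sinn_rec m n : m%:R * ccoef (cosn m) n = n%:R * scoef (sinn m) n.
Proof.
have := ccoef_derive n (per_sinn m) (is_derive_sinn m) (continuous_scale (c := m%:R) (@continuous_cosn m)).
by rewrite /scoef /ccoef ipZl.
Qed.

Lemma cs_rec m n : - m%:R * ccoef (sinn m) n = n%:R * scoef (cosn m) n.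
Proof.
have := ccoef_derive n (per_cosn m) (is_derive_cosn m) (continuous_scale (c := - m%:R) (@continuous_sinn m)).
by rewrite /scoef /ccoef ipZl.
Qed.

Lemma sc_rec m n : m%:R * scoef (cosn m) n = - n%:R * ccoef (sinn m) n.
Proof.
have := scoef_derive n (per_sinn m) (is_derive_sinn m) (continuous_scale (c := m%:R) (@continuous_cosn m)).
by rewrite /scoef /ccoef ipZl.
Qed.

Lemma natsq_neq (m n : nat) : m != n -> (m%:R ^+ 2 - n%:R ^+ 2 : R) != 0.
Proof.
move=> mn; rewrite subr_eq0 -!natrX eqr_nat.
by apply: contra mn; rewrite eqn_sqr.
Qed.

(** Orthogonality of the trigonometric system follows from the eigenvalue
    relations of the derivative: distinct eigenvalues have orthogonal
    eigenfunctions. *)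
Lemma ccoef_cosn m n : m != n -> ccoef (cosn m) n = 0.
Proof.
move=> mn; apply: (mulfI (natsq_neq mn)).
rewrite mulr0; have := ccoef_cosn_rec m n; have := ccoef_sinn_rec m n.
move: (ccoef _ _) (scoef _ _) => a b h1 h2.
have -> : (m%:R ^+ 2 - n%:R ^+ 2) * a = m%:R * (m%:R * a) - n%:R * (n%:R * a) by ring.
by rewrite h1 -h2; ring.
Qed.

Lemma scoef_sinn m n : m != n -> scoef (sinn m) n = 0.
Proof.
move=> mn; apply: (mulfI (natsq_neq mn)).
rewrite mulr0; have := ccoef_cosn_rec m n; have := ccoef_sinn_rec m n.
move: (ccoef _ _) (scoef _ _) => a b h1 h2.
have -> : (m%:R ^+ 2 - n%:R ^+ 2) * b = m%:R * (m%:R * b) - n%:R * (n%:R * b) by ring.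
by rewrite h2 -h1; ring.
Qed.

Lemma scoef_cosn m n : scoef (cosn m) n = 0.
Proof.
have [->|mn] := eqVneq m n; last first.
  apply: (mulfI (natsq_neq mn)).
  rewrite mulr0; have := cs_rec m n; have := sc_rec m n.
  move: (ccoef _ _) (scoef _ _) => a b h1 h2.
  have -> : (m%:R ^+ 2 - n%:R ^+ 2) * b = m%:R * (m%:R * b) - n%:R * (n%:R * b) by ring.
  by rewrite h1 -h2; ring.
have := cs_rec n n; rewrite /ccoef /scoef ipC.
have [->|n0] := eqVneq n 0%N; last first.
  have : (n%:R : R) != 0 by rewrite pnatr_eq0.
  move: (ip _ _) => a h e; apply: (mulfI h); lra.
rewrite mul0r => _.
rewrite /ip; under eq_Rintegral do rewrite /sinn mul0r sin0 mulr0.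
by rewrite Rintegral_cst; [rewrite mul0r|exact: measurable_period].
Qed.

Lemma ccoef_sinn m n : ccoef (sinn m) n = 0.
Proof. by rewrite /ccoef ipC -/(scoef _ _) scoef_cosn. Qed.

Lemma ccoef_cosnn n : (0 < n)%N -> ccoef (cosn n) n = pi.
Proof.
move=> n0; have e : scoef (sinn n) n = ccoef (cosn n) n.
  by apply: (@mulfI _ n%:R); [rewrite pnatr_eq0 -lt0n|rewrite ccoef_cosn_rec].
have : ccoef (cosn n) n + scoef (sinn n) n = tau.
  rewrite -[RHS]mul1r -ip_cst /ccoef /scoef /ip -RintegralD; [|exact: measurable_period|exact: L2pM..].
  apply: eq_Rintegral => x _; rewrite /cst mulr1 -!expr2 cos2Dsin2//.
rewrite e; lra.
Qed.

Lemma scoef_sinnn n : (0 < n)%N -> scoef (sinn n) n = pi.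
Proof.
move=> n0; rewrite -(ccoef_cosnn n0).
by apply: (@mulfI _ n%:R); [rewrite pnatr_eq0 -lt0n|rewrite ccoef_cosn_rec].
Qed.

Lemma ccoef_cst c n : (0 < n)%N -> ccoef (cst c) n = 0.
Proof.
move=> n0; have -> : cst c = (fun x => c * cosn 0 x).
  by apply/funext => x; rewrite /cosn mul0r cos0 mulr1.
by rewrite /ccoef ipZl// -/(ccoef _ _) ccoef_cosn ?mulr0// eq_sym -lt0n.
Qed.

Lemma scoef_cst c n : scoef (cst c) n = 0.
Proof.
have -> : cst c = (fun x => c * cosn 0 x).
  by apply/funext => x; rewrite /cosn mul0r cos0 mulr1.
by rewrite /scoef ipZl// -/(scoef _ _) scoef_cosn ?mulr0.
Qed.

Definition trig (c s : nat -> R) N x :=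
  \sum_(i < N) (c i * cosn i.+1 x + s i * sinn i.+1 x).

Lemma per_trig c s N : per (trig c s N).
Proof. by move=> x; apply: eq_bigr => i _; rewrite per_cosn per_sinn. Qed.

Lemma L2p_trig_term c s i : L2p (fun x => c i * cosn i.+1 x + s i * sinn i.+1 x).
Proof. by apply: L2pD; exact: L2pZ. Qed.

Lemma L2p_trig c s N : L2p (trig c s N).
Proof. exact: (L2p_sum (F := fun i x => c i * cosn i.+1 x + s i * sinn i.+1 x) _ (L2p_trig_term c s)). Qed.

Lemma ip_trig f c s N : L2p f ->
  ip (trig c s N) f = \sum_(i < N) (c i * ccoef f i.+1 + s i * scoef f i.+1).
Proof.
move=> hf; rewrite (ip_suml _ (L2p_trig_term c s) hf).
apply: eq_bigr => i _; rewrite ipDl; [|exact: L2pZ|exact: L2pZ|by []].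
by rewrite !ipZl// (ipC (cosn _)) (ipC (sinn _)).
Qed.

Lemma ccoef_trig c s N k : ccoef (trig c s N) k.+1 = if (k < N)%N then c k * pi else 0.
Proof.
rewrite /ccoef ip_trig//; case: ifPn => kN.
- rewrite (bigD1 (Ordinal kN))//= big1 ?addr0.
    rewrite {1}/ccoef -/(ccoef _ _) ccoef_cosnn// scoef_cosn mulr0 addr0//.
  move=> i ik; rewrite ccoef_cosn ?mulr0 ?add0r ?scoef_cosn ?mulr0//.
  by rewrite eqSS; apply: contra ik => /eqP e; apply/eqP/val_inj.
- rewrite big1// => i _; rewrite ccoef_cosn ?mulr0 ?add0r ?scoef_cosn ?mulr0//.
  by rewrite eqSS; apply: contra kN => /eqP ->.
Qed.

Lemma scoef_trig c s N k : scoef (trig c s N) k.+1 = if (k < N)%N then s k * pi else 0.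
Proof.
rewrite /scoef ip_trig//; case: ifPn => kN.
- rewrite (bigD1 (Ordinal kN))//= big1 ?addr0.
    by rewrite ccoef_sinn mulr0 add0r scoef_sinnn.
  move=> i ik; rewrite ccoef_sinn mulr0 add0r scoef_sinn ?mulr0//.
  by rewrite eqSS; apply: contra ik => /eqP e; apply/eqP/val_inj.
- rewrite big1// => i _; rewrite ccoef_sinn mulr0 add0r scoef_sinn ?mulr0//.
  by rewrite eqSS; apply: contra kN => /eqP ->.
Qed.

Lemma ccoef0_trig c s N : ccoef (trig c s N) 0 = 0.
Proof.
rewrite /ccoef ip_trig// big1// => i _.
by rewrite ccoef_cosn// scoef_cosn !mulr0 addr0.
Qed.

Lemma ip_trig_trig c s N :
  ip (trig c s N) (trig c s N) = pi * \sum_(i < N) (c i ^+ 2 + s i ^+ 2).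
Proof.
rewrite ip_trig; last exact: L2p_trig.
rewrite mulr_sumr; apply: eq_bigr => i _.
by rewrite ccoef_trig scoef_trig ltn_ord; ring.
Qed.

(** Squared amplitude of the harmonic of frequency i + 1. *)
Definition amp2 f i := ccoef f i.+1 ^+ 2 + scoef f i.+1 ^+ 2.

Lemma amp2_ge0 f i : 0 <= amp2 f i. Proof. by rewrite addr_ge0// sqr_ge0. Qed.

(** The partial sum of the Fourier series is an orthogonal projection, so the
    squared norm of the remainder is the difference of the two sides. *)
Lemma bessel f N : L2p f -> \sum_(i < N) amp2 f i <= pi * ip f f.
Proof.
move=> hf; pose t := trig (fun i => ccoef f i.+1 / pi) (fun i => scoef f i.+1 / pi) N.
have ht : L2p t by exact: L2p_trig.
have p0 : (0 : R) < pi by exact: pi_gt0.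
have pn0 : (pi : R) != 0 by rewrite gt_eqF.
have : 0 <= ip (fun x => f x - t x) (fun x => f x - t x) by exact: ip_ge0.
rewrite ipBl//; last exact: L2pB.
rewrite !ipBr// (ipC f t).
have e1 : ip t f = pi^-1 * \sum_(i < N) amp2 f i.
  rewrite ip_trig// mulr_sumr; apply: eq_bigr => i _.
  rewrite /amp2; move: (ccoef _ _) (scoef _ _) (pi : R) pn0 => a b q qn.
  by field.
have e2 : ip t t = pi^-1 * \sum_(i < N) amp2 f i.
  rewrite ip_trig_trig !mulr_sumr; apply: eq_bigr => i _.
  rewrite /amp2; move: (ccoef _ _) (scoef _ _) (pi : R) pn0 => a b q qn.
  by field.
rewrite e1 e2 subrr subr0 subr_ge0 => h.
by rewrite -ler_pdivrMl// .
Qed.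

End SquareIntegrable.

(** * Functions that are Lipschitz for the chord distance *)

Section Uniqueness.
Variable R : realType.
Implicit Types (f g : R -> R) (x y u v : R).
Local Notation mu := (@lebesgue_measure R).
Local Notation P := (period R).
Local Notation tau := (2 * @pi R).
Local Notation itg f := (mu.-integrable P (EFin \o f)).
Hint Resolve L2p_cosn L2p_sinn L2p_cst : core.

Lemma measurable_inv : measurable_fun setT (@GRing.inv R).
Proof.
have -> : [set: R] = [set~ 0] `|` [set 0] by rewrite setUC setUv.
apply/measurable_funU; first exact: measurableC.
  by [].
split; last exact: measurable_fun_set1.
apply: subspace_continuous_measurable_fun; first exact: measurableC.
apply: continuous_in_subspaceT => x /[!inE] /eqP x0.
exact: inv_continuous.
Qed.

Lemma ge0_derive_ge0 f (df : R -> R) v : 0 <= v -> f 0 = 0 ->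
  (forall x, is_derive x 1 f (df x)) -> (forall x, 0 <= x -> 0 <= df x) -> 0 <= f v.
Proof.
rewrite le_eqVlt => /predU1P[<- ->//|v0] f0 d d0.
have [|c /[!in_itv]/= /andP[c0 _]] := @MVT R f df 0 v v0.
- exact/continuous_subspaceT/(is_derive_continuous d).
- by rewrite f0 !subr0 => ->; rewrite mulr_ge0 ?d0// ltW.
Qed.

(** sin v is at least its Taylor polynomial v - v^3 / 6, and v^2 <= 4. *)
Lemma sin_ge_third v : 0 <= v <= 2 -> v / 3 <= sin v.
Proof.
move=> /andP[v0 v2].
have h1 (w : R) : 0 <= w -> 0 <= w - sin w.
  move=> w0; apply: (@ge0_derive_ge0 (fun x => x - sin x) (fun x => 1 - cos x)) => //.
  - by rewrite sin0 subr0.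
have h2 (w : R) : 0 <= w -> 0 <= cos w - 1 + w ^+ 2 / 2.
  move=> w0; apply: (@ge0_derive_ge0 (fun x => cos x - 1 + x ^+ 2 / 2) (fun x => x - sin x)) => //.
  - by rewrite cos0 subrr expr0n mul0r addr0.
  - move=> x; apply: is_derive_eq; rewrite /GRing.scale/=; by field.
have h3 : 0 <= sin v - v + v ^+ 3 / 6.
  apply: (@ge0_derive_ge0 (fun x => sin x - x + x ^+ 3 / 6) (fun x => cos x - 1 + x ^+ 2 / 2)) => //.
  - by rewrite sin0 subr0 expr0n mul0r addr0.
  - move=> x; apply: is_derive_eq; rewrite /GRing.scale/=; by field.
nra.
Qed.

Lemma onem_cos_half u : 1 - cos u = 2 * sin (u / 2) ^+ 2.
Proof.
rewrite [in LHS](_ : u = u / 2 + u / 2); last by field.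
by rewrite cosD -!expr2 cos2sin2; ring.
Qed.

Lemma onem_cos_ge u : `|u| <= pi -> u ^+ 2 <= 18 * (1 - cos u).
Proof.
move=> up; have : `|u| / 2 / 3 <= sin (`|u| / 2).
  apply: sin_ge_third; rewrite divr_ge0//=.
  by rewrite (le_trans _ (ltW (pihalf_lt2 R)))// ler_pM2r.
rewrite -[u ^+ 2]real_normK ?num_real// onem_cos_half.
have -> : sin (u / 2) ^+ 2 = sin (`|u| / 2) ^+ 2.
  by have [_|_] := ger0P u; rewrite // mulNr sinN sqrrN.
have := normr_ge0 u; nra.
Qed.

(** Lipschitz condition for the chord distance on the circle, whose square is
    2 (1 - cos (x - y)). *)
Definition chord_lip f (C : R) := forall x y, (f x - f y) ^+ 2 <= C * (1 - cos (x - y)).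

Lemma onem_cos_ge0 u : 0 <= 1 - cos u :> R.
Proof. by rewrite subr_ge0 cos_le1. Qed.

Lemma cos_per : per (@cos R).
Proof. by move=> z; rewrite mulr_natl cosD2pi. Qed.

Lemma sin_per : per (@sin R).
Proof. by move=> z; rewrite mulr_natl sinD2pi. Qed.

Lemma derive_bound_lip f (df : R -> R) L x y :
  (forall x, is_derive x 1 f (df x)) -> (forall x, `|df x| <= L) ->
  `|f x - f y| <= L * `|x - y|.
Proof.
move=> d b; wlog xy : x y / x <= y.
  move=> H; have /orP[|] := le_total x y; first exact: H.
  by move=> /H; rewrite distrC (distrC y).
have [|c _ e] := @MVT_segment R f df x y xy.
- exact/continuous_subspaceT/(is_derive_continuous d).
- by rewrite distrC (distrC x) e normrM ler_wpM2r.
Qed.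

(** After a shift by a multiple of 2pi the two angles differ by at most pi,
    where the arc is comparable with the chord. *)
Lemma derive_bound_chord_lip f (df : R -> R) L : per f ->
  (forall x, is_derive x 1 f (df x)) -> (forall x, `|df x| <= L) ->
  chord_lip f (18 * L ^+ 2).
Proof.
move=> pf d b x y.
pose w := fold (x - y + pi) - pi.
have [k has_symbol] : exists k : int, w = x - y + k%:~R * tau.
  exists (- Num.floor ((x - y + pi) / tau)).
  by rewrite /w /fold mulrNz mulNr; ring.
have wp : `|w| <= pi.
  have /andP[h1 h2] := fold_itv (x - y + pi).
  by rewrite ler_norml /w lerBrDr addNr h1/= lerBlDr -mulr2n -mulr_natl ltW.
have L0 : 0 <= L by exact: le_trans (b 0).
have := derive_bound_lip (y + w) y d b.
have -> : f (y + w) = f x.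
  by rewrite has_symbol addrA addrCA subrr addr0 per_int.
rewrite addrAC subrr add0r.
have -> : cos (x - y) = cos w by rewrite has_symbol per_int//; exact: cos_per.
move=> h; rewrite -(real_normK (num_real (f x - f y))).
apply: (@le_trans _ _ ((L * `|w|) ^+ 2)).
  by rewrite ler_pXn2r// nnegrE mulr_ge0.
rewrite exprMn real_normK ?num_real//.
have := onem_cos_ge wp; have := sqr_ge0 L; nra.
Qed.

Lemma is_derive_per f (df : R -> R) : per f ->
  (forall x, is_derive x 1 f (df x)) -> per df.
Proof.
move=> pf d x; have dx := d x; have dx' := d (x + tau).
have h : is_derive x 1 f (df (x + tau)).
  have s : is_derive x 1 (fun y => y + tau) (1 : R).
    by rewrite -[X in is_derive _ _ _ X]addr0; exact: is_deriveD.
  have := @is_derive1_comp _ f (fun y => y + tau) x _ _ dx' s; rewrite mulr1.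
  by rewrite (_ : f \o _ = f)//; apply/funext => z /=; rewrite pf.
by rewrite -(@derive_val _ _ _ _ _ _ _ h) (@derive_val _ _ _ _ _ _ _ dx).
Qed.

Lemma C1_chord_lip f (df : R -> R) : per f ->
  (forall x, is_derive x 1 f (df x)) -> continuous df -> exists2 C : R, 0 <= C & chord_lip f C.
Proof.
move=> pf d c; have pdf := is_derive_per pf d.
have [M M0 hM] := per_continuous_bounded pdf c.
by exists (18 * M ^+ 2); [rewrite mulr_ge0// sqr_ge0|exact: (derive_bound_chord_lip pf d)].
Qed.

Lemma L2p_shift f s : L2p f -> L2p (fun x => f (x + s)).
Proof.
move=> [pf mf fi]; split.
- by move=> x; rewrite addrAC pf.
- by apply: measurableT_comp => //; exact: measurable_funD.
- have := integrable_circle_lift (circle_lift_shift s) (measurable_funX 2 mf) _ fi.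
  rewrite /per => /(_ (fun x => congr1 (fun z => z ^+ 2) (pf x))).
  by congr integrable; apply/funext => x; rewrite /= mulr1.
Qed.

Lemma ip_shift f g s : L2p f -> L2p g ->
  ip (fun x => f (x + s)) g = ip f (fun x => g (x - s)).
Proof.
move=> [pf mf _] [pg mg _]; rewrite /ip [RHS](integral_circle_lift (circle_lift_shift s)).
- by apply: eq_Rintegral => x _; rewrite mulr1 addrK.
- apply: measurable_funM => //; apply: measurableT_comp => //.
  exact: measurable_funD.
- by move=> x; rewrite pf addrAC pg.
Qed.

Lemma ccoef_shift f s n : L2p f ->
  ccoef (fun x => f (x + s)) n = cosn n s * ccoef f n + sinn n s * scoef f n.
Proof.
move=> hf; rewrite /ccoef ip_shift//.
have -> : (fun x => cosn n (x - s)) =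
    (fun x => cosn n s * cosn n x + sinn n s * sinn n x).
  by apply/funext => x; rewrite /cosn mulrBr cosB mulrC [X in _ + X]mulrC.
by rewrite ipDr ?ipZr//; exact: L2pZ.
Qed.

Lemma scoef_shift f s n : L2p f ->
  scoef (fun x => f (x + s)) n = cosn n s * scoef f n - sinn n s * ccoef f n.
Proof.
move=> hf; rewrite /scoef ip_shift//.
have -> : (fun x => sinn n (x - s)) =
    (fun x => cosn n s * sinn n x - sinn n s * cosn n x).
  by apply/funext => x; rewrite /sinn mulrBr sinB mulrC [X in _ - X]mulrC.
by rewrite ipBr ?ipZr//; exact: L2pZ.
Qed.

Lemma scoef0 f : scoef f 0 = 0.
Proof.
rewrite /scoef /ip; under eq_Rintegral do rewrite /sinn mul0r sin0 mulr0.
by rewrite Rintegral_cst; [rewrite mul0r|exact: measurable_period].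
Qed.

Lemma ccoef0_cst c : ccoef (cst c) 0 = c * tau.
Proof.
rewrite -ip_cst /ccoef; congr ip.
by apply/funext => x; rewrite /cosn mul0r cos0.
Qed.

(** Chernoff's argument: with D x = f (x + x0) - f x0, the function
    r = D * sin / (1 - cos) is bounded, and r * (sin (n+1) - sin n) =
    D * (cos (n+1) + cos n) forces the sine coefficients of r to be constant,
    hence zero by Bessel's inequality. *)
Lemma chord_lip_uniqueness f C : L2p f -> chord_lip f C ->
  (forall n, (0 < n)%N -> ccoef f n = 0 /\ scoef f n = 0) ->
  f = cst (ccoef f 0 / tau).
Proof.
move=> hf lf f0; apply/funext => x0 /=.
have [pf mf _] := hf.
pose D x := f (x + x0) - f x0.
pose r x := D x * sin x / (1 - cos x).
have mc : measurable_fun setT (@cos R) by apply: continuous_measurable_fun; exact: continuous_cos.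
have ms : measurable_fun setT (@sin R) by apply: continuous_measurable_fun; exact: continuous_sin.
have hD : L2p D by apply: (L2pB (L2p_shift x0 hf)); exact: L2p_cst.
have C0 : 0 <= C.
  have := lf pi 0; rewrite subr0 cospi opprK => /(le_trans (sqr_ge0 _)).
  by rewrite pmulr_lge0.
have D0 x : cos x = 1 -> D x = 0.
  move=> cx; have := lf (x + x0) x0; rewrite addrK cx subrr mulr0.
  by rewrite -/(D x) => h; apply/eqP; rewrite -sqrf_eq0 eq_le h sqr_ge0.
have s0 x : cos x = 1 -> sin x = 0 :> R.
  by move=> cx; apply/eqP; rewrite -sqrf_eq0 sin2cos2 cx expr1n subrr.
have hr : L2p r.
  apply: (@L2p_bounded _ _ (C *+ 2 + 1)).
  - by move=> x; rewrite /r /D addrAC pf sin_per cos_per.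
  - have [_ mD _] := hD.
    apply: measurable_funM; first exact: measurable_funM.
    have -> : (fun x => (1 - cos x)^-1) = (@GRing.inv R) \o (fun x => 1 - cos x) by [].
    by apply: (measurableT_comp measurable_inv); exact: measurable_funB.
  - move=> x; have [cx|cx] := eqVneq (cos x) 1.
      by rewrite /r s0// mulr0 mul0r normr0 addr_ge0// mulrn_wge0.
    have p : 0 < 1 - cos x by rewrite lt_neqAle onem_cos_ge0 andbT eq_sym subr_eq0 eq_sym.
    have : r x ^+ 2 <= C *+ 2.
      rewrite /r !exprMn exprVn ler_pdivrMr ?exprn_gt0// sin2cos2.
      have := lf (x + x0) x0; rewrite addrK -/(D x) => h.
      have := cos_geN1 x; have := sqr_ge0 (D x).
      move: (cos x) (D x ^+ 2) p h => c d p h d0 c1.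
      have -> : d * (1 - c ^+ 2) = d * (1 + c) * (1 - c) by ring.
      have -> : C *+ 2 * (1 - c) ^+ 2 = C * (1 - c) * 2 * (1 - c) by ring.
      rewrite ler_pM2r//; nra.
    rewrite -(real_normK (num_real (r x))); have := normr_ge0 (r x).
    rewrite mulr2n; move: (`|r x|) => q; nra.
have rec n : scoef r n.+1 - scoef r n = ccoef D n.+1 + ccoef D n.
  rewrite /scoef /ccoef -ipBr// -ipDr//; apply: eq_Rintegral => x _.
  rewrite /sinn /cosn -natr1 mulrDl mul1r sinD cosD.
  have e1 : r x * (1 - cos x) = D x * sin x.
    have [cx|cx] := eqVneq (cos x) 1; first by rewrite cx subrr mulr0 s0// mulr0.
    by rewrite /r divfK// subr_eq0 eq_sym.
  have e2 : r x * sin x = D x * (1 + cos x).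
    have [cx|cx] := eqVneq (cos x) 1; first by rewrite s0// D0// mulr0 mul0r.
    have h : 1 - cos x != 0 by rewrite subr_eq0 eq_sym.
    apply: (mulIf h); rewrite mulrAC e1 -mulrA -expr2 sin2cos2; ring.
  move: (sin (n%:R * x)) (cos (n%:R * x)) => S c.
  have -> : r x * (S * cos x + c * sin x - S) = c * (r x * sin x) - S * (r x * (1 - cos x)) by ring.
  by rewrite e1 e2; ring.
have cD n : (0 < n)%N -> ccoef D n = 0.
  move=> n0; have [h1 h2] := f0 n n0.
  rewrite /D /ccoef (ipBl (L2p_shift x0 hf) (L2p_cst (f x0)) (L2p_cosn _ n)).
  by rewrite -!/(ccoef _ _) ccoef_shift// h1 h2 !mulr0 addr0 sub0r ccoef_cst// oppr0.
have r1 n : scoef r n.+1 = scoef r 1.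
  elim: n => // n IH; rewrite -IH; apply/eqP; rewrite -subr_eq0 rec.
  by rewrite !cD// addr0.
have : scoef r 1 = 0.
  have B N : N%:R * scoef r 1 ^+ 2 <= pi * ip r r.
    apply: le_trans (bessel N hr).
    rewrite mulr_natl -[N in X in X <= _]card_ord -sumr_const ler_sum// => i _.
    by rewrite /amp2 r1 lerDr sqr_ge0.
  apply/eqP; rewrite -sqrf_eq0 eq_le sqr_ge0 andbT leNgt; apply/negP => a0.
  pose N := (Num.truncn (pi * ip r r / scoef r 1 ^+ 2)).+1.
  have := B N; rewrite leNgt => /negP; apply.
  by rewrite -ltr_pdivrMr// /N truncnS_gt.
have := rec 0%N; rewrite scoef0 subr0 cD// add0r => -> .
rewrite /D /ccoef (ipBl (L2p_shift x0 hf) (L2p_cst (f x0)) (L2p_cosn _ 0)).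
rewrite -!/(ccoef _ _) ccoef_shift// ccoef0_cst /cosn /sinn mul0r cos0 sin0 mul0r addr0 mul1r.
move=> /eqP; rewrite subr_eq0 => /eqP ->.
by rewrite mulfK// gt_eqF// tau_gt0.
Qed.

End Uniqueness.

(** * Periodic primitives and uniqueness of Fourier coefficients *)

Section Primitive.
Variable R : realType.
Implicit Types (f g : R -> R) (x y u v a b c : R).
Local Notation mu := (@lebesgue_measure R).
Local Notation P := (period R).
Local Notation tau := (2 * @pi R).
Local Notation itg f := (mu.-integrable P (EFin \o f)).
Local Notation Int a b f := (\int[mu]_(t in `[a%R, b%R]) f t).
Hint Resolve L2p_cosn L2p_sinn L2p_cst : core.

Lemma Rintegral_shift f a b c : measurable_fun setT f ->
  Int (a + c) (b + c) f = Int a b (fun x => f (x + c)).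
Proof.
move=> mf; rewrite /Rintegral; congr fine.
have mef : measurable_fun setT (EFin \o f) by exact/measurable_EFinP.
rewrite integralE [RHS]integralE; congr (_ - _)%E.
- have := ge0_integral_shift a b c (measurable_funepos mef) (@funepos_ge0 _ _ _).
  by move=> ->; apply: eq_integral => x _; rewrite !funeposE.
- have := ge0_integral_shift a b c (measurable_funeneg mef) (@funeneg_ge0 _ _ _).
  by move=> ->; apply: eq_integral => x _; rewrite !funenegE.
Qed.

Lemma Rintegral_period f c : measurable_fun setT f -> per f ->
  Int c (c + tau) f = \int[mu]_(x in P) f x.
Proof.
move=> mf pf; rewrite /Rintegral; congr fine.
have mef : measurable_fun setT (EFin \o f) by exact/measurable_EFinP.
rewrite integralE [RHS]integralE; congr (_ - _)%E.
- by apply: ge0_integral_period => // [|x]; [exact: measurable_funepos|rewrite !funeposE/= pf].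
- by apply: ge0_integral_period => // [|x]; [exact: measurable_funeneg|rewrite !funenegE/= pf].
Qed.

Section Prim.
Variable f : R -> R.
Hypotheses (pf : per f) (mf : measurable_fun setT f) (fi : itg f).

Lemma integrable_itv a b : mu.-integrable `[a, b] (EFin \o f).
Proof.
have mef : measurable_fun setT (EFin \o f) by exact/measurable_EFinP.
have maf : measurable_fun setT (abse \o (EFin \o f)) by exact: measurableT_comp.
have h c n : (\int[mu]_(x in `[c, (c + n%:R * tau)%R]) `|(f x)%:E| < +oo)%E.
  elim: n => [|n IH].
    by rewrite mul0r addr0 set_itv1 integral_set1.
  have tn : 0 <= n%:R * tau by rewrite mulr_ge0// ltW// tau_gt0.
  rewrite (@ge0_integral_itvD _ (abse \o (EFin \o f)) _ (c + n%:R * tau))//.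
  - apply: lte_add_pinfty => //.
    rewrite (_ : c + n.+1%:R * tau = c + n%:R * tau + tau); last by ring.
    rewrite (@ge0_integral_period _ (abse \o (EFin \o f)))//.
    + by case/integrableP: fi.
    + by move=> x; exact: abse_ge0.
    + by move=> x /=; rewrite pf.
  - by move=> x; exact: abse_ge0.
  - by rewrite lerDl.
  - by rewrite lerD2l ler_pM2r ?tau_gt0// ler_nat.
pose n := (Num.truncn ((b - a) / tau)).+1.
apply: (@integrableS _ _ _ mu `[a, a + n%:R * tau]) => //.
  move=> x /=; rewrite !in_itv/= => /andP[-> xb]/=; rewrite (le_trans xb)//.
  rewrite -lerBlDl -ler_pdivrMr ?tau_gt0// ltW// truncnS_gt//.
by apply/integrableP; split; [exact: measurable_funTS|exact: h].
Qed.

Lemma Rintegral_itvD a b c : a <= b -> b <= c ->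
  Int a c f = Int a b f + Int b c f.
Proof.
move=> ab bc; apply/eqP; rewrite addrC -subr_eq; apply/eqP.
rewrite Rintegral_itvB ?bnd_simp//; last exact: integrable_itv.
rewrite Rintegral_itv_obnd_cbnd//.
by apply: integrableS (integrable_itv b c) => //; apply: subset_itvr; rewrite bnd_simp.
Qed.

(** The periodic primitive of a periodic function of mean zero. *)
Definition prim x := Int 0 (fold x) f.

Hypothesis f0 : \int[mu]_(x in P) f x = 0.

Lemma fold_shift x (k : int) : fold (x + k%:~R * tau) = fold x.
Proof.
rewrite /fold [(x + _) / _]mulrDl mulfK ?gt_eqF ?tau_gt0//.
by rewrite floorDrz ?intr_int// intrD intrKfloor; ring.
Qed.

Lemma per_prim : per prim.
Proof. by move=> x; rewrite /prim -{1}[tau]mul1r (fold_shift x 1). Qed.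

(** The mean value of f is zero, so a full period contributes nothing and the
    integral may start at any earlier multiple of 2pi. *)
Lemma primE (j : int) x : j%:~R * tau <= x -> prim x = Int (j%:~R * tau) x f.
Proof.
move=> jx.
have stp a y n : a <= y -> Int a (y + n%:R * tau) f = Int a y f.
  move=> ay; elim: n => [|n IH]; first by rewrite mul0r addr0.
  have tn : 0 <= n%:R * tau by rewrite mulr_ge0// ltW// tau_gt0.
  have e : y + n.+1%:R * tau = y + n%:R * tau + tau by ring.
  rewrite e (@Rintegral_itvD a (y + n%:R * tau) (y + n%:R * tau + tau)).
  - rewrite IH Rintegral_period// f0 addr0//.
  - by rewrite (le_trans ay)// lerDl.
  - by rewrite lerDl ltW// tau_gt0.
pose k := Num.floor (x / tau).
have jk : (j <= k)%R.
  by rewrite floor_ge_int ler_pdivlMr// tau_gt0.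
have [n kn] : exists n : nat, k = j + n%:Z.
  by exists `|k - j|%N; rewrite gez0_abs ?subr_ge0// subrKC.
have -> : x = fold x + j%:~R * tau + n%:R * tau.
  by rewrite /fold -/k kn intrD; ring.
rewrite stp; last by rewrite lerDr; have /andP[] := fold_itv x.
rewrite -[X in Int X _ _]add0r Rintegral_shift//.
rewrite /prim -addrA -mulrDl (_ : j%:~R + n%:R = (j + n%:Z)%:~R); last by rewrite intrD.
rewrite fold_shift [in LHS](_ : fold (fold x) = fold x); last first.
  by rewrite {2}/fold -mulNr -mulrNz fold_shift.
by apply: eq_Rintegral => y _; rewrite per_int.
Qed.

Lemma prim_near x : exists a b, [/\ a < x, x < b &
  forall y, a <= y -> prim y = Int a y f].
Proof.
pose j := Num.floor (x / tau) - 1.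
exists (j%:~R * tau), (x + 1); split.
- have /andP[h _] := floor_itv (x / tau).
  rewrite -ltr_pdivlMr ?tau_gt0// (lt_le_trans _ h)// /j ltr_int.
  by rewrite ltrBlDr ltrDl.
- by rewrite ltrDl.
- by move=> y; exact: primE.
Qed.

Lemma continuous_prim : continuous prim.
Proof.
move=> x; have [a [b [ax xb ab]]] := prim_near x.
have := parameterized_integral_continuous (ltW (lt_trans ax xb)) (integrable_itv a b).
move=> /(continuous_within_itvP _ (lt_trans ax xb)) [h _ _].
have /h : x \in `]a, b[ by rewrite in_itv/= ax xb.
rewrite /continuous_at {2}/parameterized_integral -ab ?ltW//.
apply: cvg_trans; apply: near_eq_cvg.
near=> y; rewrite /parameterized_integral -ab//.
near: y; exact: lt_le_nbhsr ax.
Unshelve. all: by end_near. Qed.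

Lemma is_derive_prim x : {for x, continuous f} -> is_derive x 1 prim (f x).
Proof.
move=> cx; have [a [b [ax xb ab]]] := prim_near x.
have [d1 d2] := continuous_FTC1_closed xb (integrable_itv a b) ax cx.
apply: (@near_eq_is_derive _ _ _ (fun y => Int a y f)).
  near=> y; rewrite -ab//.
  near: y; exact: lt_le_nbhsr ax.
by apply: DeriveDef; [exact: d1|rewrite -derive1E; exact: d2].
Unshelve. all: by end_near. Qed.

Lemma prim_period x : P x -> prim x = Int 0 x f.
Proof.
rewrite /period/= in_itv/= => /andP[x0 _].
by have := @primE 0 x; rewrite mul0r => ->.
Qed.

(** No regularity of f is available, so integration by parts is replaced by
    Fubini on the triangle t <= x. *)
Lemma ip_prim g (dg : R -> R) : per g -> (forall x, is_derive x 1 g (dg x)) ->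
  continuous dg -> ip prim dg = - ip f g.
Proof.
move=> pg d c.
have pdg := is_derive_per pg d.
have [M M0 hM] := per_continuous_bounded pdg c.
pose k (z : R * R) : R := f z.2 * dg z.1 *
  (\1_P z.1 * (\1_P z.2 * ((z.2 <= z.1)%R)%:R)).
have mk : measurable_fun setT k.
  apply: measurable_funM; first apply: measurable_funM.
  - exact: measurable_snd_comp.
  - by apply: measurable_fst_comp; exact: continuous_measurable_fun.
  - apply: measurable_funM.
      by apply: measurable_fst_comp; exact: measurable_indic_period.
    apply: measurable_funM.
      by apply: measurable_snd_comp; exact: measurable_indic_period.
    apply: (measurableT_comp (f := fun b : bool => b%:R : R)) => //.
    by apply: measurable_fun_ler.
have k1 x : \int[mu]_y k (x, y) = (prim x * dg x) * \1_P x.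
  rewrite /k /=; have [Px|nPx] := pselect (P x); last first.
    rewrite [\1_P x](_ : _ = 0); last by rewrite indicE memNset.
    under eq_Rintegral do rewrite mul0r mulr0.
    by rewrite Rintegral_cst// mul0r mulr0.
  rewrite [\1_P x](_ : _ = 1); last by rewrite indicE mem_set.
  rewrite mulr1 prim_period// mulrC -RintegralZl//; last exact: integrable_itv.
  rewrite [RHS]Rintegral_mkcond; apply: eq_Rintegral => y _.
  rewrite patchE mul1r; case: ifPn => [|].
    rewrite inE/= in_itv/= => /andP[y0 yx].
    rewrite yx mulr1 indicE mem_set ?mulr1 1?mulrC//.
    move: Px; rewrite /period/= !in_itv/= y0 => /andP[_ xt].
    by rewrite (le_trans yx xt).
  rewrite notin_setE/= in_itv/= => /negP; rewrite negb_and.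
  move=> /orP[y0|yx].
    rewrite indicE memNset ?mul0r ?mulr0//= /period /= in_itv/=.
    by move=> /andP[] /(negP y0).
  by rewrite (negbTE yx) !mulr0.
have k2 y : \int[mu]_x k (x, y) = (f y * (g tau - g y)) * \1_P y.
  rewrite /k /=; have [Py|nPy] := pselect (P y); last first.
    rewrite [\1_P y](_ : _ = 0); last by rewrite indicE memNset.
    under eq_Rintegral do rewrite mul0r !mulr0.
    by rewrite Rintegral_cst// mul0r mulr0.
  rewrite [\1_P y](_ : _ = 1); last by rewrite indicE mem_set.
  rewrite mulr1; have [y0 yt] : 0 <= y /\ y <= tau.
    by apply/andP; move: Py; rewrite /period/= in_itv.
  have [yt'|yt'] := ltP y tau; last first.
    have -> : y = tau by apply/eqP; rewrite eq_le yt yt'.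
    rewrite subrr mulr0.
    rewrite (_ : \int[mu]_x _ = \int[mu]_x (((fun x => f tau * dg x) \_ [set tau]) x)).
      by rewrite -Rintegral_mkcond Rintegral_set1.
    apply: eq_Rintegral => x _; rewrite patchE; case: ifPn => [|].
      rewrite inE /= => ->; rewrite lexx indicE mem_set ?mulr1//.
      by rewrite /period/= in_itv/= lexx ltW// tau_gt0.
    rewrite notin_setE/= => xt; rewrite mul1r.
    have [Px|nPx] := pselect (P x); last by rewrite indicE memNset ?mul0r ?mulr0.
    have [h|h] := leP tau x; last by rewrite !mulr0.
    exfalso; apply: xt; apply/eqP; rewrite eq_le h andbT.
    by move: Px; rewrite /period/= in_itv/= => /andP[].
  rewrite -(Rintegral_FTC yt' d c) -RintegralZl//; last first.
    apply: continuous_compact_integrable; first exact: segment_compact.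
    exact: continuous_subspaceT.
  rewrite [RHS]Rintegral_mkcond; apply: eq_Rintegral => x _.
  rewrite patchE mul1r; case: ifPn => [|].
    rewrite inE/= in_itv/= => /andP[yx xt].
    rewrite yx mulr1 indicE mem_set ?mulr1//.
    by rewrite /period/= in_itv/= (le_trans y0 yx).
  rewrite notin_setE/= in_itv/= => /negP; rewrite negb_and.
  move=> /orP[yx|xt].
    by rewrite (negbTE yx) !mulr0.
  rewrite indicE memNset ?mul0r ?mulr0//= /period /= in_itv/=.
  by move=> /andP[_] /(negP xt).
have kb x y : `|k (x, y)| <= (M * `|f y|) * \1_P y.
  rewrite /k /= !normrM [`|\1_P y|]ger0_norm ?indicE// [`|\1_P x|]ger0_norm ?indicE//.
  rewrite [`|f y| * _]mulrC; apply: ler_pM; rewrite ?mulr_ge0//.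
    by rewrite ler_wpM2r.
  rewrite -[leRHS]mul1r; apply: ler_pM; rewrite ?mulr_ge0//; first by case: (_ \in _).
  rewrite -[leRHS]mulr1; apply: ler_pM => //.
  by case: (y <= x); rewrite ?normr1 ?normr0.
have kb' x y : `|k (x, y)| <= (M * `|f y|) * \1_P x.
  rewrite /k /= !normrM [`|\1_P y|]ger0_norm ?indicE// [`|\1_P x|]ger0_norm ?indicE//.
  rewrite [`|f y| * _]mulrC; apply: ler_pM; rewrite ?mulr_ge0//.
    by rewrite ler_wpM2r.
  rewrite -[leRHS]mulr1; apply: ler_pM; rewrite ?mulr_ge0//.
  rewrite -[leRHS]mulr1; apply: ler_pM => //; first by case: (_ \in _).
  by case: (y <= x); rewrite ?normr1 ?normr0.
have ik : (mu \x mu)%E.-integrable setT (EFin \o k).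
  apply/integrable21ltyP; first exact/measurable_EFinP.
  have fi' := fi; move/integrableP : fi' => [_ fi'].
  apply: (@le_lt_trans _ _ (\int[mu]_y (((fun y => (M * tau)%:E * `|(f y)%:E|) \_ P) y))%E); last first.
    rewrite -integral_mkcond ge0_integralZl//.
    - by rewrite lte_mul_pinfty// lee_fin mulr_ge0// ltW// tau_gt0.
    - exact: measurable_period.
    - by apply: measurable_funTS; apply: measurableT_comp => //; exact/measurable_EFinP.
    - by rewrite lee_fin mulr_ge0// ltW// tau_gt0.
  have mak : measurable_fun setT (fun z => `|(k z)%:E|%E).
    by apply: measurableT_comp => //; exact/measurable_EFinP.
  apply: ge0_le_integral => //.
  - by move=> y _; apply: integral_ge0.
  - by apply: (@measurable_integral_fst _ (abse \o (EFin \o k))) => // z; exact: abse_ge0.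
  - apply: (measurable_restrictT _ _).1; first exact: measurable_period.
    apply: measurable_funTS; apply: emeasurable_funM => //.
    by apply: measurableT_comp => //; exact/measurable_EFinP.
  - move=> y _; apply: (@le_trans _ _ (\int[mu]_x (((cst (M%:E * `|(f y)%:E| * (\1_P y)%:E)%E) \_ P) x))%E).
      apply: ge0_le_integral => //.
      + by apply: measurableT_comp => //; apply/measurable_EFinP; exact: measurable_section_fst.
      + apply: (measurable_restrictT _ _).1; first exact: measurable_period.
        exact: measurable_cst.
      + move=> x _; rewrite patchE; case: ifPn => xP /=; first by rewrite lee_fin kb.
        by rewrite lee_fin (le_trans (kb' x y))// indicE (negbTE xP) mulr0.
    rewrite -integral_mkcond integral_cst; last exact: measurable_period.
    rewrite [X in (_ * X)%E]period_measure patchE indicE; case: ifPn => yP.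
      by rewrite mule1 -!EFinM lee_fin le_eqVlt mulrAC eqxx.
    by rewrite mule0 mul0e.
have iP (h : R -> R) : itg h -> mu.-integrable setT (fun x => (h x * \1_P x)%:E).
  move=> /itg_patch; congr integrable; apply/funext => x.
  by rewrite /= patch_indic.
have mkx x : measurable_fun setT (fun y => (k (x, y))%:E).
  by apply/measurable_EFinP; exact: measurable_section_snd.
have mky y : measurable_fun setT (fun x => (k (x, y))%:E).
  by apply/measurable_EFinP; exact: measurable_section_fst.
have E1 x : (\int[mu]_y (k (x, y))%:E = ((prim x * dg x) * \1_P x)%:E)%E.
  rewrite -k1 /Rintegral fineK//; apply: integrable_fin_num => //.
  apply: (le_integrable _ _ _ (iP (fun y => M * `|f y|) _)) => //.
    exact: mkx.
    by move=> y _ /=; rewrite lee_fin (le_trans (kb _ _))// ler_norm.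
  apply: itgZ; apply: (itg_le _ _ ((integrable_norm fi))) => //=.
    exact: measurableT_comp.
  by move=> y _; rewrite normr_id.
have E2 y : (\int[mu]_x (k (x, y))%:E = ((f y * (g tau - g y)) * \1_P y)%:E)%E.
  rewrite -k2 /Rintegral fineK//; apply: integrable_fin_num => //.
  apply: (le_integrable _ _ _ (iP (fun x => M * `|f y|) _)) => //.
    exact: mky.
    by move=> x _ /=; rewrite lee_fin (le_trans (kb' _ _))// ler_norm.
  exact: itg_cst.
have := Fubini ik; rewrite /fubini_F /fubini_G.
under eq_integral do rewrite /= E1.
under [X in _ = X -> _]eq_integral do rewrite /= E2.
have iPE (h : R -> R) : fine (\int[mu]_x (h x * \1_P x)%:E) = \int[mu]_(x in P) h x.
  rewrite /Rintegral [in RHS]integral_mkcond; congr fine.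
  by apply: eq_integral => x _; rewrite epatch_indic.
move=> /(congr1 fine); rewrite !iPE /ip => ->.
have cg := is_derive_continuous d.
have hg : measurable_fun setT g by exact: continuous_measurable_fun.
have [N N0 hN] := per_continuous_bounded pg cg.
transitivity (\int[mu]_(x in P) (g tau * f x - f x * g x)).
  by apply: eq_Rintegral => x _; ring.
have ifg : itg (fun x => f x * g x).
  apply: (itg_le _ _ (itgZ N ((integrable_norm fi)))) => /=.
    exact: measurable_funM.
  by move=> x _; rewrite normrM mulrC ler_wpM2r.
rewrite RintegralB//; last exact: itgZ.
  by rewrite RintegralZl// ?f0 ?mulr0 ?sub0r//; exact: measurable_period.
exact: measurable_period.
Qed.

End Prim.

Lemma L2p_prim f : L2p f -> \int[mu]_(x in P) f x = 0 -> L2p (prim f).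
Proof.
move=> hf f0; have [pf mf _] := hf; have fi := L2p_itg hf.
by apply: L2p_continuous; [exact: per_prim|exact: continuous_prim].
Qed.

Lemma ccoef_prim f n : L2p f -> \int[mu]_(x in P) f x = 0 ->
  n%:R * ccoef (prim f) n = - scoef f n.
Proof.
move=> hf f0; have [pf mf _] := hf; have fi := L2p_itg hf.
rewrite -ipZr ?(ip_prim pf mf fi f0 (per_sinn n) (is_derive_sinn n))//.
- exact/continuous_scale/continuous_cosn.
- exact: L2p_prim.
Qed.

Lemma scoef_prim f n : L2p f -> \int[mu]_(x in P) f x = 0 ->
  n%:R * scoef (prim f) n = ccoef f n.
Proof.
move=> hf f0; have [pf mf _] := hf; have fi := L2p_itg hf.
have := ip_prim pf mf fi f0 (per_cosn n) (is_derive_cosn n)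
  (continuous_scale (c := - n%:R) (@continuous_sinn R n)).
rewrite ipZr//; last exact: L2p_prim.
by rewrite mulNr => /eqP; rewrite eqr_opp => /eqP.
Qed.

Lemma ccoef0E f : ccoef f 0 = \int[mu]_(x in P) f x.
Proof.
by apply: eq_Rintegral => x _; rewrite /cosn mul0r cos0 mulr1.
Qed.

(** The primitive of f, and after subtraction of its mean the primitive of that
    primitive, have vanishing coefficients.  The second primitive is of class
    C^1, so it is constant by Chernoff's argument, hence the first primitive
    vanishes and f is zero almost everywhere by differentiation. *)
Lemma fourier_uniqueness f : L2p f ->
  (forall n, ccoef f n = 0 /\ scoef f n = 0) ->
  {ae mu, forall x, P x -> f x = 0}.
Proof.
move=> hf f0; have [pf mf _] := hf; have fi := L2p_itg hf.
have i0 : \int[mu]_(x in P) f x = 0 by rewrite -ccoef0E; case: (f0 0%N).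
pose F1 := prim f; have hF1 : L2p F1 by exact: L2p_prim.
have F1c n : (0 < n)%N -> ccoef F1 n = 0 /\ scoef F1 n = 0.
  move=> n0; have [c0 s0] := f0 n.
  have nn : (n%:R : R) != 0 by rewrite pnatr_eq0 -lt0n.
  by split; apply: (mulfI nn); rewrite ?ccoef_prim ?scoef_prim// ?c0 ?s0 ?oppr0 mulr0.
pose m := ccoef F1 0 / tau.
pose G x := F1 x - m; have hG : L2p G by exact: (L2pB hF1 (L2p_cst m)).
have Gc n : ccoef G n = 0 /\ scoef G n = 0.
  rewrite /G /ccoef /scoef !(ipBl hF1 (L2p_cst m))// -!/(ccoef _ _) -!/(scoef _ _) scoef_cst.
  have [->|n0] := eqVneq n 0%N.
    by rewrite !scoef0 ccoef0_cst divfK ?gt_eqF ?tau_gt0// !subrr.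
  by rewrite ccoef_cst ?lt0n//; have [|-> ->] := F1c n; rewrite ?lt0n// !subrr.
have [pG mG _] := hG; have Gi := L2p_itg hG.
have G0 : \int[mu]_(x in P) G x = 0 by rewrite -ccoef0E; case: (Gc 0%N).
have cG : continuous G.
  by move=> x; apply: cvgB; [exact: continuous_prim|exact: cvg_cst].
have dG x : is_derive x 1 (prim G) (G x) by apply: is_derive_prim => //; exact: cG.
have [C C0 cl] := C1_chord_lip (per_prim G) dG cG.
have : prim G = cst (ccoef (prim G) 0 / tau).
  apply: (chord_lip_uniqueness _ cl); first exact: L2p_prim.
  move=> n n0; have [c0 s0] := Gc n.
  have nn : (n%:R : R) != 0 by rewrite pnatr_eq0 -lt0n.
  by split; apply: (mulfI nn); rewrite ?ccoef_prim ?scoef_prim// ?c0 ?s0 ?oppr0 mulr0.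
move=> e; have Gz x : G x = 0.
  have h := dG x; rewrite e in h.
  by rewrite -(@derive_val _ _ _ _ _ _ _ h) derive_cst.
have Fz x : F1 x = 0.
  have F1m y : F1 y = m by apply/eqP; rewrite -subr_eq0; apply/eqP; exact: (Gz y).
  rewrite F1m -(F1m 0) /F1 prim_period//; last by rewrite /period/= in_itv/= lexx ltW// tau_gt0.
  by rewrite set_itv1 Rintegral_set1.
pose h := f \_ P.
have hi : mu.-integrable setT (EFin \o h) by exact: itg_patch.
have hi2 y : mu.-integrable [set` Interval (BLeft 0) (BRight y)] (EFin \o h).
  exact: integrableS hi.
have := FTC1 hi2 (open_integrable_locally openT hi).
have aeN (c : R) : {ae mu, forall x, x <> c}.
  exists [set c]; split; [exact: measurable_set1|exact: lebesgue_measure_set1|].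
  by move=> x /= /contrapT.
apply: filterS3 (aeN 0) (aeN tau) => [|x x0 xt hx Px].
  exact: (ae_filter_ringOfSetsType mu).
have [a0 b0] : 0 < x /\ x < tau.
  move: Px; rewrite /period/= in_itv/= => /andP[a b].
  by split; rewrite lt_neqAle ?a ?b andbT; apply/eqP => // e'; apply: x0.
have [|_] := hx; first by rewrite /= lte_fin.
rewrite /h patchE mem_set// => <-.
rewrite derive1E; apply: derive_val.
apply: (@near_eq_is_derive _ _ _ (cst 0)).
near=> y.
have [y0 yt] : 0 <= y /\ y <= tau.
  by split; near: y; [exact: lt_le_nbhsr|exact: lt_le_nbhsl].
rewrite /= -[LHS](Fz y) /F1 prim_period//; last by rewrite /period/= in_itv/= y0.
rewrite [LHS]Rintegral_mkcond [RHS]Rintegral_mkcond; apply: eq_Rintegral => z _.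
rewrite /h !patchE; case: ifPn => // /[!inE]/=; rewrite in_itv/= => /andP[z0 zy].
by rewrite mem_set// /period/= in_itv/= z0 (le_trans zy).
Unshelve. all: by end_near. Qed.

Lemma fourier_uniqueness_cst f g : L2p f -> L2p g ->
  (forall n, (0 < n)%N -> ccoef f n = ccoef g n /\ scoef f n = scoef g n) ->
  exists c, {ae mu, forall x, P x -> f x = g x + c}.
Proof.
move=> hf hg e; pose c := (ccoef f 0 - ccoef g 0) / tau; exists c.
have hD : L2p (fun x => f x - g x - cst c x) by exact: (L2pB (L2pB hf hg) (L2p_cst c)).
have := fourier_uniqueness hD; have h : forall n,
  ccoef (fun x => f x - g x - cst c x) n = 0 /\ scoef (fun x => f x - g x - cst c x) n = 0.
  move=> n; rewrite /ccoef /scoef !(ipBl (L2pB hf hg) (L2p_cst c))// !(ipBl hf hg)//.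
  rewrite -!/(ccoef _ _) -!/(scoef _ _) scoef_cst subr0.
  have [->|n0] := eqVneq n 0%N.
    by rewrite !scoef0 ccoef0_cst divfK ?gt_eqF ?tau_gt0// !subrr.
  by rewrite ccoef_cst ?lt0n//; have [|-> ->] := e n; rewrite ?lt0n// !subrr.
move=> /(_ h); apply: filterS => [|x]; first exact: (ae_filter_ringOfSetsType mu).
move=> /[apply] /= /eqP.
by rewrite subr_eq0 subr_eq addrC => /eqP.
Qed.

End Primitive.

(** * The Riesz-Fischer theorem *)

Section RieszFischer.
Variable R : realType.
Implicit Types (f g : R -> R) (x y : R) (c s : nat -> R).
Local Notation mu := (@lebesgue_measure R).
Local Notation P := (period R).
Local Notation tau := (2 * @pi R).
Local Notation itg f := (mu.-integrable P (EFin \o f)).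
Hint Resolve L2p_cosn L2p_sinn L2p_cst : core.

Definition trunc c N i : R := if (N <= i)%N then c i else 0.

Lemma trig_trunc c s N N' x : (N <= N')%N ->
  trig c s N' x - trig c s N x = trig (trunc c N) (trunc s N) N' x.
Proof.
move=> NN'; rewrite /trig.
rewrite [X in _ - X](big_ord_widen N' (fun i => c i * cosn i.+1 x + s i * sinn i.+1 x) NN').
rewrite [X in _ - X]big_mkcond -sumrB; apply: eq_bigr => i _.
rewrite /trunc; case: leqP => _; first by rewrite subr0.
by rewrite !mul0r addr0 subrr.
Qed.

Lemma trunc_sum_le c s N N' M : (0 < N)%N ->
  (forall n, \sum_(i < n) i.+1%:R * (c i ^+ 2 + s i ^+ 2) <= M) ->
  \sum_(i < N') (trunc c N i ^+ 2 + trunc s N i ^+ 2) <= M / N%:R.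
Proof.
move=> N0 hM; have N0' : (0 : R) < N%:R by rewrite ltr0n.
rewrite ler_pdivlMr// mulrC; apply: le_trans (hM N').
rewrite mulr_sumr; apply: ler_sum => i _; rewrite /trunc.
have h : 0 <= c i ^+ 2 + s i ^+ 2 by rewrite addr_ge0// sqr_ge0.
case: ifPn => Ni; last by rewrite expr0n addr0 mulr0 mulr_ge0.
by rewrite ler_wpM2r// ler_nat ltnW.
Qed.

Lemma continuous_trig c s N : continuous (trig c s N).
Proof.
elim: N => [|N IH].
  rewrite (_ : trig c s 0 = cst 0); first by move=> x; exact: cvg_cst.
  by apply/funext => x; rewrite /trig big_ord0.
rewrite (_ : trig c s N.+1 = fun x => trig c s N x + (c N * cosn N.+1 x + s N * sinn N.+1 x)).
  move=> x; apply: cvgD; first exact: IH.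
  apply: cvgD; apply: cvgMr; [exact: continuous_cosn|exact: continuous_sinn].
by apply/funext => x; rewrite /trig big_ord_recr.
Qed.

Section Limit.
Variables (c s : nat -> R) (M : R).
Hypothesis hM : forall n, \sum_(i < n) i.+1%:R * (c i ^+ 2 + s i ^+ 2) <= M.

Let T k := trig c s (4 ^ k).
Let D k x := T k.+1 x - T k x.
Let K := (tau + pi * M) / 2.

Let M0 : 0 <= M. Proof. by have := hM 0; rewrite big_ord0. Qed.

Let mT k : measurable_fun setT (T k).
Proof. by apply: continuous_measurable_fun; exact: continuous_trig. Qed.

Let mD k : measurable_fun setT (D k).
Proof. exact: measurable_funB. Qed.

(** The inequality 2 |D| <= 2^-k + 2^k D^2 is integrated; the norm of the k-th
    dyadic block gains a factor 4^-k from the weight. *)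
Let int_D k : (\int[mu]_(x in P) `|(D k x)%:E| <= (2 * K / (2 ^ (k + 1))%:R)%:E)%E.
Proof.
have pow2 : (0 : R) < 2 ^+ k by rewrite exprn_gt0.
have L2D : L2p (D k) by apply: L2pB; exact: L2p_trig.
pose h x := (2 ^- k + 2 ^+ k * (D k x * D k x)) / 2.
have hi : itg h.
  have := itgZ 2^-1 (itgD (itg_cst (2 ^- k)) (itgZ (2 ^+ k) (L2pM L2D L2D))).
  by congr integrable; apply/funext => x; rewrite /h /= mulrC.
have Dh x : `|D k x| <= h x.
  rewrite /h -expr2 -(real_normK (num_real (D k x))).
  have : 0 <= (2 ^- k - `|D k x|) ^+ 2 * 2 ^+ k by rewrite mulr_ge0 ?sqr_ge0// ltW.
  have -> : (2 ^- k - `|D k x|) ^+ 2 * 2 ^+ k =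
     2 ^- k - 2 * `|D k x| + 2 ^+ k * `|D k x| ^+ 2.
    by move: (`|_|) (2 ^+ k) pow2 => a q q0; field; rewrite gt_eqF.
  lra.
apply: (@le_trans _ _ (\int[mu]_(x in P) (h x)%:E)%E).
  apply: ge0_le_integral => //.
  - exact: measurable_period.
  - exact: measurable_abs_EFin.
  - by case/integrableP: hi.
  - by move=> x _; rewrite lee_fin.
rewrite -[X in (X <= _)%E]fineK; last by apply: integrable_fin_num => //; exact: measurable_period.
rewrite lee_fin -/(Rintegral mu P h).
have -> : Rintegral mu P h = 2^-1 * (2 ^- k * tau + 2 ^+ k * ip (D k) (D k)).
  rewrite -ip_cst /ip -RintegralZl; [|exact: measurable_period|exact: L2pM].
  rewrite -RintegralD; [|exact: measurable_period|exact: L2pM|exact/itgZ/L2pM].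
  rewrite -RintegralZl; [|exact: measurable_period|].
    by apply: eq_Rintegral => x _; rewrite /h /= mulr1 mulrC.
  by apply: itgD; [exact: L2pM|exact/itgZ/L2pM].
have -> : D k = trig (trunc c (4 ^ k)) (trunc s (4 ^ k)) (4 ^ k.+1).
  by apply/funext => x; rewrite /D trig_trunc// leq_exp2l.
rewrite ip_trig_trig.
have := trunc_sum_le (N := 4 ^ k) (4 ^ k.+1) (expn_gt0 4 k) hM.
move: (\sum_(i < _) _) => S hS.
rewrite /K natrX exprD expr1.
have e4 : (4 ^ k)%:R = 2 ^+ k * 2 ^+ k :> R by rewrite natrX -exprMn; congr (_ ^+ k); ring.
rewrite e4 in hS; move: (2 ^+ k) pow2 hS => q q0 hS.
have hS' : q * S <= M / q.
  rewrite ler_pdivlMr// mulrC mulrA; move: hS; rewrite ler_pdivlMr ?mulr_gt0// => h'.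
  by rewrite mulrC.
have p0 := @pi_gt0 R.
have -> : 2 * ((tau + pi * M) / 2) / (q * 2) = 2^-1 * (q^-1 * tau + pi * (M / q)).
  by field; rewrite gt_eqF.
rewrite ler_pM2l// lerD2l mulrCA ler_pM2l//.
Qed.

Let G x : \bar R := (`|(T 0 x)%:E| + \sum_(0 <= k <oo) `|(D k x)%:E|)%E.

Let mG : measurable_fun setT G.
Proof.
apply: emeasurable_funD; first exact: measurable_abs_EFin.
apply: ge0_emeasurable_sum => // k _ _.
exact: measurable_abs_EFin.
Qed.

Let G0 x : (0 <= G x)%E.
Proof. by rewrite adde_ge0//; apply: nneseries_ge0. Qed.

Let G_integrable : mu.-integrable P G.
Proof.
apply/integrableP; split; first exact: measurable_funTS.
under eq_integral do rewrite gee0_abs//.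
have mS : measurable_fun P (fun x => \sum_(0 <= k <oo) `|(D k x)%:E|)%E.
  apply: measurable_funTS; apply: ge0_emeasurable_sum => // k _ _.
  exact: measurable_abs_EFin.
have mT0 : measurable_fun P (fun x => `|(T 0 x)%:E|)%E by exact: measurable_abs_EFin.
rewrite ge0_integralD//; try first [exact: mS | exact: mT0 |
  exact: measurable_period | by move=> x _; apply: nneseries_ge0].
apply: lte_add_pinfty.
  by have := L2p_itg (L2p_trig c s (4 ^ 0)) => /integrableP[].
rewrite integral_nneseries//; [|exact: measurable_period|]; last first.
  by move=> k; exact: measurable_abs_EFin.
apply: (@le_lt_trans _ _ (\sum_(0 <= k <oo) (2 * K / (2 ^ (k + 1))%:R)%:E)%E).
  by apply: lee_nneseries => *; [exact: integral_ge0|exact: int_D].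
have := @cvg_geometric_eseries_half R (2 * K) 0.
by move/cvg_lim => ->; rewrite ?ltry.
Qed.

Let good x := G x \is a fin_num.

Let ae_good : {ae mu, forall x, P x -> good x}.
Proof. by apply: integrable_ae G_integrable; exact: measurable_period. Qed.

Let T_sum k x : T k x = T 0 x + \sum_(0 <= j < k) D j x.
Proof. by rewrite telescope_sumr// addrC subrK. Qed.

Let T_le k x : (`|(T k x)%:E| <= G x)%E.
Proof.
rewrite T_sum EFinD; apply: (le_trans (lee_abs_add _ _)); rewrite leeD2l//.
apply: (@le_trans _ _ (\sum_(0 <= j < k) `|(D j x)%:E|)%E); last exact: nneseries_lim_ge.
by rewrite -sumEFin; apply: lee_abs_sum.
Qed.

Let g x := fine (limn_esup (fun k => (T k x)%:E)).

Let g_cvg x : good x -> T ^~ x @ \oo --> g x.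
Proof.
move=> gx.
have /normed_cvg cD : cvgn [normed series (fun k => D k x)].
  apply: nondecreasing_is_cvgn.
    have -> : [normed series (fun k => D k x)] = (fun n => \sum_(0 <= k < n) `|D k x|) by [].
    by apply/nondecreasing_seqP => n; rewrite big_nat_recr//= lerDl.
  exists (fine (G x)) => _ [k _ <-] /=; rewrite -lee_fin fineK//.
  rewrite /series/= -sumEFin /G -[X in (X <= _)%E]add0e leeD//.
  exact: nneseries_lim_ge.
have cT : cvgn (T ^~ x).
  have -> : T ^~ x = (fun k => T 0 x + series (fun k => D k x) k).
    by apply/funext => k; rewrite T_sum.
  by apply: is_cvgD => //; exact: is_cvg_cst.
have cTE : (fun k => (T k x)%:E) @ \oo --> (limn (T ^~ x))%:E.
  by apply/cvg_EFin => //; exact: nearW.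
by rewrite /g (cvg_limn_einf_sup cTE).2.
Qed.

Lemma trig_limit : exists g (G : R -> \bar R),
  [/\ per g, measurable_fun setT g, mu.-integrable P G &
  {ae mu, forall x, P x -> (fun k => trig c s (4 ^ k) x) @ \oo --> g x /\
     forall k, (`|(trig c s (4 ^ k) x)%:E| <= G x)%E}].
Proof.
exists g, G; split => //.
- move=> x; rewrite /g; congr fine; congr limn_esup.
  by apply/funext => k; rewrite /T per_trig.
- apply: measurableT_comp => //; apply: measurable_fun_limn_esup => k.
  exact/measurable_EFinP.
- apply: filterS ae_good => [|x gx Px]; first exact: (ae_filter_ringOfSetsType mu).
  split; first exact/g_cvg/gx.
  by move=> k; exact: T_le.
Qed.

End Limit.

(** Only the partial sums of order 4 ^ k are known to converge almost
    everywhere; their norms are increasing, which is enough for Fatou. *)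
Lemma trig_fatou c s g M : measurable_fun setT g ->
  {ae mu, forall x, P x -> (fun k => trig c s (4 ^ k) x) @ \oo --> g x} ->
  (forall n, \sum_(i < n) (c i ^+ 2 + s i ^+ 2) <= M) ->
  (\int[mu]_(x in P) (g x ^+ 2)%:E <= (pi * M)%:E)%E.
Proof.
move=> mg ag hM; pose T k := trig c s (4 ^ k).
have mT k : measurable_fun setT (T k).
  by apply: continuous_measurable_fun; exact: continuous_trig.
have mT2 k : measurable_fun P (fun x => (T k x ^+ 2)%:E).
  by apply: measurable_funTS; apply/measurable_EFinP; exact: measurable_funX.
have -> : (\int[mu]_(x in P) (g x ^+ 2)%:E =
    \int[mu]_(x in P) limn_einf (fun k => (T k x ^+ 2)%:E))%E.
  apply: ge0_ae_eq_integral => //.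
  - exact: measurable_period.
  - by apply: measurable_funTS; apply/measurable_EFinP; exact: measurable_funX.
  - have -> : (fun x => limn_einf (fun k => (T k x ^+ 2)%:E)) =
      (fun x => - limn_esup (fun k => - (T k x ^+ 2)%:E))%E.
      by [].
    apply: measurableT_comp => //; apply: measurable_fun_limn_esup => k.
    apply: (measurableT_comp (f := oppe)); [exact: oppe_measurable|exact: mT2].
  - by move=> x _; rewrite lee_fin sqr_ge0.
  - move=> x _; rewrite limn_einf_lim; apply: lime_ge; first exact: is_cvg_einfs.
    apply: nearW => n; apply: le_ereal_inf_tmp => _ [m _ <-].
    by rewrite lee_fin sqr_ge0.
  - apply: filterS ag => [|x h Px]; first exact: (ae_filter_ringOfSetsType mu).
    have {}h := h Px.
    have h2 : (fun k => (T k x ^+ 2)%:E) @ \oo --> (g x ^+ 2)%:E.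
      apply/cvg_EFin; first exact: nearW.
      rewrite expr2 (_ : fine \o _ = (fun k => T k x * T k x)); first exact: cvgM.
      by apply/funext => k; rewrite /= expr2.
    by rewrite (cvg_limn_einf_sup h2).1.
apply: (le_trans (fatou _ (measurable_period R) mT2 _)).
  by move=> k x _; rewrite lee_fin sqr_ge0.
pose a k := ip (T k) (T k).
have aE k : (\int[mu]_(x in P) (T k x ^+ 2)%:E = (a k)%:E)%E.
  have hT : L2p (T k) by exact: L2p_trig.
  rewrite /a /ip /Rintegral fineK; first by apply: eq_integral => x _; rewrite expr2.
  by apply: integrable_fin_num; [exact: measurable_period|exact: (L2pM hT hT)].
have ca : a @ \oo --> limn a.
  apply: nondecreasing_is_cvgn.
    move=> m n mn; rewrite /a !ip_trig_trig ler_pM2l ?pi_gt0//.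
    have h : (4 ^ m <= 4 ^ n)%N by rewrite leq_exp2l.
    rewrite (big_ord_widen (4 ^ n) (fun i => c i ^+ 2 + s i ^+ 2) h) big_mkcond /=.
    apply: ler_sum => i _; case: ifP => // _.
    by rewrite addr_ge0// sqr_ge0.
  exists (pi * M) => _ [k _ <-]; rewrite /a ip_trig_trig.
  by rewrite ler_pM2l ?pi_gt0.
have cE : (fun k => \int[mu]_(x in P) (T k x ^+ 2)%:E)%E @ \oo --> (limn a)%:E.
  under eq_fun do rewrite aE.
  by apply/cvg_EFin => //; exact: nearW.
rewrite (cvg_limn_einf_sup cE).1 lee_fin.
apply: limr_le; first exact: cvgP ca.
apply: nearW => k; rewrite /a ip_trig_trig.
by rewrite ler_pM2l ?pi_gt0.
Qed.

(** The weight i + 1 replaces the completeness of L^2: it makes the dyadic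
    blocks of the series summable in L^1, so the partial sums of order 4 ^ k
    converge almost everywhere under an integrable bound, and dominated
    convergence identifies the coefficients of the limit. *)
Lemma riesz_fischer c s M :
  (forall n, \sum_(i < n) i.+1%:R * (c i ^+ 2 + s i ^+ 2) <= M) ->
  exists g, [/\ L2p g, ccoef g 0 = 0,
    (forall i, ccoef g i.+1 = pi * c i /\ scoef g i.+1 = pi * s i) &
    (fun n => pi * \sum_(i < n) (c i ^+ 2 + s i ^+ 2)) @ \oo --> ip g g].
Proof.
move=> hM; have M0 : 0 <= M by have := hM 0; rewrite big_ord0.
have [g [G [pg mg iG agG]]] := trig_limit hM.
have ag : {ae mu, forall x, P x -> (fun k => trig c s (4 ^ k) x) @ \oo --> g x}.
  apply: filterS agG => [|x h Px]; first exact: (ae_filter_ringOfSetsType mu).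
  by have [] := h Px.
have hM1 n : \sum_(i < n) (c i ^+ 2 + s i ^+ 2) <= M.
  apply: le_trans (hM n); apply: ler_sum => i _.
  by rewrite ler_peMl ?ler1n// addr_ge0// sqr_ge0.
have L2g : L2p g.
  split => //; apply/integrableP; split.
    by apply: measurable_funTS; apply/measurable_EFinP; exact: measurable_funX.
  apply: (@le_lt_trans _ _ (pi * M)%:E); last by rewrite ltry.
  under eq_integral do rewrite /= ger0_norm ?sqr_ge0//.
  exact: (trig_fatou mg ag hM1).
have lim_ip (h : R -> R) : L2p h -> (forall x, `|h x| <= 1) ->
    (fun k => ip (trig c s (4 ^ k)) h) @ \oo --> ip g h.
  move=> hh h1; have [_ mh _] := hh.
  have mTh k : measurable_fun P (fun x => (trig c s (4 ^ k) x * h x)%:E).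
    apply: measurable_funTS; apply/measurable_EFinP; apply: measurable_funM => //.
    by have [] := L2p_trig c s (4 ^ k).
  have mgh : measurable_fun P (fun x => (g x * h x)%:E).
    by apply: measurable_funTS; apply/measurable_EFinP; exact: measurable_funM.
  have [] := dominated_convergence (measurable_period R) mTh mgh _ iG _.
  - apply: filterS ag => [|x hx Px]; first exact: (ae_filter_ringOfSetsType mu).
    apply/cvg_EFin; first exact: nearW.
    by apply: cvgMl; exact: hx.
  - apply: filterS agG => [|x hx k Px]; first exact: (ae_filter_ringOfSetsType mu).
    have [_ /(_ k) hk] := hx Px.
    apply: le_trans hk; rewrite /= lee_fin normrM ler_piMr//.
  - move=> igh _ c1; rewrite /ip /Rintegral.
    apply: fine_cvg; rewrite fineK//.
    by apply: integrable_fin_num => //; exact: measurable_period.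
have bcos n x : `|cosn n x| <= 1 :> R by exact: cos_max.
have bsin n x : `|sinn n x| <= 1 :> R by exact: sin_max.
have ccg i : ccoef g i.+1 = pi * c i /\ scoef g i.+1 = pi * s i.
  have near_i : \forall k \near \oo, (i < 4 ^ k)%N.
    exists i => // k /= ik; rewrite (leq_ltn_trans ik)// ltn_expl//.
  split.
  - rewrite /ccoef; have := lim_ip _ (L2p_cosn R i.+1) (bcos _); move/cvg_lim => <- //.
    apply: lim_near_cst => //; apply: filterS near_i => k ik.
    by rewrite -/(ccoef _ _) ccoef_trig ik mulrC.
  - rewrite /scoef; have := lim_ip _ (L2p_sinn R i.+1) (bsin _); move/cvg_lim => <- //.
    apply: lim_near_cst => //; apply: filterS near_i => k ik.
    by rewrite -/(scoef _ _) scoef_trig ik mulrC.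
exists g; split => //.
  rewrite /ccoef; have := lim_ip _ (L2p_cosn R 0) (bcos _); move/cvg_lim => <- //.
  by apply: lim_near_cst => //; apply: nearW => k; rewrite -/(ccoef _ _) ccoef0_trig.
(* The remainder after 4 ^ k terms is estimated by Fatou's lemma, applied to
   the limit of the truncated sums. *)
have p0 : (0 : R) < pi := pi_gt0 R.
have ipgT N : ip (trig c s N) g = pi * \sum_(i < N) (c i ^+ 2 + s i ^+ 2).
  rewrite ip_trig// mulr_sumr; apply: eq_bigr => i _.
  by have [-> ->] := ccg i; ring.
have tail k : ip g g - pi * \sum_(i < 4 ^ k) (c i ^+ 2 + s i ^+ 2) <= pi * (M / (4 ^ k)%:R).
  pose t := trig c s (4 ^ k).
  have ht : L2p t by exact: L2p_trig.
  have hgt : L2p (fun x => g x - t x) by exact: L2pB.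
  have -> : ip g g - pi * \sum_(i < 4 ^ k) (c i ^+ 2 + s i ^+ 2) =
      ip (fun x => g x - t x) (fun x => g x - t x).
    rewrite ipBl// !ipBr// (ipC g t) ipgT ip_trig_trig; ring.
  have := @trig_fatou (trunc c (4 ^ k)) (trunc s (4 ^ k)) (fun x => g x - t x) (M / (4 ^ k)%:R) _ _ _.
  have [_ mgt _] := hgt; move=> /(_ mgt) H; rewrite -lee_fin.
  have -> : (ip (fun x => g x - t x) (fun x => g x - t x))%:E =
      (\int[mu]_(x in P) ((g x - t x) ^+ 2)%:E)%E.
    rewrite /ip /Rintegral fineK; first by apply: eq_integral => x _; rewrite expr2.
    by apply: integrable_fin_num; [exact: measurable_period|exact: (L2pM hgt hgt)].
  apply: H; last by move=> n; apply: trunc_sum_le => //; rewrite expn_gt0.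
  apply: filterS ag => [|x hx Px]; first exact: (ae_filter_ringOfSetsType mu).
  have h1 : (fun j => trig c s (4 ^ j) x - t x) @ \oo --> g x - t x.
    by apply: cvgB; [exact: hx|exact: cvg_cst].
  apply: cvg_trans h1; apply: near_eq_cvg; exists k => // j /= kj.
  by rewrite /t trig_trunc// leq_exp2l.
have lo n : pi * \sum_(i < n) (c i ^+ 2 + s i ^+ 2) <= ip g g.
  rewrite -(ler_pM2l p0); apply: le_trans (bessel n L2g).
  rewrite !mulr_sumr; apply: ler_sum => i _; rewrite /amp2.
  by have [-> ->] := ccg i; rewrite le_eqVlt; apply/orP; left; apply/eqP; ring.
apply/cvgrPdist_le => e e0.
pose k := Num.truncn (pi * M / e).
exists (4 ^ k)%N => // n /= kn.
rewrite ger0_norm; last by rewrite subr_ge0; exact: lo.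
apply: (@le_trans _ _ (ip g g - pi * \sum_(i < 4 ^ k) (c i ^+ 2 + s i ^+ 2))).
  rewrite lerD2l lerN2 ler_pM2l//.
  rewrite (big_ord_widen n (fun i => c i ^+ 2 + s i ^+ 2) kn) big_mkcond /=.
  apply: ler_sum => i _; case: ifP => // _.
  by rewrite addr_ge0// sqr_ge0.
apply: (le_trans (tail k)); rewrite mulrA ler_pdivrMr ?ltr0n ?expn_gt0//.
rewrite -ler_pdivrMl// mulrC ltW// (lt_le_trans (truncnS_gt _))// ler_nat.
by rewrite -/k ltn_expl.
Qed.

End RieszFischer.

(** * Parseval's identity *)

Section Douglas.
Variable R : realType.
Implicit Types (f g : R -> R) (x y : R).
Local Notation mu := (@lebesgue_measure R).
Local Notation P := (period R).
Local Notation tau := (2 * @pi R).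
Local Notation itg f := (mu.-integrable P (EFin \o f)).
Hint Resolve L2p_cosn L2p_sinn L2p_cst : core.

Lemma ip_ae f g h : L2p f -> L2p g -> L2p h ->
  {ae mu, forall x, P x -> f x = g x} -> ip f h = ip g h.
Proof.
move=> hf hg hh fg; rewrite /ip /Rintegral; congr fine.
apply: ae_eq_integral.
- exact: measurable_period.
- by have /integrableP[] := L2pM hf hh.
- by have /integrableP[] := L2pM hg hh.
- apply: filterS fg => [|x /[apply] /= ->//]; exact: (ae_filter_ringOfSetsType mu).
Qed.

Definition weights_bounded f :=
  exists M : R, forall n, \sum_(i < n) i.+1%:R * amp2 f i <= M.

(** The function with the same coefficients produced by [riesz_fischer] equals
    f almost everywhere by uniqueness. *)
Lemma parseval f : L2p f -> ccoef f 0 = 0 -> weights_bounded f ->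
  (fun n => pi^-1 * \sum_(i < n) amp2 f i) @ \oo --> ip f f.
Proof.
move=> hf f0 [M hM]; have p0 : (pi : R) != 0 by rewrite gt_eqF ?pi_gt0.
have [|g [hg g0 cg limg]] := @riesz_fischer R (fun i => ccoef f i.+1 / pi)
    (fun i => scoef f i.+1 / pi) (M / pi ^+ 2) _.
  move=> n; rewrite ler_pdivlMr ?exprn_gt0 ?pi_gt0// mulr_suml.
  apply: le_trans (hM n); apply: ler_sum => i _.
  rewrite le_eqVlt; apply/orP; left; apply/eqP; rewrite /amp2.
  by move: (ccoef _ _) (scoef _ _) (pi : R) p0 => a b q q0; field.
have fg : {ae mu, forall x, P x -> f x = g x}.
  have := fourier_uniqueness (L2pB hf hg).
  have h n : ccoef (fun x => f x - g x) n = 0 /\ scoef (fun x => f x - g x) n = 0.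
    rewrite /ccoef /scoef !ipBl// -!/(ccoef _ _) -!/(scoef _ _).
    case: n => [|n]; first by rewrite f0 g0 !scoef0 !subrr.
    have [-> ->] := cg n.
    by rewrite !mulrA !(mulrC pi) !mulfK// !subrr.
  move=> /(_ h); apply: filterS => [|x /[apply] /eqP]; first exact: (ae_filter_ringOfSetsType mu).
  by rewrite subr_eq0 => /eqP.
have -> : ip f f = ip g g.
  by rewrite (ip_ae hf hg hf fg) ipC (ip_ae hf hg hg fg).
apply: cvg_trans limg; apply: near_eq_cvg; apply: nearW => n.
rewrite !mulr_sumr; apply: eq_bigr => i _; rewrite /amp2.
by move: (ccoef _ _) (scoef _ _) (pi : R) p0 => a b q q0; field.
Qed.

(** * The Fejer kernel *)
Definition dirichlet n x : R := 1 + 2 * trig (cst 1) (cst 0) n x.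
Definition fejer n x : R := \sum_(k < n) dirichlet k x.

Lemma dirichletE n x : (1 - cos x) * dirichlet n x = cosn n x - cosn n.+1 x.
Proof.
elim: n => [|n IH].
  by rewrite /dirichlet /trig big_ord0 mulr0 addr0 mulr1 /cosn mul0r cos0 mul1r.
have -> : dirichlet n.+1 x = dirichlet n x + 2 * cosn n.+1 x.
  by rewrite /dirichlet /trig big_ord_recr /=; ring.
rewrite mulrDr IH /cosn.
have -> : n.+2%:R * x = n.+1%:R * x + x by rewrite -[n.+2]addn1 natrD; ring.
have -> : n%:R * x = n.+1%:R * x - x by rewrite -[n.+1]addn1 natrD; ring.
by rewrite cosB cosD; ring.
Qed.

Lemma fejerE n x : (1 - cos x) * fejer n x = 1 - cosn n x.
Proof.
rewrite /fejer mulr_sumr; elim: n => [|n IH].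
  by rewrite big_ord0 /cosn mul0r cos0 subrr.
by rewrite big_ord_recr /= IH dirichletE; ring.
Qed.

Lemma continuous_dirichlet n : continuous (dirichlet n).
Proof.
move=> x; apply: cvgD; first exact: cvg_cst.
by apply: cvgMr; exact: continuous_trig.
Qed.

Lemma per_dirichlet n : per (dirichlet n).
Proof. by move=> x; rewrite /dirichlet per_trig. Qed.

Lemma L2p_dirichlet n : L2p (dirichlet n).
Proof. by apply: L2p_continuous; [exact: per_dirichlet|exact: continuous_dirichlet]. Qed.

Lemma L2p_fejer n : L2p (fejer n).
Proof. exact: (L2p_sum n (F := dirichlet) L2p_dirichlet). Qed.

Lemma Rintegral_fejer n : \int[mu]_(x in P) fejer n x = n%:R * tau.
Proof.
rewrite -ccoef0E /ccoef /fejer (ip_suml n L2p_dirichlet)//.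
rewrite (eq_bigr (fun=> tau)); first by rewrite sumr_const card_ord [RHS]mulr_natl.
move=> k _; rewrite /dirichlet.
rewrite (ipDl (L2p_cst 1) (L2pZ 2 (L2p_trig _ _ _)))// ipZl//; last exact: L2p_trig.
by rewrite -!/(ccoef _ _) ccoef0_cst ccoef0_trig mulr0 addr0 mul1r.
Qed.

(** The Fejer kernel in closed form.  It differs from [fejer] only where
    cos x = 1, that is at the ends of the period. *)
Definition fejq n x : R := (1 - cosn n x) / (1 - cos x).

Lemma fejq_ge0 n x : 0 <= fejq n x.
Proof. by rewrite /fejq divr_ge0// onem_cos_ge0. Qed.

Lemma measurable_fejq n : measurable_fun setT (fejq n).
Proof.
apply: measurable_funM.
  by apply: measurable_funB => //; apply: continuous_measurable_fun; exact: continuous_cosn.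
apply: (measurableT_comp (@measurable_inv R)); apply: measurable_funB => //.
by apply: continuous_measurable_fun; exact: continuous_cos.
Qed.

Lemma fejq_fejer n x : 1 - cos x != 0 -> fejq n x = fejer n x.
Proof. by move=> h; rewrite /fejq -fejerE mulrAC divff// mul1r. Qed.

Lemma integral_fejq n : (\int[mu]_(x in P) (fejq n x)%:E = (n%:R * tau)%:E)%E.
Proof.
have := L2p_itg (L2p_fejer n) => fi.
rewrite -Rintegral_fejer /Rintegral fineK; last first.
  by apply: integrable_fin_num => //; exact: measurable_period.
apply: eq_integral_itv_bounded.
- by apply: measurable_funTS; exact: measurable_fejq.
- by apply: measurable_funTS; have [] := L2p_fejer n.
- move=> x; rewrite in_itv/= => /andP[x0 xt]; apply: fejq_fejer.
  rewrite onem_cos_half mulf_neq0// sqrf_eq0 gt_eqF// sin_gt0_pi//.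
  by rewrite divr_gt0//= ltr_pdivrMr// mulrC.
Qed.

(** * The energy as a double integral *)
Definition ekernel (z : R * R) : R := (2 * (1 - cos (z.1 - z.2)))^-1.

Lemma ekernel_ge0 z : 0 <= ekernel z.
Proof. by rewrite /ekernel invr_ge0 mulr_ge0// onem_cos_ge0. Qed.

Lemma measurable_diff : measurable_fun setT (fun z : R * R => z.1 - z.2).
Proof. by apply: measurable_funB. Qed.

Lemma measurable_ekernel : measurable_fun setT ekernel.
Proof.
apply: (measurableT_comp (@measurable_inv R)).
apply: measurable_funM => //; apply: measurable_funB => //.
apply: (measurableT_comp (f := @cos R)); last exact: measurable_diff.
by apply: continuous_measurable_fun; exact: continuous_cos.
Qed.

Definition increment f (z : R * R) : R := f z.1 - f z.2.

Lemma measurable_increment f : measurable_fun setT f -> measurable_fun setT (increment f).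
Proof.
by move=> mf; apply: measurable_funB; [exact: measurable_fst_comp|exact: measurable_snd_comp].
Qed.

Definition energye f : \bar R :=
  (\int[mu]_(x in P) \int[mu]_(y in P) ((increment f (x, y)) ^+ 2 * ekernel (x, y))%:E)%E.

Lemma tonelli_period (F : R * R -> \bar R) : measurable_fun setT F ->
  (forall z, 0 <= F z)%E ->
  (\int[mu]_(x in P) \int[mu]_(y in P) F (x, y) =
   \int[mu]_(y in P) \int[mu]_(x in P) F (x, y))%E.
Proof.
move=> mF F0; pose H z : \bar R := (F z * (\1_P z.1 * \1_P z.2)%:E)%E.
have mH : measurable_fun setT H.
  apply: emeasurable_funM => //; apply/measurable_EFinP; apply: measurable_funM.
    by apply: measurable_fst_comp; exact: measurable_indic_period.
  by apply: measurable_snd_comp; exact: measurable_indic_period.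
have H0 z : (0 <= H z)%E by rewrite mule_ge0// lee_fin mulr_ge0.
have := fubini_tonelli (m1 := mu) (m2 := mu) H mH H0.
have e1 x : (\int[mu]_y H (x, y) = ((fun x => \int[mu]_(y in P) F (x, y)) \_ P) x)%E.
  rewrite patchE; case: ifPn => xP.
    rewrite [in RHS]integral_mkcond; apply: eq_integral => y _.
    by rewrite /H /= epatch_indic indicE xP mul1r.
  rewrite (eq_integral (cst 0%E)) ?integral_cst ?mul0e//.
  by move=> y _; rewrite /H /= indicE (negbTE xP) mul0r mule0.
have e2 y : (\int[mu]_x H (x, y) = ((fun y => \int[mu]_(x in P) F (x, y)) \_ P) y)%E.
  rewrite patchE; case: ifPn => yP.
    rewrite [in RHS]integral_mkcond; apply: eq_integral => x _.
    by rewrite /H /= epatch_indic indicE [X in (_ * X)%:E]indicE yP mulr1.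
  rewrite (eq_integral (cst 0%E)) ?integral_cst ?mul0e//.
  by move=> x _; rewrite /H /= [X in (_ * X)%:E]indicE (negbTE yP) mulr0 mule0.
under eq_integral do rewrite e1.
under [X in _ = X -> _]eq_integral do rewrite e2.
by rewrite -!integral_mkcond.
Qed.

(** Integrand of the energy after the substitution y = x + s. *)
Definition shift_kernel f (z : R * R) : \bar R :=
  ((f (z.1 + z.2) - f z.1) ^+ 2 * (2 * (1 - cos z.2))^-1)%:E.

Lemma measurable_shift_kernel f : L2p f -> measurable_fun setT (shift_kernel f).
Proof.
move=> [_ mf _]; apply/measurable_EFinP; apply: measurable_funM.
  apply: measurable_funX; apply: measurable_funB; last exact: measurable_fst_comp.
  by apply: (measurableT_comp mf); exact: measurable_funD.
apply: (measurableT_comp (@measurable_inv R)).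
apply: measurable_funM => //; apply: measurable_funB => //.
by apply: measurable_snd_comp; apply: continuous_measurable_fun; exact: continuous_cos.
Qed.

Lemma shift_kernel_ge0 f z : (0 <= shift_kernel f z)%E.
Proof. by rewrite lee_fin mulr_ge0 ?sqr_ge0// invr_ge0 mulr_ge0// onem_cos_ge0. Qed.

Lemma integral_shift_kernel f s : L2p f ->
  (\int[mu]_(x in P) shift_kernel f (x, s) = ((2 * (1 - cos s))^-1 *
            ip (fun x => f (x + s) - f x) (fun x => f (x + s) - f x))%:E)%E.
Proof.
move=> hf.
have hs : L2p (fun x => f (x + s) - f x) by apply: L2pB => //; exact: L2p_shift.
rewrite EFinM muleC; have := L2pM hs hs => his.
rewrite [in RHS]/ip /Rintegral fineK; last by apply: integrable_fin_num => //; exact: measurable_period.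
have ge1 : (0 <= ((2 * (1 - cos s))^-1)%:E)%E.
  by rewrite lee_fin invr_ge0 mulr_ge0// onem_cos_ge0.
have me : measurable_fun P (fun x => ((f (x + s) - f x) * (f (x + s) - f x))%:E).
  by case/integrableP: his.
rewrite -ge0_integralZr//; last first.
- by move=> x _; rewrite lee_fin -expr2 sqr_ge0.
- exact: measurable_period.
Qed.

Lemma measurable_shift_energy f : L2p f ->
  measurable_fun P (fun s => ((2 * (1 - cos s))^-1 *
            ip (fun x => f (x + s) - f x) (fun x => f (x + s) - f x))%:E).
Proof.
move=> hf; apply: measurable_funTS.
pose H z : \bar R := (shift_kernel f z * (\1_P z.1)%:E)%E.
have mH : measurable_fun setT H.
  apply: emeasurable_funM; first exact: measurable_shift_kernel.
  by apply/measurable_EFinP; apply: measurable_fst_comp; exact: measurable_indic_period.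
have := measurable_integral_fst mH; rewrite (_ : (fun y => _) = (fun s => ((2 * (1 - cos s))^-1 *
            ip (fun x => f (x + s) - f x) (fun x => f (x + s) - f x))%:E)).
  by apply => z; rewrite mule_ge0 ?shift_kernel_ge0// lee_fin.
apply/funext => s; rewrite -integral_shift_kernel// [in RHS]integral_mkcond.
by apply: eq_integral => x _; rewrite /H /= epatch_indic.
Qed.

Lemma energyeE f : L2p f ->
  energye f = (\int[mu]_(s in P) ((2 * (1 - cos s))^-1 *
            ip (fun x => f (x + s) - f x) (fun x => f (x + s) - f x))%:E)%E.
Proof.
move=> hf; have [pf mf _] := hf.
transitivity (\int[mu]_(x in P) \int[mu]_(s in P) shift_kernel f (x, s))%E.
  apply: eq_integral => x _.
  rewrite (ge0_integral_circle_lift (circle_lift_shift x)).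
  - apply: eq_integral => s _; rewrite mule1 /shift_kernel /increment /ekernel /=; congr EFin.
    by rewrite -[_ - f x]opprB sqrrN (addrC s x) opprD addrA subrr sub0r cosN.
  - have : measurable_fun setT (fun z => ((increment f z) ^+ 2 * ekernel z)%:E).
      apply/measurable_EFinP; apply: measurable_funM; last exact: measurable_ekernel.
      by apply: measurable_funX; exact: measurable_increment.
    exact: measurable_section_snd.
  - by move=> y; rewrite lee_fin mulr_ge0 ?sqr_ge0// ekernel_ge0.
  - move=> y; rewrite /increment /ekernel /= pf opprD addrA.
    by have := @cos_per R (x - y - tau); rewrite subrK => ->.
rewrite tonelli_period//; [|exact: measurable_shift_kernel|exact: shift_kernel_ge0].
by apply: eq_integral => s _; exact: integral_shift_kernel.
Qed.

Lemma amp2_shift f s i : L2p f ->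
  amp2 (fun x => f (x + s) - f x) i = 2 * (1 - cosn i.+1 s) * amp2 f i.
Proof.
move=> hf; have hs := L2p_shift s hf.
rewrite /amp2 /ccoef /scoef !ipBl// -!/(ccoef _ _) -!/(scoef _ _) ccoef_shift// scoef_shift//.
have : cosn i.+1 s ^+ 2 + sinn i.+1 s ^+ 2 = 1 by exact: cos2Dsin2.
move: (cosn _ _) (sinn _ _) (ccoef _ _) (scoef _ _) => C S a b h.
have -> : (C * a + S * b - a) ^+ 2 + (C * b - S * a - b) ^+ 2 =
    (C ^+ 2 + S ^+ 2) * (a ^+ 2 + b ^+ 2) - 2 * C * (a ^+ 2 + b ^+ 2) + (a ^+ 2 + b ^+ 2) by ring.
by rewrite h; ring.
Qed.

Lemma ccoef0_shift f s : L2p f -> ccoef (fun x => f (x + s) - f x) 0 = 0.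
Proof.
move=> hf; have hs := L2p_shift s hf.
rewrite /ccoef !ipBl// -!/(ccoef _ _) ccoef_shift//.
by rewrite /cosn /sinn mul0r cos0 sin0 mul0r addr0 mul1r subrr.
Qed.

Let term f i s : R := (pi^-1 * amp2 f i) * fejq i.+1 s.

Let term_ge0 f i s : 0 <= term f i s.
Proof. by rewrite mulr_ge0 ?fejq_ge0// mulr_ge0 ?amp2_ge0// invr_ge0 pi_ge0. Qed.

Let measurable_term f i : measurable_fun setT (fun s => (term f i s)%:E).
Proof. by apply/measurable_EFinP; apply: measurable_funM => //; exact: measurable_fejq. Qed.

Let integral_term f i :
  (\int[mu]_(s in P) (term f i s)%:E = (2 * (i.+1%:R * amp2 f i))%:E)%E.
Proof.
have c0 : 0 <= pi^-1 * amp2 f i by rewrite mulr_ge0 ?amp2_ge0// invr_ge0 pi_ge0.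
transitivity (\int[mu]_(s in P) ((pi^-1 * amp2 f i)%:E * (fejq i.+1 s)%:E))%E.
  by apply: eq_integral => s _; rewrite -EFinM.
rewrite ge0_integralZl//; try first [exact: measurable_period |
  by apply: measurable_funTS; apply/measurable_EFinP; exact: measurable_fejq |
  by move=> s _; rewrite lee_fin fejq_ge0 | by rewrite lee_fin].
rewrite integral_fejq -EFinM; congr EFin.
have p0 : (pi : R) != 0 by rewrite gt_eqF ?pi_gt0.
by move: (amp2 _ _) (pi : R) p0 => a q q0; field.
Qed.

Let amp2_term f s i : L2p f ->
  (2 * (1 - cos s))^-1 * (pi^-1 * amp2 (fun x => f (x + s) - f x) i) = term f i s.
Proof.
move=> hf; rewrite amp2_shift// /term /fejq invfM.
move: ((1 - cos s)^-1) (amp2 _ _) (pi^-1) (cosn _ _) => a b c d.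
have h2 : (2^-1 : R) * 2 = 1 by rewrite mulVf// pnatr_eq0.
have -> : 2^-1 * a * (c * (2 * (1 - d) * b)) = (2^-1 * 2) * (c * b * ((1 - d) * a)) by ring.
by rewrite h2 mul1r.
Qed.

(** One half of Douglas' formula, by Bessel's inequality for the differences
    f (x + s) - f x and the integral of the Fejer kernel. *)
Lemma energye_ge f n : L2p f -> ((2 * \sum_(i < n) i.+1%:R * amp2 f i)%:E <= energye f)%E.
Proof.
move=> hf; rewrite energyeE//.
have -> : ((2 * \sum_(i < n) i.+1%:R * amp2 f i)%:E =
    \int[mu]_(s in P) \sum_(i < n) (term f i s)%:E)%E.
  rewrite ge0_integral_sum//; try first [exact: measurable_period |
    by move=> i; apply: measurable_funTS; exact: measurable_term |
    by move=> i s _; rewrite lee_fin term_ge0].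
  rewrite mulr_sumr -sumEFin; apply: eq_bigr => i _.
  by rewrite integral_term.
apply: ge0_le_integral.
- exact: measurable_period.
- by move=> s _; apply: sume_ge0 => i _; rewrite lee_fin term_ge0.
- apply: measurable_funTS; apply: emeasurable_sum => i.
  exact: measurable_term.
- exact: measurable_shift_energy.
- move=> s _; rewrite sumEFin lee_fin.
  have hs : L2p (fun x => f (x + s) - f x) by apply: L2pB => //; exact: L2p_shift.
  have B := bessel n hs.
  rewrite (eq_bigr (fun i : 'I_n => (2 * (1 - cos s))^-1 *
    (pi^-1 * amp2 (fun x => f (x + s) - f x) i))); last first.
    by move=> i _; rewrite amp2_term.
  rewrite -!mulr_sumr ler_wpM2l ?invr_ge0 ?mulr_ge0 ?onem_cos_ge0//.
  by rewrite ler_pdivrMl ?pi_gt0.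
Qed.

Lemma weights_bounded_shift f s : L2p f -> weights_bounded f ->
  weights_bounded (fun x => f (x + s) - f x).
Proof.
move=> hf [M hM]; exists (4 * M) => n; rewrite -ler_pdivrMl//.
apply: le_trans (hM n); rewrite mulr_sumr; apply: ler_sum => i _.
rewrite amp2_shift// ler_pdivrMl//.
have := cos_geN1 (i.+1%:R * s); have := amp2_ge0 f i; rewrite -/(cosn i.+1 s).
have := ler0n R i.+1.
move: (cosn _ _) (amp2 _ _) (i.+1%:R) => C e k k0' e0 C1.
have := mulr_ge0 k0' e0; nra.
Qed.

(** Douglas' formula.  Parseval's identity for f (x + s) - f x turns the inner
    integral into a sum of Fejer kernels, which is integrated term by term. *)
Lemma energye_cvg f : L2p f -> weights_bounded f ->
  (fun n => (2 * \sum_(i < n) i.+1%:R * amp2 f i)%:E) @ \oo --> energye f.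
Proof.
move=> hf wf; rewrite energyeE//.
have -> : (\int[mu]_(s in P) ((2 * (1 - cos s))^-1 *
            ip (fun x => f (x + s) - f x) (fun x => f (x + s) - f x))%:E =
    \int[mu]_(s in P) \sum_(0 <= i <oo) (term f i s)%:E)%E.
  apply: eq_integral => s _; apply/esym/cvg_lim => //.
  have hs : L2p (fun x => f (x + s) - f x) by apply: L2pB => //; exact: L2p_shift.
  have h0 := parseval hs (ccoef0_shift s hf) (weights_bounded_shift s hf wf).
  have h : (fun n => (2 * (1 - cos s))^-1 * (pi^-1 * \sum_(i < n) amp2 (fun x => f (x + s) - f x) i)) @ \oo
     --> (2 * (1 - cos s))^-1 * ip (fun x => f (x + s) - f x) (fun x => f (x + s) - f x).
    by apply: cvgMr.
  rewrite [X in X @ \oo --> _](_ : _ = EFin \o (fun n => (2 * (1 - cos s))^-1 *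
      (pi^-1 * \sum_(i < n) amp2 (fun x => f (x + s) - f x) i))); last first.
    apply/funext => n /=; rewrite big_mkord sumEFin; congr EFin.
    rewrite !mulr_sumr; by apply: eq_bigr => i _; rewrite -amp2_term.
  by apply/cvg_EFin => //; exact: nearW.
rewrite integral_nneseries//; try first [exact: measurable_period |
    by move=> i; apply: measurable_funTS; exact: measurable_term |
    by move=> i s _; rewrite lee_fin term_ge0].
apply: cvg_trans (is_cvg_nneseries _); last first.
  by move=> i _ _; apply: integral_ge0 => s _; rewrite lee_fin term_ge0.
apply: near_eq_cvg; apply: nearW => n /=.
rewrite big_mkord mulr_sumr -sumEFin; apply: eq_bigr => i _.
by rewrite integral_term.
Qed.

End Douglas.

(** * The energy form *)

Section Form.
Variable R : realType.
Implicit Types (f g : R -> R) (x y : R) (m : R * R -> R).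
Local Notation mu := (@lebesgue_measure R).
Local Notation P := (period R).
Local Notation tau := (2 * @pi R).
Local Notation itg f := (mu.-integrable P (EFin \o f)).
Hint Resolve L2p_cosn L2p_sinn L2p_cst : core.
Local Notation PP := (P `*` P).
Local Notation mu2 := ((mu \x mu)%E).
Local Notation itg2 F := (mu2.-integrable PP (EFin \o F)).

Lemma measurable_square :
  @measurable _ (measurableTypeR R * measurableTypeR R)%type PP.
Proof. by apply: measurableX; exact: measurable_period. Qed.

Lemma integral_square (F : R * R -> \bar R) : measurable_fun setT F ->
  (forall z, 0 <= F z)%E ->
  (\int[mu2]_(z in PP) F z = \int[mu]_(x in P) \int[mu]_(y in P) F (x, y))%E.
Proof.
move=> mF F0.
have mD := measurable_square.
have mG : measurable_fun setT (F \_ PP).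
  have [+ _] := measurable_restrict F mD (@measurableT _ _).
  by apply; exact: measurable_funTS.
have G0 z : (0 <= (F \_ PP) z)%E by rewrite patchE; case: ifP.
rewrite [LHS]integral_mkcond.
transitivity (\int[mu]_x fubini_F mu (F \_ PP) x)%E.
  exact: (fubini_tonelli1 (m1 := mu) (m2 := mu) _ mG G0).
rewrite [in RHS]integral_mkcond; apply: eq_integral => x _ /=.
rewrite patchE; case: ifPn => xP.
  rewrite /fubini_F [in RHS]integral_mkcond; apply: eq_integral => y _.
  by rewrite !patchE in_setX /= xP.
rewrite /fubini_F; apply: integral0_eq => y _.
by rewrite patchE in_setX /= (negbTE xP).
Qed.

(** Real functions of finite energy, representing the classes of H^(1/2). *)
Definition Hhalf f := L2p f /\ itg2 (fun z => increment f z ^+ 2 * ekernel z).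

Lemma Hhalf_L2p f : Hhalf f -> L2p f. Proof. by case. Qed.
Hint Resolve Hhalf_L2p : core.

Lemma measurable_sqr_ekernel f : L2p f -> measurable_fun setT (fun z => increment f z ^+ 2 * ekernel z).
Proof.
move=> [_ mf _]; apply: measurable_funM; last exact: measurable_ekernel.
by apply: measurable_funX; exact: measurable_increment.
Qed.

Lemma sqr_ekernel_ge0 f z : 0 <= increment f z ^+ 2 * ekernel z.
Proof. by rewrite mulr_ge0 ?sqr_ge0// ekernel_ge0. Qed.

Lemma energye_square f : L2p f ->
  (\int[mu2]_(z in PP) (increment f z ^+ 2 * ekernel z)%:E = energye f)%E.
Proof.
move=> hf; rewrite integral_square//.
  by apply/measurable_EFinP; exact: measurable_sqr_ekernel.
by move=> z; rewrite lee_fin sqr_ekernel_ge0.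
Qed.

Lemma Hhalf_energye f : L2p f -> (energye f < +oo)%E -> Hhalf f.
Proof.
move=> hf h; split => //; apply/integrableP; split.
  by apply/measurable_EFinP; apply: measurable_funTS; exact: measurable_sqr_ekernel.
rewrite (_ : (\int[_]_(_ in _) _)%E = energye f)//.
rewrite -energye_square//; apply: eq_integral => z _ /=.
by rewrite ger0_norm ?sqr_ekernel_ge0.
Qed.

Definition ker m f g (z : R * R) := increment f z * increment g z * ekernel z * m z.

Definition eform m f g : R := \int[mu2]_(z in PP) ker m f g z.
Definition energy f := eform (cst 1) f f.

Lemma energyE f : Hhalf f -> (energy f)%:E = energye f.
Proof.
move=> [hf fi]; rewrite /energy /eform /Rintegral.
rewrite (_ : (\int[_]_(_ in _) _)%E = energye f) ?fineK//; last first.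
  rewrite -energye_square//; apply: eq_integral => z _ /=.
  by rewrite /ker mulr1 expr2.
rewrite -energye_square//; apply: integrable_fin_num => //; exact: measurable_square.
Qed.

Definition bsym (M : R) m := measurable_fun setT m /\ forall z, `|m z| <= M.

Lemma measurable_ker m f g : L2p f -> L2p g -> measurable_fun setT m ->
  measurable_fun setT (ker m f g).
Proof.
move=> [_ mf _] [_ mg _] mm; apply: measurable_funM => //.
apply: measurable_funM; last exact: measurable_ekernel.
by apply: measurable_funM; exact: measurable_increment.
Qed.

Lemma ker_le M m f g t z : 0 < t -> bsym M m ->
  `|ker m f g z| <= M / 2 * (t * (increment f z ^+ 2 * ekernel z) + t^-1 * (increment g z ^+ 2 * ekernel z)).
Proof.
move=> t0 [_ hm]; rewrite /ker !normrM (ger0_norm (ekernel_ge0 z)).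
have := hm z; have := ekernel_ge0 z; have := normr_ge0 (m z).
move: `|m z| (ekernel z) => b k b0 hk bM.
rewrite -(real_normK (num_real (increment f z))) -(real_normK (num_real (increment g z))).
move: `|increment f z| `|increment g z| (normr_ge0 (increment f z)) (normr_ge0 (increment g z)) => p q p0 q0.
have h : 2 * (p * q) <= t * p ^+ 2 + t^-1 * q ^+ 2.
  rewrite -subr_ge0.
  have -> : t * p ^+ 2 + t^-1 * q ^+ 2 - 2 * (p * q) = t^-1 * (t * p - q) ^+ 2.
    by field; rewrite gt_eqF.
  by rewrite mulr_ge0 ?sqr_ge0// invr_ge0 ltW.
have M0 : 0 <= M := le_trans b0 bM.
apply: (@le_trans _ _ (p * q * k * M)).
  by rewrite ler_wpM2l// !mulr_ge0.
have -> : M / 2 * (t * (p ^+ 2 * k) + t^-1 * (q ^+ 2 * k)) =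
   (M / 2 * k) * (t * p ^+ 2 + t^-1 * q ^+ 2) by ring.
have -> : p * q * k * M = (M / 2 * k) * (2 * (p * q)) by field.
by rewrite ler_wpM2l// mulr_ge0// divr_ge0.
Qed.

Lemma itg2Z c F : itg2 F -> itg2 (fun z => c * F z).
Proof.
by move=> h; have := integrableZl measurable_square c h.
Qed.

Lemma itg2D F G : itg2 F -> itg2 G -> itg2 (fun z => F z + G z).
Proof. by move=> h k; have := integrableD measurable_square h k. Qed.

Lemma itg2_le (F G : R * R -> R) : measurable_fun setT F -> (forall z, `|F z| <= G z) ->
  itg2 G -> itg2 F.
Proof.
move=> mF FG; apply: le_integrable.
- exact: measurable_square.
- by apply/measurable_EFinP; apply: measurable_funTS.
- by move=> z _ /=; rewrite lee_fin (le_trans (FG z))// ler_norm.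
Qed.

Lemma itg2_ker M m f g : Hhalf f -> Hhalf g -> bsym M m -> itg2 (ker m f g).
Proof.
move=> [hf fi] [hg gi] hm.
apply: (@itg2_le _ (fun z => M / 2 * (1 * (increment f z ^+ 2 * ekernel z)
    + 1^-1 * (increment g z ^+ 2 * ekernel z)))).
- by apply: measurable_ker => //; case: hm.
- by move=> z; apply: ker_le.
- by apply: itg2Z; apply: itg2D; apply: itg2Z.
Qed.

Lemma bsym_cst c : bsym `|c| (cst c).
Proof. by split. Qed.

Lemma bsym1 : bsym 1 (cst 1).
Proof. by have := bsym_cst 1; rewrite normr1. Qed.
Hint Resolve bsym1 : core.

Lemma eformC m f g : eform m f g = eform m g f.
Proof. by rewrite /eform /ker; congr Rintegral; apply/funext => z; rewrite (mulrC (increment f z)). Qed.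

Lemma energy_ge0 f : 0 <= energy f.
Proof.
apply: Rintegral_ge0 => z _; rewrite /ker mulr1 -expr2 sqr_ekernel_ge0 //.
Qed.

Lemma HhalfD f g : Hhalf f -> Hhalf g -> Hhalf (fun x => f x + g x).
Proof.
move=> [hf fi] [hg gi]; split; first exact: L2pD.
apply: (@itg2_le _ (fun z => 2 * (increment f z ^+ 2 * ekernel z + increment g z ^+ 2 * ekernel z))).
- by apply: measurable_sqr_ekernel; exact: L2pD.
- move=> z; rewrite ger0_norm ?sqr_ekernel_ge0// /increment.
  have := ekernel_ge0 z; move: (ekernel z) (f z.1) (f z.2) (g z.1) (g z.2) => k a b c d hk.
  have -> : 2 * ((a - b) ^+ 2 * k + (c - d) ^+ 2 * k) = 2 * ((a - b) ^+ 2 + (c - d) ^+ 2) * k by ring.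
  by rewrite ler_wpM2r//; have := sqr_ge0 (a - b - (c - d)); nra.
- by apply: itg2Z; apply: itg2D.
Qed.

Lemma HhalfZ c f : Hhalf f -> Hhalf (fun x => c * f x).
Proof.
move=> [hf fi]; split; first exact: L2pZ.
apply: (@itg2_le _ (fun z => c ^+ 2 * (increment f z ^+ 2 * ekernel z))).
- by apply: measurable_sqr_ekernel; exact: L2pZ.
- move=> z; rewrite ger0_norm ?sqr_ekernel_ge0// /increment le_eqVlt; apply/orP; left.
  by apply/eqP; ring.
- exact: itg2Z.
Qed.

Lemma HhalfB f g : Hhalf f -> Hhalf g -> Hhalf (fun x => f x - g x).
Proof.
move=> hf hg; have := HhalfD hf (HhalfZ (-1) hg).
by rewrite (_ : (fun x => _ + -1 * _) = (fun x => f x - g x))//; apply/funext => x; rewrite mulN1r.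
Qed.

Lemma Hhalf_cst c : Hhalf (cst c).
Proof.
split => //; apply: (@itg2_le _ (cst 0)).
- exact: measurable_sqr_ekernel.
- by move=> z; rewrite /increment subrr expr0n mul0r normr0.
- exact: integrable0.
Qed.

Lemma eformDl M m f g h : bsym M m -> Hhalf f -> Hhalf g -> Hhalf h ->
  eform m (fun x => f x + g x) h = eform m f h + eform m g h.
Proof.
move=> hm hf hg hh; rewrite /eform -RintegralD//.
- by congr Rintegral; apply/funext => z; rewrite /ker /increment; ring.
- exact: measurable_square.
- exact: itg2_ker hm.
- exact: itg2_ker hm.
Qed.

Lemma eformZl M m c f h : bsym M m -> Hhalf f -> Hhalf h ->
  eform m (fun x => c * f x) h = c * eform m f h.
Proof.
move=> hm hf hh; rewrite /eform -RintegralZl//.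
- by congr Rintegral; apply/funext => z; rewrite /ker /increment; ring.
- exact: measurable_square.
- exact: itg2_ker hm.
Qed.

Lemma eformBl M m f g h : bsym M m -> Hhalf f -> Hhalf g -> Hhalf h ->
  eform m (fun x => f x - g x) h = eform m f h - eform m g h.
Proof.
move=> hm hf hg hh; have := eformDl hm hf (HhalfZ (-1) hg) hh.
rewrite (eformZl (-1) hm hg hh) mulN1r => <-.
by congr eform; apply/funext => x; rewrite mulN1r.
Qed.

Lemma eformDr M m f g h : bsym M m -> Hhalf f -> Hhalf g -> Hhalf h ->
  eform m h (fun x => f x + g x) = eform m h f + eform m h g.
Proof. by move=> hm hf hg hh; rewrite eformC (eformDl hm)// !(eformC m h). Qed.

Lemma eformZr M m c f h : bsym M m -> Hhalf f -> Hhalf h ->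
  eform m h (fun x => c * f x) = c * eform m h f.
Proof. by move=> hm hf hh; rewrite eformC (eformZl _ hm)// (eformC m h). Qed.

Lemma eformDm M1 M2 m1 m2 f g : bsym M1 m1 -> bsym M2 m2 -> Hhalf f -> Hhalf g ->
  eform (fun z => m1 z + m2 z) f g = eform m1 f g + eform m2 f g.
Proof.
move=> h1 h2 hf hg; rewrite /eform -RintegralD//.
- by congr Rintegral; apply/funext => z; rewrite /ker; ring.
- exact: measurable_square.
- exact: itg2_ker h1.
- exact: itg2_ker h2.
Qed.

Lemma eformZm M c m f g : bsym M m -> Hhalf f -> Hhalf g ->
  eform (fun z => c * m z) f g = c * eform m f g.
Proof.
move=> hm hf hg; rewrite /eform -RintegralZl//.
- by congr Rintegral; apply/funext => z; rewrite /ker; ring.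
- exact: measurable_square.
- exact: itg2_ker hm.
Qed.

Lemma bsymD M1 M2 m1 m2 : bsym M1 m1 -> bsym M2 m2 -> bsym (M1 + M2) (fun z => m1 z + m2 z).
Proof.
move=> [a1 b1] [a2 b2]; split; first exact: measurable_funD.
by move=> z; rewrite (le_trans (ler_normD _ _))// lerD.
Qed.

Lemma bsymZ M c m : bsym M m -> bsym (`|c| * M) (fun z => c * m z).
Proof.
move=> [a b]; split; first exact: measurable_funM.
by move=> z; rewrite normrM ler_wpM2l.
Qed.

Lemma eform_young M m f g t : 0 < t -> bsym M m -> Hhalf f -> Hhalf g ->
  `|eform m f g| <= M / 2 * (t * energy f + t^-1 * energy g).
Proof.
move=> t0 hm hf hg; have fg := itg2_ker hf hg hm.
have ff := itg2_ker hf hf bsym1; have gg := itg2_ker hg hg bsym1.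
have := le_normr_Rintegral measurable_square fg.
move=> /le_trans; apply.
rewrite /energy /eform -!RintegralZl//; try exact: measurable_square.
rewrite -RintegralD//; try exact: measurable_square; try exact: itg2Z.
rewrite -RintegralZl//; try exact: measurable_square; last by apply: itg2D; exact: itg2Z.
apply: le_Rintegral.
- exact: measurable_square.
- exact: integrable_norm.
- by apply: itg2Z; apply: itg2D; apply: itg2Z.
- move=> z _; rewrite (le_trans (ker_le f g z t0 hm))// le_eqVlt; apply/orP; left; apply/eqP.
  by rewrite /ker /=; ring.
Qed.

(** Optimizing over t gives the Cauchy-Schwarz bound; p and q are enlarged by
    a small e because the optimal t = sqrt (q / p) may not exist. *)
Lemma young_CS (M p q b : R) : 0 <= M -> 0 <= p -> 0 <= q ->
  (forall t, 0 < t -> `|b| <= M / 2 * (t * p + t^-1 * q)) -> b ^+ 2 <= M ^+ 2 * (p * q).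
Proof.
move=> M0 p0 q0 h; rewrite -(real_normK (num_real b)).
move: `|b| (normr_ge0 b) h => {}b b0 h.
have h' e : 0 < e -> b ^+ 2 <= M ^+ 2 * ((p + e) * (q + e)).
  move=> e0; have pe : 0 < p + e by rewrite ltr_wpDl.
  have qe : 0 < q + e by rewrite ltr_wpDl.
  have sp : 0 < Num.sqrt (p + e) by rewrite sqrtr_gt0.
  have sq : 0 < Num.sqrt (q + e) by rewrite sqrtr_gt0.
  have := h (Num.sqrt (q + e) / Num.sqrt (p + e)) (divr_gt0 sq sp).
  have P2 := sqr_sqrtr (ltW pe); have Q2 := sqr_sqrtr (ltW qe).
  move: (Num.sqrt _) (Num.sqrt _) sp sq P2 Q2 => u v u0 v0 P2 Q2 hb.
  have {}hb : b <= M * (u * v).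
    apply: (le_trans hb).
    have -> : M * (u * v) = M / 2 * (u / v * v ^+ 2 + (u / v)^-1 * u ^+ 2).
      by field; rewrite !gt_eqF.
    have r0 : 0 < u / v by rewrite divr_gt0.
    rewrite ler_wpM2l ?divr_ge0// P2 Q2 lerD// ler_wpM2l ?invr_ge0 ?(ltW r0)//.
    + by rewrite ltW// ltrDl.
    + by rewrite ltW// ltrDl.
  have := ler_pM b0 b0 hb hb; rewrite -expr2 => /le_trans -> //.
  by rewrite -P2 -Q2 le_eqVlt; apply/orP; left; apply/eqP; ring.
have [M_eq|Mn] := eqVneq M 0.
  by have := h' 1 ltr01; rewrite M_eq expr0n /= !mul0r.
apply/ler_addgt0Pr => e e0.
have M2 : 0 < M ^+ 2 by rewrite exprn_gt0// lt_def Mn.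
pose d := Num.min 1 (e / (M ^+ 2 * (p + q + 1))).
have c0 : 0 < M ^+ 2 * (p + q + 1) by rewrite mulr_gt0// ltr_wpDl// addr_ge0.
have d0 : 0 < d by rewrite lt_min ltr01 divr_gt0.
have d1 : d <= 1 by rewrite ge_min lexx.
have d2 : d * (M ^+ 2 * (p + q + 1)) <= e by rewrite -ler_pdivlMr// ge_min lexx orbT.
apply: (le_trans (h' d d0)).
have -> : M ^+ 2 * ((p + d) * (q + d)) = M ^+ 2 * (p * q) + d * (M ^+ 2 * (p + q + d)) by ring.
rewrite lerD2l; apply: le_trans d2; rewrite (ler_pM2l d0) (ler_pM2l M2).
by rewrite lerD2l.
Qed.

Lemma eform_CS M m f g : bsym M m -> Hhalf f -> Hhalf g ->
  (eform m f g) ^+ 2 <= M ^+ 2 * (energy f * energy g).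
Proof.
move=> hm hf hg; apply: young_CS; rewrite ?energy_ge0//.
  by case: hm => _ /(_ (0, 0)); apply: le_trans.
by move=> t t0; apply: eform_young.
Qed.

Lemma energyD f g : Hhalf f -> Hhalf g ->
  energy (fun x => f x + g x) = energy f + 2 * eform (cst 1) f g + energy g.
Proof.
move=> hf hg; have hfg := HhalfD hf hg.
rewrite /energy (eformDl bsym1 hf hg hfg) !(eformDr bsym1 hf hg)// (eformC _ g f); ring.
Qed.

(** * Energy in terms of Fourier coefficients *)
Lemma Hhalf_weights f : Hhalf f -> weights_bounded f.
Proof.
move=> hf; exists (energy f / 2) => n; rewrite ler_pdivlMr// mulrC -lee_fin energyE//.
by apply: energye_ge; case: hf.
Qed.

Lemma weights_Hhalf f : L2p f -> weights_bounded f -> Hhalf f.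
Proof.
move=> hf wf; apply: Hhalf_energye => //.
have [M hM] := wf.
apply: (@le_lt_trans _ _ (2 * M)%:E); last exact: ltry.
apply: (cvge_to_le (energye_cvg hf wf)); apply: nearW => n.
by rewrite lee_fin ler_wpM2l.
Qed.

Lemma energy_cvg f : Hhalf f -> (fun n => 2 * \sum_(i < n) i.+1%:R * amp2 f i) @ \oo --> energy f.
Proof.
move=> hf; have := energye_cvg (Hhalf_L2p hf) (Hhalf_weights hf); rewrite -energyE//.
by move/fine_cvgP => [].
Qed.

Lemma energy_le f (M : R) : Hhalf f -> (forall n, 2 * \sum_(i < n) i.+1%:R * amp2 f i <= M) -> energy f <= M.
Proof.
by move=> hf h; apply: (cvgr_to_le (energy_cvg hf)); exact: nearW. Qed.

Definition coef_pairing n f g :=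
  \sum_(i < n) i.+1%:R * (ccoef f i.+1 * ccoef g i.+1 + scoef f i.+1 * scoef g i.+1).

Lemma eform1_cvg f g : Hhalf f -> Hhalf g -> (fun n => 2 * coef_pairing n f g) @ \oo --> eform (cst 1) f g.
Proof.
move=> hf hg.
have -> : eform (cst 1) f g = 2^-1 * (energy (fun x => f x + g x) - energy f - energy g).
  by rewrite energyD//; field.
have -> : (fun n => 2 * coef_pairing n f g) = (fun n => 2^-1 *
   (2 * (\sum_(i < n) i.+1%:R * amp2 (fun x => f x + g x) i) -
   2 * (\sum_(i < n) i.+1%:R * amp2 f i) - 2 * (\sum_(i < n) i.+1%:R * amp2 g i))).
  apply/funext => n; rewrite /coef_pairing !mulr_sumr -!sumrB mulr_sumr; apply: eq_bigr => i _.
  rewrite /amp2 /ccoef /scoef !ipDl//; try exact: Hhalf_L2p.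
  by field.
apply: cvgMr; apply: cvgB; first apply: cvgB; apply: energy_cvg => //.
exact: HhalfD.
Qed.

End Form.

(** * Operators given by a symbol *)

Section Symbol.
Variable R : realType.
Implicit Types (f g : R -> R) (x y : R) (m : R * R -> R).
Local Notation mu := (@lebesgue_measure R).
Local Notation P := (period R).
Local Notation tau := (2 * @pi R).
Hint Resolve L2p_cosn L2p_sinn L2p_cst Hhalf_L2p : core.
Local Notation PP := (P `*` P).
Local Notation mu2 := ((mu \x mu)%E).
Local Notation itg2 F := (mu2.-integrable PP (EFin \o F)).

Lemma square_measure : mu2 PP = (tau * tau)%:E.
Proof.
have -> : mu2 PP = (mu P * mu P)%E.
  by apply: product_measure1E; exact: measurable_period.
by rewrite period_measure EFinM.
Qed.

Lemma itg2_cst (c : R) : itg2 (cst c).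
Proof.
apply/integrableP; split; first by apply/measurable_EFinP; exact: measurable_cst.
rewrite /comp /= integral_cst; last exact: measurable_square.
apply: (@le_lt_trans _ _ (`|c| * (tau * tau))%:E); last exact: ltry.
by rewrite EFinM -square_measure.
Qed.

Lemma chord_lip_kernel f C z : chord_lip f C -> increment f z ^+ 2 * ekernel z <= C / 2.
Proof.
move=> h; have := h z.1 z.2; rewrite /increment /ekernel.
have := @onem_cos_ge0 R (z.1 - z.2).
rewrite le_eqVlt => /predU1P[<-|c0].
  rewrite !mulr0 invr0 mulr0 => _; rewrite divr_ge0//.
  have := h pi 0.
  rewrite subr0 cospi opprK; have := sqr_ge0 (f pi - f 0).
  by nra.
by move=> h'; rewrite ler_pdivrMr ?mulr_gt0// (le_trans h')// mulrA divfK.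
Qed.

Lemma chord_lip_Hhalf f C : L2p f -> chord_lip f C -> Hhalf f.
Proof.
move=> hf h; split => //; apply: (@itg2_le _ _ (cst (C / 2))).
- exact: measurable_sqr_ekernel.
- by move=> z; rewrite ger0_norm ?sqr_ekernel_ge0// chord_lip_kernel.
- exact: itg2_cst.
Qed.

Lemma chord_lip_energy f C : L2p f -> chord_lip f C -> energy f <= C / 2 * tau ^+ 2.
Proof.
move=> hf h; have [_ fi] := chord_lip_Hhalf hf h.
have -> : C / 2 * tau ^+ 2 = \int[mu2]_(z in PP) (cst (C / 2)) z.
  rewrite Rintegral_cst; last exact: measurable_square.
  congr (_ * _); rewrite expr2; have := square_measure.
  by move=> /(congr1 fine) /= /esym.
apply: le_Rintegral.
- exact: measurable_square.
- by apply: (itg2_ker (chord_lip_Hhalf hf h) (chord_lip_Hhalf hf h)); exact: bsym1.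
- exact: itg2_cst.
- by move=> z _; rewrite /ker /= mulr1 -expr2 chord_lip_kernel.
Qed.

Lemma derive_Hhalf f (df : R -> R) : per f -> (forall x, is_derive x 1 f (df x)) ->
  continuous df -> Hhalf f.
Proof.
move=> pf d c; have [C _ h] := C1_chord_lip pf d c.
apply: chord_lip_Hhalf h; apply: L2p_continuous => //.
exact: is_derive_continuous d.
Qed.

Lemma Hhalf_cosn n : Hhalf (@cosn R n).
Proof.
apply: (derive_Hhalf (@per_cosn _ n) (is_derive_cosn n)).
by apply: continuous_scale; exact: continuous_sinn.
Qed.

Lemma Hhalf_sinn n : Hhalf (@sinn R n).
Proof.
apply: (derive_Hhalf (@per_sinn _ n) (is_derive_sinn n)).
by apply: continuous_scale; exact: continuous_cosn.
Qed.
Hint Resolve Hhalf_cosn Hhalf_sinn : core.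

Lemma trigS (c s : nat -> R) N : trig c s N.+1 =
  (fun x => trig c s N x + (c N * cosn N.+1 x + s N * sinn N.+1 x)).
Proof. by apply/funext => x; rewrite /trig big_ord_recr. Qed.

Lemma Hhalf_trig (c s : nat -> R) N : Hhalf (trig c s N).
Proof.
elim: N => [|N IH].
  rewrite (_ : trig _ _ _ = cst 0); first exact: Hhalf_cst.
  by apply/funext => x; rewrite /trig big_ord0.
by rewrite trigS; apply: HhalfD => //; apply: HhalfD; apply: HhalfZ.
Qed.

Lemma eform_trig M m f (c s : nat -> R) N : bsym M m -> Hhalf f ->
  eform m f (trig c s N) =
    \sum_(i < N) (c i * eform m f (cosn i.+1) + s i * eform m f (sinn i.+1)).
Proof.
move=> hm hf; elim: N => [|N IH].
  rewrite big_ord0 (_ : trig _ _ _ = fun x => 0 * cosn 0 x).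
    by rewrite (eformZr _ hm)// mul0r.
  by apply/funext => x; rewrite /trig big_ord0 mul0r.
have h1 : Hhalf (fun x => c N * cosn N.+1 x) by exact: HhalfZ.
have h2 : Hhalf (fun x => s N * sinn N.+1 x) by exact: HhalfZ.
rewrite big_ord_recr /= -IH trigS (eformDr hm (Hhalf_trig _ _ _) (HhalfD h1 h2) hf).
by rewrite (eformDr hm h1 h2 hf) !(eformZr _ hm).
Qed.

Lemma energy_trig (c s : nat -> R) N :
  energy (trig c s N) <= 2 * pi ^+ 2 * \sum_(i < N) i.+1%:R * (c i ^+ 2 + s i ^+ 2).
Proof.
apply: energy_le; first exact: Hhalf_trig.
move=> n; rewrite -mulrA ler_wpM2l// mulr_sumr.
have e i : i.+1%:R * amp2 (trig c s N) i =
    if (i < N)%N then pi ^+ 2 * (i.+1%:R * (c i ^+ 2 + s i ^+ 2)) else 0.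
  by rewrite /amp2 ccoef_trig scoef_trig; case: ifP => _; ring.
have e0 i : 0 <= i.+1%:R * amp2 (trig c s N) i by rewrite mulr_ge0 ?amp2_ge0.
apply: (@le_trans _ _ (\sum_(i < maxn n N) i.+1%:R * amp2 (trig c s N) i)).
  rewrite (big_ord_widen (maxn n N) (fun i => i.+1%:R * amp2 (trig c s N) i) (leq_maxl n N)).
  by rewrite [leRHS](bigID (fun i : 'I__ => (i < n)%N))/= lerDl sumr_ge0.
rewrite (big_ord_widen (maxn n N) (fun i => pi ^+ 2 * (i.+1%:R * (c i ^+ 2 + s i ^+ 2))) (leq_maxr n N)).
by rewrite [leRHS]big_mkcond; apply: ler_sum => i _; rewrite e.
Qed.

(** [g] is the image of [f] under the operator T_m, up to an additive constant:
    tau <g, w'> = - E[m](f, w) for w = sin and w = cos of each frequency. *)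
Definition has_symbol m f g := forall i : nat,
  tau * i.+1%:R * ccoef g i.+1 = - eform m f (sinn i.+1) /\
  tau * i.+1%:R * scoef g i.+1 = eform m f (cosn i.+1).

(** The test function w is, up to sign, the conjugate of the partial sum with
    coefficients a and b.  Then E[m](f, w) is 2pi times the weighted sum S on the left, while
    the energy of w is 2 pi^2 S, and Cauchy-Schwarz gives a bound for S. *)
Lemma has_symbol_coef_le M m f (a b : nat -> R) N : bsym M m -> Hhalf f ->
  (forall i, tau * i.+1%:R * a i = - eform m f (sinn i.+1) /\
             tau * i.+1%:R * b i = eform m f (cosn i.+1)) ->
  2 * \sum_(i < N) i.+1%:R * (a i ^+ 2 + b i ^+ 2) <= M ^+ 2 * energy f.
Proof.
move=> hm hf ab; set S := \sum_(i < N) _.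
have S0 : 0 <= S by apply: sumr_ge0 => i _; rewrite mulr_ge0 ?addr_ge0 ?sqr_ge0.
pose w := trig b (fun i => - a i) N.
have hw : Hhalf w by exact: Hhalf_trig.
have Bw : eform m f w = tau * S.
  rewrite (eform_trig _ _ _ hm hf) mulr_sumr; apply: eq_bigr => i _.
  have [h1 h2] := ab i; rewrite -h2 -[eform m f (sinn _)]opprK -h1; ring.
have Qw : energy w <= 2 * pi ^+ 2 * S.
  apply: (le_trans (energy_trig _ _ _)); rewrite ler_wpM2l ?mulr_ge0 ?pi_ge0//.
  by apply: ler_sum => i _; rewrite sqrrN addrC.
have := eform_CS hm hf hw; rewrite Bw => h.
have {h} : (tau * S) ^+ 2 <= M ^+ 2 * (energy f * (2 * pi ^+ 2 * S)).
  by apply: (le_trans h); rewrite ler_wpM2l ?sqr_ge0// ler_wpM2l// energy_ge0.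
have -> : (tau * S) ^+ 2 = 2 * pi ^+ 2 * S * (2 * S) by ring.
have -> : M ^+ 2 * (energy f * (2 * pi ^+ 2 * S)) = 2 * pi ^+ 2 * S * (M ^+ 2 * energy f) by ring.
move: S0; rewrite le_eqVlt => /predU1P[<- _|S0].
  by rewrite mulr0 mulr_ge0 ?sqr_ge0// energy_ge0.
by rewrite ler_pM2l// !mulr_gt0 ?pi_gt0// exprn_gt0 ?pi_gt0.
Qed.

Lemma has_symbol_Hhalf M m f g : bsym M m -> Hhalf f -> L2p g -> has_symbol m f g -> Hhalf g.
Proof.
move=> hm hf hg h; apply: weights_Hhalf => //; exists (M ^+ 2 * energy f / 2) => n.
by rewrite ler_pdivlMr// mulrC (has_symbol_coef_le n hm hf h).
Qed.

Lemma has_symbol_energy M m f g : bsym M m -> Hhalf f -> L2p g -> has_symbol m f g ->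
  energy g <= M ^+ 2 * energy f.
Proof.
move=> hm hf hg h; apply: energy_le; first exact: has_symbol_Hhalf hm hf hg h.
by move=> n; exact: (has_symbol_coef_le n hm hf h).
Qed.

Lemma has_symbol_exists M m f : bsym M m -> Hhalf f -> exists g, [/\ Hhalf g, ccoef g 0 = 0 & has_symbol m f g].
Proof.
move=> hm hf; have t0 i : tau * i.+1%:R != 0.
  by rewrite mulf_neq0// gt_eqF// tau_gt0.
have p0 : (pi : R) != 0 by rewrite gt_eqF ?pi_gt0.
pose a i := - eform m f (sinn i.+1) / (tau * i.+1%:R).
pose b i := eform m f (cosn i.+1) / (tau * i.+1%:R).
have ab i : tau * i.+1%:R * a i = - eform m f (sinn i.+1) /\
            tau * i.+1%:R * b i = eform m f (cosn i.+1).
  by rewrite /a /b ![_ * (_ / _)]mulrC !divfK.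
have [|g [hg g0 gc _]] := @riesz_fischer R (fun i => a i / pi) (fun i => b i / pi)
    (M ^+ 2 * energy f / 2 / pi ^+ 2).
  move=> n; rewrite ler_pdivlMr ?exprn_gt0 ?pi_gt0// ler_pdivlMr// mulrC.
  apply: le_trans (has_symbol_coef_le n hm hf ab); rewrite ler_pM2l// mulr_suml.
  rewrite le_eqVlt; apply/orP; left; apply/eqP; apply: eq_bigr => i _.
  by move: (a _) (b _) (pi : R) p0 => u v q q0; field.
have gw : has_symbol m f g.
  move=> i; have [h1 h2] := ab i; have [-> ->] := gc i.
  by rewrite -h1 -h2 ![pi * (_ / _)]mulrC !divfK.
by exists g; split => //; exact: has_symbol_Hhalf hm hf hg gw.
Qed.

Lemma has_symbol_coef m f g g' i : has_symbol m f g -> has_symbol m f g' ->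
  ccoef g i.+1 = ccoef g' i.+1 /\ scoef g i.+1 = scoef g' i.+1.
Proof.
move=> h h'; have [h1 h2] := h i; have [h1' h2'] := h' i.
have t0 : tau * i.+1%:R != 0 by rewrite mulf_neq0// gt_eqF// tau_gt0.
by split; apply: (mulfI t0); rewrite ?h1 ?h2.
Qed.

Lemma has_symbolD M m f g f' g' : bsym M m -> Hhalf f -> Hhalf f' -> L2p g -> L2p g' ->
  has_symbol m f g -> has_symbol m f' g' -> has_symbol m (fun x => f x + f' x) (fun x => g x + g' x).
Proof.
move=> hm hf hf' hg hg' h h' i; have [h1 h2] := h i; have [h1' h2'] := h' i.
rewrite !(eformDl hm)// opprD -h1 -h2 -h1' -h2' /ccoef /scoef !ipDl// !mulrDr.
by split.
Qed.

Lemma has_symbolZ M m f g c : bsym M m -> Hhalf f -> L2p g ->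
  has_symbol m f g -> has_symbol m (fun x => c * f x) (fun x => c * g x).
Proof.
move=> hm hf hg h i; have [h1 h2] := h i.
rewrite !(eformZl _ hm)// -mulrN -h1 -h2 /ccoef /scoef !ipZl//.
by split; ring.
Qed.

Lemma has_symbolDm M1 M2 m1 m2 f g g' : bsym M1 m1 -> bsym M2 m2 -> Hhalf f -> L2p g -> L2p g' ->
  has_symbol m1 f g -> has_symbol m2 f g' -> has_symbol (fun z => m1 z + m2 z) f (fun x => g x + g' x).
Proof.
move=> hm hm' hf hg hg' h h' i; have [h1 h2] := h i; have [h1' h2'] := h' i.
rewrite !(eformDm hm hm')// opprD -h1 -h2 -h1' -h2' /ccoef /scoef !ipDl// !mulrDr.
by split.
Qed.

Lemma has_symbolZm M m f g c : bsym M m -> Hhalf f -> L2p g ->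
  has_symbol m f g -> has_symbol (fun z => c * m z) f (fun x => c * g x).
Proof.
move=> hm hf hg h i; have [h1 h2] := h i.
rewrite !(eformZm _ hm)// -mulrN -h1 -h2 /ccoef /scoef !ipZl//.
by split; ring.
Qed.

Lemma eform1_cosn f i : Hhalf f -> eform (cst 1) f (cosn i.+1) = tau * i.+1%:R * ccoef f i.+1.
Proof.
move=> hf; rewrite -(cvg_lim (@Rhausdorff R) (eform1_cvg hf (Hhalf_cosn i.+1))).
apply: lim_near_cst => //; exists i.+1 => // n /= ni; rewrite /coef_pairing.
rewrite (bigD1 (Ordinal ni))//= big1 ?addr0.
  by rewrite ccoef_cosnn// scoef_cosn; ring.
move=> j ji; rewrite ccoef_cosn ?scoef_cosn; first by ring.
by rewrite eqSS eq_sym; apply: contra ji => /eqP e; apply/eqP/val_inj.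
Qed.

Lemma eform1_sinn f i : Hhalf f -> eform (cst 1) f (sinn i.+1) = tau * i.+1%:R * scoef f i.+1.
Proof.
move=> hf; rewrite -(cvg_lim (@Rhausdorff R) (eform1_cvg hf (Hhalf_sinn i.+1))).
apply: lim_near_cst => //; exists i.+1 => // n /= ni; rewrite /coef_pairing.
rewrite (bigD1 (Ordinal ni))//= big1 ?addr0.
  by rewrite scoef_sinnn// ccoef_sinn; ring.
move=> j ji; rewrite scoef_sinn ?ccoef_sinn; first by ring.
by rewrite eqSS eq_sym; apply: contra ji => /eqP e; apply/eqP/val_inj.
Qed.

(** [g] is a conjugate function of [f]: the Fourier multiplier - i sgn, in terms
    of cosine and sine coefficients. *)
Definition conjugate f g := forall i, ccoef g i.+1 = - scoef f i.+1 /\ scoef g i.+1 = ccoef f i.+1.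

(** Douglas' formula polarized against a single harmonic: the Hilbert transform
    is the operator with symbol 1. *)
Lemma conj_has_symbol f g : Hhalf f -> conjugate f g <-> has_symbol (cst 1) f g.
Proof.
move=> hf; have t0 i : tau * i.+1%:R != 0 :> R.
  by rewrite mulf_neq0// gt_eqF// tau_gt0.
split=> h i; have [h1 h2] := h i.
  by rewrite eform1_sinn// eform1_cosn// h1 h2 mulrN.
move: h1 h2; rewrite eform1_sinn// eform1_cosn// -mulrN => /(mulfI (t0 _)) h1 /(mulfI (t0 _)) h2.
by split.
Qed.

Lemma energy_coef0 f : Hhalf f -> (forall i, ccoef f i.+1 = 0 /\ scoef f i.+1 = 0) -> energy f = 0.
Proof.
move=> hf h; apply/eqP; rewrite eq_le energy_ge0 andbT; apply: energy_le => // n.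
by rewrite big1 ?mulr0// => i _; rewrite /amp2; have [-> ->] := h i; rewrite expr0n addr0 mulr0.
Qed.

(** The difference of f and f' has energy zero. *)
Lemma eform_coef M m f f' g : bsym M m -> Hhalf f -> Hhalf f' -> Hhalf g ->
  (forall i, ccoef f i.+1 = ccoef f' i.+1 /\ scoef f i.+1 = scoef f' i.+1) -> eform m f g = eform m f' g.
Proof.
move=> hm hf hf' hg h; apply/eqP; rewrite -subr_eq0 -(eformBl hm)//.
rewrite -sqrf_eq0 eq_le sqr_ge0 andbT.
have hd := HhalfB hf hf'; have lf := Hhalf_L2p hf; have lf' := Hhalf_L2p hf'.
have := eform_CS hm hd hg; rewrite energy_coef0 ?mul0r ?mulr0//.
by move=> i; have := h i; rewrite /ccoef /scoef !ipBl// => -[-> ->]; rewrite !subrr.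
Qed.

End Symbol.

(** * Circle maps and the energy form *)

Section Diffeo.
Variable R : realType.
Implicit Types (f g : R -> R) (x y : R) (m : R * R -> R).
Local Notation mu := (@lebesgue_measure R).
Local Notation P := (period R).
Local Notation tau := (2 * @pi R).
Hint Resolve L2p_cosn L2p_sinn L2p_cst Hhalf_cosn Hhalf_sinn bsym1 : core.
Local Notation PP := (P `*` P).
Local Notation mu2 := ((mu \x mu)%E).
Local Notation itg2 F := (mu2.-integrable PP (EFin \o F)).

Lemma is_derive_scale c f (df : R) x : is_derive x 1 f df ->
  is_derive x 1 (fun y => c * f y) (c * df).
Proof. by move=> d; apply: is_deriveZ. Qed.

(** Polarization of Parseval's identity. *)
Lemma parseval_ip f g : Hhalf f -> Hhalf g -> ccoef f 0 = 0 -> ccoef g 0 = 0 ->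
  (fun n => pi^-1 * \sum_(i < n) (ccoef f i.+1 * ccoef g i.+1 + scoef f i.+1 * scoef g i.+1))
    @ \oo --> ip f g.
Proof.
move=> hf hg f0 g0; have lf := Hhalf_L2p hf; have lg := Hhalf_L2p hg.
have hfg := HhalfD hf hg; have lfg := Hhalf_L2p hfg.
have fg0 : ccoef (fun x => f x + g x) 0 = 0.
  by move: f0 g0; rewrite /ccoef ipDl// => -> ->; rewrite addr0.
have c1 := parseval lf f0 (Hhalf_weights hf).
have c2 := parseval lg g0 (Hhalf_weights hg).
have c3 := parseval lfg fg0 (Hhalf_weights hfg).
have -> : ip f g = 2^-1 * (ip (fun x => f x + g x) (fun x => f x + g x) - ip f f - ip g g).
  by rewrite ipDl// !ipDr// (ipC g f); field.
rewrite [X in X @ \oo --> _](_ : _ = fun n => 2^-1 * (pi^-1 * (\sum_(i < n) amp2 (fun x => f x + g x) i)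
    - pi^-1 * (\sum_(i < n) amp2 f i) - pi^-1 * (\sum_(i < n) amp2 g i))); last first.
  apply/funext => n; rewrite -!mulrBr -!sumrB mulrCA; congr (_ * _).
  rewrite mulr_sumr; apply: eq_bigr => i _.
  by rewrite /amp2 /ccoef /scoef !ipDl//; field.
by apply: cvgMr; apply: cvgB => //; apply: cvgB.
Qed.

(** Compare Parseval's identity on the left with Douglas' formula on the right:
    differentiating w and conjugating f both exchange sine and cosine
    coefficients. *)
Lemma conj_parts f v w (dw : R -> R) : Hhalf f -> Hhalf v -> ccoef v 0 = 0 -> conjugate f v ->
  per w -> (forall x, is_derive x 1 w (dw x)) -> continuous dw -> Hhalf dw ->
  tau * ip v dw = - eform (cst 1) f w.
Proof.
move=> hf hv v0 fv pw d c hdw; have hw := derive_Hhalf pw d c.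
have dw0 : ccoef dw 0 = 0 by rewrite (ccoef_derive 0 pw d c) mul0r.
have h1 : (fun n => tau * (pi^-1 * \sum_(i < n) (ccoef v i.+1 * ccoef dw i.+1 + scoef v i.+1 * scoef dw i.+1)))
    @ \oo --> tau * ip v dw by apply: cvgMr; exact: parseval_ip.
have h2 : (fun n => - (2 * coef_pairing n f w)) @ \oo --> - eform (cst 1) f w.
  by apply: cvgN; exact: eform1_cvg.
rewrite -(cvg_lim (@Rhausdorff R) h1); apply: cvg_lim => //.
apply: cvg_trans h2; apply: near_eq_cvg; apply: nearW => n.
rewrite /coef_pairing mulrA [tau * _](_ : _ = 2); last by rewrite -mulrA divff ?mulr1// gt_eqF ?pi_gt0.
rewrite -mulrN -sumrN /=; congr (_ * _); apply: eq_bigr => i _.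
rewrite (ccoef_derive _ pw d c) (scoef_derive _ pw d c).
by have [-> ->] := fv i; ring.
Qed.

Definition versine (z : R * R) : R := 1 - cos (z.1 - z.2).

(** Quotient of the kernel pulled back by phi x phi, with its Jacobian, by the
    kernel itself.  The conventions on division make it vanish where the
    kernel has its singularity. *)
Definition lift_symbol (phi dphi : R -> R) (z : R * R) : R :=
  dphi z.1 * dphi z.2 * (versine z / versine (phi z.1, phi z.2)).

Lemma measurable_versine : measurable_fun setT versine.
Proof.
apply: measurable_funB => //.
apply: (measurableT_comp (f := @cos R)); last by apply: measurable_funB.
by apply: continuous_measurable_fun; exact: continuous_cos.
Qed.

Lemma measurable_versine_comp phi : measurable_fun setT phi ->
  measurable_fun setT (fun z : R * R => versine (phi z.1, phi z.2)).
Proof.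
move=> mp; apply: measurable_funB => //.
apply: (measurableT_comp (f := @cos R)).
  by apply: continuous_measurable_fun; exact: continuous_cos.
by apply: measurable_funB; [exact: measurable_fst_comp|exact: measurable_snd_comp].
Qed.

Lemma measurable_lift_symbol phi dphi : circle_lift phi dphi -> measurable_fun setT (lift_symbol phi dphi).
Proof.
move=> l; have [_ c _ _] := l.
have mp : measurable_fun setT phi by apply: continuous_measurable_fun; exact: circle_lift_continuous l.
have md : measurable_fun setT dphi by exact: continuous_measurable_fun.
apply: measurable_funM.
  by apply: measurable_funM; [exact: measurable_fst_comp|exact: measurable_snd_comp].
apply: measurable_funM; first exact: measurable_versine.
by apply: (measurableT_comp (@measurable_inv R)); exact: measurable_versine_comp.
Qed.

Lemma lift_symbol_ge0 phi dphi z : circle_lift phi dphi -> 0 <= lift_symbol phi dphi z.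
Proof. by move=> [_ _ d0 _]; rewrite /lift_symbol !mulr_ge0 ?invr_ge0 ?onem_cos_ge0// ltW. Qed.

Lemma circle_lift_per_comp (phi dphi f : R -> R) : circle_lift phi dphi -> per f -> per (f \o phi).
Proof. by move=> [_ _ _ h] pf x /=; rewrite h pf. Qed.

(** Both cos o phi and sin o phi are Lipschitz for the chord distance, and the
    sum of their squared increments is 2 (1 - cos (phi x - phi y)). *)
Lemma versine_lift_le phi dphi : circle_lift phi dphi -> (exists M : R, forall x, dphi x <= M) ->
  exists C : R, forall z, versine (phi z.1, phi z.2) <= C * versine z.
Proof.
move=> l [M hM]; have [d c d0 _] := l.
have dM x : `|dphi x| <= M by rewrite ger0_norm// ltW.
have h1 : chord_lip (@cos R \o phi) (18 * M ^+ 2).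
  apply: (@derive_bound_chord_lip R _ (fun x => - sin (phi x) * dphi x)).
  - exact: (circle_lift_per_comp l (@cos_per R)).
  - by move=> x; rewrite normrM normrN -[M]mul1r ler_pM// sin_max.
have h2 : chord_lip (@sin R \o phi) (18 * M ^+ 2).
  apply: (@derive_bound_chord_lip R _ (fun x => cos (phi x) * dphi x)).
  - exact: (circle_lift_per_comp l (@sin_per R)).
  - by move=> x; rewrite normrM -[M]mul1r ler_pM// cos_max.
exists (18 * M ^+ 2) => z; have := lerD (h1 z.1 z.2) (h2 z.1 z.2).
rewrite /versine /=; have := cos2Dsin2 (phi z.1); have := cos2Dsin2 (phi z.2).
rewrite (cosB (phi z.1)); move: (18 * M ^+ 2 * (1 - cos (z.1 - z.2))) => K.
by move: (cos (phi _)) (cos (phi _)) (sin (phi _)) (sin (phi _)) => a b c' d' e1 e2; nra.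
Qed.

Lemma ekernel_lift phi dphi z : circle_lift phi dphi -> (exists M : R, forall x, dphi x <= M) ->
  ekernel (phi z.1, phi z.2) * (dphi z.1 * dphi z.2) = ekernel z * lift_symbol phi dphi z.
Proof.
move=> l hM; have [C hC] := versine_lift_le l hM; have := hC z.
rewrite /ekernel /lift_symbol -/(versine z) /= -/(versine (phi z.1, phi z.2)) !invfM.
have [->|N0] := eqVneq (versine z) 0.
  rewrite mulr0 invr0 mulr0 mul0r => h.
  have -> : versine (phi z.1, phi z.2) = 0 by apply/eqP; rewrite eq_le h onem_cos_ge0.
  by rewrite invr0 mulr0 mul0r.
move=> _; move: (versine z) N0 (versine (phi z.1, phi z.2))^-1 => N N0 T.
have h : N^-1 * N = 1 by rewrite mulVf.
rewrite [RHS](_ : _ = (N^-1 * N) * (2^-1 * T * (dphi z.1 * dphi z.2))); last by ring.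
by rewrite h mul1r.
Qed.

(** Change of variables in each of the two variables. *)
Lemma energy_change phi dphi f : circle_lift phi dphi -> (exists M : R, forall x, dphi x <= M) ->
  L2p f -> L2p (f \o phi) ->
  (\int[mu2]_(z in PP) (ker (lift_symbol phi dphi) (f \o phi) (f \o phi) z)%:E = energye f)%E.
Proof.
move=> l hM hf hF; have mm := measurable_lift_symbol l; have [pf mf _] := hf.
have [d c d0 pphi] := l.
have m0 z : 0 <= lift_symbol phi dphi z by exact: lift_symbol_ge0.
rewrite integral_square; first last.
- by move=> z; rewrite lee_fin /ker -expr2 mulr_ge0// sqr_ekernel_ge0.
- by apply/measurable_EFinP; exact: measurable_ker.
have mF : measurable_fun setT (fun z => (increment f z ^+ 2 * ekernel z)%:E).
  by apply/measurable_EFinP; exact: measurable_sqr_ekernel.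
pose G x := (\int[mu]_(y in P) (increment f (x, y) ^+ 2 * ekernel (x, y))%:E)%E.
have kper1 x y : ekernel (x + tau, y) = ekernel (x, y).
  by rewrite /ekernel /= addrAC cos_per.
have kper2 x y : ekernel (x, y + tau) = ekernel (x, y).
  rewrite /ekernel /= opprD addrA.
  by have := @cos_per R (x - y - tau); rewrite subrK => ->.
have -> : energye f = (\int[mu]_(x in P) G x)%E by [].
have mG : measurable_fun setT G.
  pose H z : \bar R := ((increment f z ^+ 2 * ekernel z)%:E * (\1_P z.2)%:E)%E.
  have mH : measurable_fun setT H.
    apply: emeasurable_funM => //.
    by apply/measurable_EFinP; apply: measurable_snd_comp; exact: measurable_indic_period.
  have := measurable_integral_snd mH; rewrite (_ : (fun x => _) = G).
    by apply => z; rewrite mule_ge0// lee_fin ?sqr_ekernel_ge0.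
  apply/funext => x; rewrite /G [in RHS]integral_mkcond.
  by apply: eq_integral => y _; rewrite /H /= epatch_indic.
have G0 x : (0 <= G x)%E by apply: integral_ge0 => y _; rewrite lee_fin sqr_ekernel_ge0.
have pG : per G.
  by move=> x; apply: eq_integral => y _; rewrite kper1 /increment /= pf.
rewrite (ge0_integral_circle_lift l mG G0 pG); apply: eq_integral => x _.
have mS : measurable_fun setT (fun y => (increment f (phi x, y) ^+ 2 * ekernel (phi x, y))%:E).
  exact: (measurable_section_snd (phi x) mF).
rewrite /G (ge0_integral_circle_lift l mS); first last.
- by move=> y; rewrite kper2 /increment /= pf.
- by move=> y; rewrite lee_fin sqr_ekernel_ge0.
rewrite muleC -ge0_integralZl//.
- apply: eq_integral => y _; rewrite -!EFinM; congr EFin.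
  have := ekernel_lift (x, y) l hM; rewrite /ker /increment /= => e.
  rewrite -!expr2 -[LHS]mulrA -e; ring.
- exact: measurable_period.
- apply: measurable_funTS; apply: emeasurable_funM.
    apply: (measurableT_comp mS); apply: continuous_measurable_fun; exact: circle_lift_continuous l.
  by apply/measurable_EFinP; exact: continuous_measurable_fun.
- by move=> y _; rewrite mule_ge0// lee_fin ?sqr_ekernel_ge0// ltW.
- by rewrite lee_fin ltW.
Qed.

(** The quadratic identity [energy_change], polarized. *)
Lemma invariance M phi dphi f g : circle_lift phi dphi -> (exists M : R, forall x, dphi x <= M) ->
  bsym M (lift_symbol phi dphi) -> Hhalf f -> Hhalf g -> Hhalf (f \o phi) -> Hhalf (g \o phi) ->
  eform (lift_symbol phi dphi) (f \o phi) (g \o phi) = eform (cst 1) f g.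
Proof.
move=> l hM hm hf hg hF hG.
have QB h : Hhalf h -> Hhalf (h \o phi) -> eform (lift_symbol phi dphi) (h \o phi) (h \o phi) = energy h.
  move=> hh hH; apply: EFin_inj; rewrite energyE//.
  rewrite -(energy_change l hM (Hhalf_L2p hh) (Hhalf_L2p hH)) /eform /Rintegral fineK//.
  apply: integrable_fin_num; first exact: measurable_square.
  exact: itg2_ker hm.
have := QB _ (HhalfD hf hg) (HhalfD hF hG).
rewrite energyD//.
have -> : (fun x => f x + g x) \o phi = (fun x => (f \o phi) x + (g \o phi) x) by [].
rewrite (eformDl hm hF hG (HhalfD hF hG)) !(eformDr hm hF hG)// (eformC _ (g \o phi) (f \o phi)).
rewrite (QB f)// (QB g)//.
move: (eform _ _ _) (eform _ _ _) (energy f) (energy g) => a b c d; lra.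
Qed.

(** * Conjugating the Hilbert transform by a circle map *)
Section Conjugation.
Variables (phi dphi psi dpsi ddpsi : R -> R).
Hypotheses (l : circle_lift phi dphi) (dphi_bd : forall x, 2^-1 <= dphi x <= 2).
Hypothesis symbol_bd : forall z, versine z != 0 -> 2^-1 <= lift_symbol phi dphi z <= 2.
Hypotheses (phiK : cancel phi psi) (psiK : cancel psi phi).
Hypothesis dpsiP : forall x, is_derive x 1 psi (dpsi x).
Hypothesis ddpsiP : forall x, is_derive x 1 dpsi (ddpsi x).
Hypothesis ddpsi_cont : continuous ddpsi.

Let dphi_le : exists M : R, forall x, dphi x <= M.
Proof. by exists 2 => x; have /andP[] := dphi_bd x. Qed.

Lemma bsym_lift : bsym 2 (lift_symbol phi dphi).
Proof.
split; first exact: measurable_lift_symbol.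
move=> z; have [N0|N0] := eqVneq (versine z) 0.
  by rewrite /lift_symbol N0 mul0r mulr0 normr0.
have /andP[h1 h2] := symbol_bd N0; rewrite ger0_norm//.
by apply: le_trans h1; rewrite invr_ge0.
Qed.

Let psi_tau x : psi (x + tau) = psi x + tau.
Proof. by rewrite -[in LHS](psiK x); have [_ _ _ <-] := l; rewrite phiK. Qed.

Let psi_per f : per f -> per (f \o psi).
Proof. by move=> pf x /=; rewrite psi_tau pf. Qed.

Let psi_cont : continuous psi.
Proof. exact: is_derive_continuous dpsiP. Qed.

Let dpsi_cont : continuous dpsi.
Proof. exact: is_derive_continuous ddpsiP. Qed.

Lemma L2p_lift f : L2p f -> L2p (f \o phi).
Proof.
move=> [pf mf fi]; split.
- exact: circle_lift_per_comp l pf.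
- by apply: measurableT_comp => //; apply: continuous_measurable_fun; exact: circle_lift_continuous l.
- have mF : measurable_fun setT (fun x => f x ^+ 2) by exact: measurable_funX.
  have pF : per (fun x => f x ^+ 2) by move=> x; rewrite pf.
  have h := itgZ 2 (integrable_circle_lift l mF pF fi).
  apply: itg_le h.
    apply: measurable_funX; apply: measurableT_comp => //.
    by apply: continuous_measurable_fun; exact: circle_lift_continuous l.
  move=> x _ /=; rewrite ger0_norm ?sqr_ge0//.
  have /andP[h1 _] := dphi_bd x; have := sqr_ge0 (f (phi x)); move: (f _ ^+ 2) => q; nra.
Qed.

(** Push the integral forward by phi, whose derivative is bounded. *)
Lemma L2p_unlift f : L2p f -> L2p (f \o psi).
Proof.
move=> [pf mf fi]; have mpsi := continuous_measurable_fun psi_cont.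
have mF : measurable_fun setT (f \o psi) by apply: measurableT_comp.
split => //; first exact: psi_per.
have mF2 : measurable_fun setT (fun x => (f \o psi) x ^+ 2) by exact: measurable_funX.
apply/integrableP; split; first by apply/measurable_EFinP; exact: measurable_funTS.
have -> : (\int[mu]_(x in P) `|(EFin \o (fun x0 => ((f \o psi) x0 ^+ 2)%R)) x| =
    \int[mu]_(x in P) ((f \o psi) x ^+ 2)%:E)%E.
  by apply: eq_integral => x _; rewrite /= ger0_norm ?sqr_ge0.
rewrite (ge0_integral_circle_lift l); first last.
- by move=> x /=; rewrite psi_tau pf.
- by move=> x; rewrite lee_fin sqr_ge0.
- exact/measurable_EFinP.
have mE : measurable_fun P (fun x => ((f \o psi) (phi x) ^+ 2)%:E * (dphi x)%:E)%E.
  rewrite (_ : (fun x => _) = (fun x => (f x ^+ 2 * dphi x)%:E)).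
    apply/measurable_EFinP; apply: measurable_funTS; apply: measurable_funM.
      exact: measurable_funX.
    by apply: continuous_measurable_fun; case: l.
  by apply/funext => x; rewrite /= phiK EFinM.
have h2 := itgZ 2 fi.
have /integrableP[me] := h2; apply: le_lt_trans.
apply: ge0_le_integral => //.
- exact: measurable_period.
- by move=> x _; rewrite mule_ge0// lee_fin ?sqr_ge0// ltW//; case: l.
- exact: measurableT_comp.
- move=> x _; have q0 := sqr_ge0 (f x).
  rewrite /= phiK -EFinM lee_fin (ger0_norm (mulr_ge0 (ler0n _ 2) q0)).
  have /andP[_ h] := dphi_bd x; move: (f x ^+ 2) q0 => q; nra.
Qed.

Lemma Hhalf_unlift f : Hhalf f -> Hhalf (f \o psi).
Proof.
move=> hf; have lf := Hhalf_L2p hf; have lF := L2p_unlift lf.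
apply: Hhalf_energye => //.
have fE : (f \o psi) \o phi = f by apply/funext => x /=; rewrite phiK.
rewrite -(energy_change l dphi_le lF) fE//.
have h := itg2_ker hf hf bsym_lift.
have := integrable_fin_num (@measurable_square R) h.
by rewrite fin_numElt => /andP[].
Qed.

Lemma Hhalf_lift f : Hhalf f -> Hhalf (f \o phi).
Proof.
move=> hf; have lf := Hhalf_L2p hf; have lF := L2p_lift lf.
split => //.
have fin : itg2 (ker (lift_symbol phi dphi) (f \o phi) (f \o phi)).
  apply/integrableP; split.
    apply/measurable_EFinP; apply: measurable_funTS; apply: measurable_ker => //.
    exact: measurable_lift_symbol.
  apply: (@le_lt_trans _ _ (energye f)); last first.
    by rewrite -energyE// ltry.
  rewrite -(energy_change l dphi_le lf lF) le_eqVlt; apply/orP; left; apply/eqP.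
  apply: eq_integral => z _; congr EFin => /=; rewrite ger0_norm//.
  by rewrite /ker -expr2 mulr_ge0 ?sqr_ekernel_ge0// lift_symbol_ge0.
apply: (@itg2_le _ _ (fun z => 2 * ker (lift_symbol phi dphi) (f \o phi) (f \o phi) z)).
- exact: measurable_sqr_ekernel.
- move=> z; rewrite ger0_norm ?sqr_ekernel_ge0// /ker.
  have [N0|N0] := eqVneq (versine z) 0.
    by rewrite /ekernel -/(versine z) N0 mulr0 invr0 !mulr0 mul0r mulr0.
  have /andP[h1 _] := symbol_bd N0.
  rewrite -expr2; have := sqr_ekernel_ge0 (f \o phi) z; move: (_ ^+ 2 * _) (lift_symbol _ _ _) h1 => q s; nra.
- exact: itg2Z.
Qed.

Let chain x : dpsi (phi x) * dphi x = 1.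
Proof.
have [d _ _ _] := l; have a1 := d x; have a2 := dpsiP (phi x).
have [_ <-] : is_derive x 1 (psi \o phi) (dpsi (phi x) * dphi x) by exact: is_derive1_comp.
have -> : psi \o phi = id by apply/funext => y /=; rewrite phiK.
exact: derive_id.
Qed.

(** Put W = w o psi, where psi is the inverse of phi.  The pairing of v o phi
    with w' is that of v with W', by a change of variables; since v is the
    conjugate of f o psi it is given by E[1](f o psi, W), and by invariance this
    is E[m](f, w) for the symbol m of phi. *)
Lemma conjugation_symbol f v : Hhalf f -> Hhalf v -> ccoef v 0 = 0 -> conjugate (f \o psi) v ->
  has_symbol (lift_symbol phi dphi) f (v \o phi).
Proof.
move=> hf hv v0 cv i; have hF := Hhalf_unlift hf; have hV := Hhalf_lift hv.
have key w (dw ddw : R -> R) : per w -> (forall x, is_derive x 1 w (dw x)) ->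
    (forall x, is_derive x 1 dw (ddw x)) -> continuous ddw ->
    tau * ip (v \o phi) dw = - eform (lift_symbol phi dphi) f w.
  move=> pw d1 d2 c2.
  pose W := w \o psi; pose dW x := dw (psi x) * dpsi x.
  have c1 := is_derive_continuous d2.
  have pW : per W by exact: psi_per.
  have dWP x : is_derive x 1 W (dW x).
    by have a1 := dpsiP x; have a2 := d1 (psi x); apply: is_derive1_comp.
  have cdW : continuous dW.
    by move=> x; apply: cvgM; [apply: continuous_comp; [exact: psi_cont|exact: c1]|exact: dpsi_cont].
  have hdW : Hhalf dW.
    apply: (@derive_Hhalf _ _ (fun x => ddw (psi x) * dpsi x ^+ 2 + dw (psi x) * ddpsi x)).
    - exact: is_derive_per pW dWP.
    - move=> x; have a1 := dpsiP x; have a2 := d2 (psi x); have a3 := ddpsiP x.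
      have a4 : is_derive x 1 (dw \o psi) (ddw (psi x) * dpsi x) by exact: is_derive1_comp.
      apply: DeriveDef.
        by apply: derivableM; [case: a4|case: a3].
      have := @is_deriveM _ _ (dw \o psi) dpsi x 1 _ _ a4 a3.
      move=> [_]; rewrite /dW => e; rewrite [LHS]e.
      by rewrite /GRing.scale /=; ring.
    - move=> x; apply: cvgD; apply: cvgM.
      + by apply: continuous_comp; [exact: psi_cont|exact: c2].
      + by rewrite expr2; apply: cvgM; exact: dpsi_cont.
      + by apply: continuous_comp; [exact: psi_cont|exact: c1].
      + exact: ddpsi_cont.
  have hW : Hhalf W := derive_Hhalf pW dWP cdW.
  have hw : Hhalf w := derive_Hhalf pw d1 c1.
  have e1 : W \o phi = w by apply/funext => x; rewrite /W /= phiK.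
  have e2 : (f \o psi) \o phi = f by apply/funext => x /=; rewrite phiK.
  have -> : ip (v \o phi) dw = ip v dW.
    have [_ mv _] := Hhalf_L2p hv; have [pv _ _] := Hhalf_L2p hv.
    have [_ mdW _] := Hhalf_L2p hdW; have [pdW _ _] := Hhalf_L2p hdW.
    rewrite [RHS]/ip (integral_circle_lift l); first last.
    + by move=> x; rewrite pv pdW.
    + exact: measurable_funM.
    apply: eq_Rintegral => x _; rewrite /dW phiK -mulrA -(mulrA (dw x)) chain mulr1//.
  rewrite (conj_parts hF hv v0 cv pW dWP cdW hdW).
  by rewrite -(invariance l dphi_le bsym_lift hF hW) ?e1 ?e2.
have hc := key _ _ _ (@per_cosn R i.+1) (is_derive_cosn i.+1)
  (fun x => is_derive_scale (- i.+1%:R) (is_derive_sinn i.+1 x))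
  (continuous_scale (continuous_scale (@continuous_cosn R i.+1))).
have hs := key _ _ _ (@per_sinn R i.+1) (is_derive_sinn i.+1)
  (fun x => is_derive_scale i.+1%:R (is_derive_cosn i.+1 x))
  (continuous_scale (continuous_scale (@continuous_sinn R i.+1))).
have lV := Hhalf_L2p hV; move: hc hs; rewrite !ipZr// => hc hs.
split; first by rewrite -hs /ccoef; ring.
by rewrite -[RHS]opprK -hc /scoef; ring.
Qed.

End Conjugation.

End Diffeo.

(** * First order expansion of the symbols *)

Section Variation.
Variable R : realType.
Implicit Types (f g : R -> R) (x y : R) (m : R * R -> R).
Local Notation mu := (@lebesgue_measure R).
Local Notation P := (period R).
Local Notation tau := (2 * @pi R).

(** Derivative at s = 0 of the symbol of x + s a(x). *)
Definition field_symbol (a da : R -> R) (z : R * R) : R :=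
  (da z.1 + da z.2) * (versine z / versine z) - sin (z.1 - z.2) * (a z.1 - a z.2) / versine z.

Lemma field_symbolB a da b db z :
  field_symbol a da z - field_symbol b db z = field_symbol (fun x => a x - b x) (fun x => da x - db x) z.
Proof. by rewrite /field_symbol; ring. Qed.

Lemma sin_sqr_versine (z : R * R) : sin (z.1 - z.2) ^+ 2 <= 2 * versine z.
Proof.
rewrite /versine; have := cos2Dsin2 (z.1 - z.2).
have := @cos_le1 R (z.1 - z.2); have := @cos_geN1 R (z.1 - z.2).
move: (cos _) (sin _) => c s; nra.
Qed.

Lemma sqr_le_abs (u v : R) : 0 <= v -> u ^+ 2 <= v ^+ 2 -> `|u| <= v.
Proof. by move=> v0; rewrite -(real_normK (num_real u)) ler_sqr. Qed.

Section Slope.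
Variables (a da : R -> R) (L : R).
Hypotheses (pa : per a) (daP : forall x, is_derive x 1 a (da x)).
Hypothesis (daL : forall x, `|da x| <= L).

Let L0 : 0 <= L. Proof. exact: le_trans (daL 0). Qed.

Lemma slope_chord_lip z : (a z.1 - a z.2) ^+ 2 <= 18 * L ^+ 2 * versine z.
Proof. exact: derive_bound_chord_lip. Qed.

(** sin^2 (x - y) and (a x - a y)^2 are both at most a multiple of
    1 - cos (x - y). *)
Lemma slope_sigma z : `|sin (z.1 - z.2) * (a z.1 - a z.2) / versine z| <= 6 * L.
Proof.
have [->|N0] := eqVneq (versine z) 0; first by rewrite invr0 mulr0 normr0 mulr_ge0.
have N1 : 0 < versine z by rewrite lt_def N0 onem_cos_ge0.
rewrite normrM normfV (gtr0_norm N1) ler_pdivrMr//.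
apply: sqr_le_abs; first by rewrite !mulr_ge0// ltW.
have := slope_chord_lip z; have := sin_sqr_versine z.
move: (sin _) (a _ - a _) (versine z) N1
  (sqr_ge0 (sin (z.1 - z.2))) (sqr_ge0 (a z.1 - a z.2)) => S d N N1 _ d0 h1 h2.
have -> : (S * d) ^+ 2 = S ^+ 2 * d ^+ 2 by ring.
have -> : (6 * L * N) ^+ 2 = (2 * N) * (18 * L ^+ 2 * N) by ring.
by apply: ler_pM => //; rewrite ?sqr_ge0.
Qed.

Lemma field_symbol_le z : `|field_symbol a da z| <= 8 * L.
Proof.
rewrite /field_symbol; have h1 := slope_sigma z; have h2 := daL z.1; have h3 := daL z.2.
apply: (le_trans (ler_normB _ _)).
have -> : 8 * L = 2 * L + 6 * L by ring.
apply: lerD => //; rewrite normrM.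
apply: (@le_trans _ _ (2 * L * 1)); last by rewrite mulr1.
apply: ler_pM => //.
  by apply: (le_trans (ler_normD _ _)); have := lerD h2 h3; lra.
have [->|N0] := eqVneq (versine z) 0; first by rewrite mul0r normr0.
by rewrite divff// normr1.
Qed.

Lemma measurable_field_symbol : continuous da -> measurable_fun setT (field_symbol a da).
Proof.
move=> cda; have ma : measurable_fun setT a.
  by apply: continuous_measurable_fun; exact: is_derive_continuous daP.
have mda := continuous_measurable_fun cda.
have mi : measurable_fun setT (fun z : R * R => (versine z)^-1).
  by apply: (measurableT_comp (@measurable_inv R)); exact: measurable_versine.
apply: measurable_funB.
  apply: measurable_funM; last by apply: measurable_funM => //; exact: measurable_versine.
  by apply: measurable_funD; [exact: measurable_fst_comp|exact: measurable_snd_comp].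
apply: measurable_funM => //; apply: measurable_funM.
  apply: (measurableT_comp (f := @sin R)); last exact: measurable_diff.
  by apply: continuous_measurable_fun; exact: continuous_sin.
by apply: measurable_funB; [exact: measurable_fst_comp|exact: measurable_snd_comp].
Qed.

Lemma bsym_field : continuous da -> bsym (8 * L) (field_symbol a da).
Proof. by move=> c; split; [exact: measurable_field_symbol|exact: field_symbol_le]. Qed.

Lemma onem_cos_le (u : R) : 1 - cos u <= u ^+ 2.
Proof.
rewrite onem_cos_half.
have := @derive_bound_lip R (@sin R) (@cos R) 1 (u / 2) 0 _ _.
move=> /(_ (fun x => is_derive_sin x) (fun x => cos_max x)).
rewrite sin0 !subr0 mul1r => h.
have := ler_pM (normr_ge0 _) (normr_ge0 _) h h.
rewrite -!expr2 !real_normK ?num_real// exprMn.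
have := sqr_ge0 u; have -> : (2^-1 : R) ^+ 2 = 4^-1 by rewrite exprVn; congr (_^-1); ring.
by move: (u ^+ 2) (sin _ ^+ 2) => p q; lra.
Qed.

Lemma sin_sub_le (u : R) : `|sin u - u| <= u ^+ 2.
Proof.
wlog u0 : u / 0 <= u.
  move=> h; have [/h//|/ltW u0] := leP 0 u.
  have := h (- u); rewrite oppr_ge0 sinN sqrrN => /(_ u0).
  by rewrite -opprD normrN.
have d1 x : is_derive x 1 (fun v => v - sin v) (1 - cos x) by apply: is_deriveB.
have d2 x : is_derive x 1 (fun v => v ^+ 2 - (v - sin v)) (2 * x - (1 - cos x)).
  have dx : is_derive x 1 (fun v => v ^+ 2) (2 * x).
    have h := is_deriveM (is_derive_id x (1 : R)) (is_derive_id x (1 : R)).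
    have -> : (fun v : R => v ^+ 2) = (id * id) by apply/funext => v; rewrite expr2.
    by apply: (is_derive_eq h); rewrite /GRing.scale /=; ring.
  exact: is_deriveB dx (d1 x).
have le1 : 0 <= u - sin u.
  apply: (ge0_derive_ge0 u0 _ d1); first by rewrite sin0 subr0.
  by move=> x _; rewrite onem_cos_ge0.
rewrite distrC ger0_norm// -subr_ge0.
apply: (ge0_derive_ge0 u0 _ d2); first by rewrite sin0 expr0n subrr subr0.
move=> v v0; have hs x : `|- sin x| <= 1 :> R by rewrite normrN sin_max.
have := derive_bound_lip 0 v (fun x => is_derive_cos x) hs.
rewrite cos0 sub0r normrN (ger0_norm v0) mul1r => h.
have := ler_norm (1 - cos v); lra.
Qed.

(** First order expansion of (1 + p) (1 + q) / (1 + S + e), where p, q and S are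
    of order l and e is of order l^2; the hypothesis on l keeps the
    denominator away from zero. *)
Lemma quotient_expansion (p q S e l : R) : 0 <= l <= 100^-1 ->
  `|p| <= l -> `|q| <= l -> `|S| <= 6 * l -> `|e| <= 36 * l ^+ 2 ->
  `|(1 + p) * (1 + q) / (1 + S + e) - 1 - (p + q - S)| <= 200 * l ^+ 2.
Proof.
move=> /andP[l0 l1] hp hq hS he.
have r0 : 2^-1 <= 1 + S + e.
  move: hS he; rewrite !ler_norml => /andP[a1 a2] /andP[b1 b2]; nra.
have r1 : 0 < 1 + S + e by apply: lt_le_trans r0; rewrite invr_gt0.
have -> : (1 + p) * (1 + q) / (1 + S + e) - 1 - (p + q - S) =
   (p * q - S * (p + q - S) - e * (1 + p + q - S)) / (1 + S + e).
  by field; rewrite gt_eqF.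
rewrite normrM normfV (gtr0_norm r1) ler_pdivrMr//.
have h : `|p * q - S * (p + q - S) - e * (1 + p + q - S)| <= 100 * l ^+ 2.
  have h1 : `|p * q| <= l * l by rewrite normrM; apply: ler_pM.
  have h2 : `|p + q - S| <= 8 * l.
    apply: (le_trans (ler_normB _ _)); have := ler_normD p q; lra.
  have h3 : `|S * (p + q - S)| <= 6 * l * (8 * l) by rewrite normrM; apply: ler_pM.
  have h4 : `|1 + p + q - S| <= 2.
    have -> : 1 + p + q - S = 1 + (p + q - S) by ring.
    apply: (le_trans (ler_normD _ _)); rewrite normr1; lra.
  have h5 : `|e * (1 + p + q - S)| <= 36 * l ^+ 2 * (1 + 8 * l).
    rewrite normrM; apply: ler_pM => //.
    have -> : 1 + p + q - S = 1 + (p + q - S) by ring.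
    by apply: (le_trans (ler_normD _ _)); rewrite normr1 lerD2l.
  apply: (le_trans (ler_normB _ _)); have := ler_normB (p * q) (S * (p + q - S)).
  move: h1 h3 h5; move: `|p * q| `|S * _| `|e * _| => x y z; nra.
have := sqr_ge0 l; move: h; move: `|_| (1 + S + e) r0 => x r r0; nra.
Qed.

(** With u = s (a x - a y), the addition formula gives
    1 - cos (x - y + u) = (1 - cos (x - y)) (1 + S + e), where S is the linear
    part in u and e collects the quadratic remainders of cos u and sin u; both
    are uniformly small because u^2 is at most a multiple of
    s^2 (1 - cos (x - y)). *)
Lemma symbol_estimate s z : `|s| * L <= 100^-1 ->
  `|lift_symbol (fun x => x + s * a x) (fun x => 1 + s * da x) z
    - versine z / versine z - s * field_symbol a da z| <= 200 * (`|s| * L) ^+ 2.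
Proof.
move=> sL; have l0 : 0 <= `|s| * L by rewrite mulr_ge0.
rewrite /lift_symbol /field_symbol; have [->|N0] := eqVneq (versine z) 0.
  by rewrite invr0 !(mulr0, mul0r, subr0) normr0 mulr_ge0 ?sqr_ge0.
have N1 : 0 < versine z by rewrite lt_def N0 onem_cos_ge0.
set u := s * (a z.1 - a z.2).
pose e := (cos (z.1 - z.2) * (1 - cos u) + sin (z.1 - z.2) * (sin u - u)) / versine z.
pose S := s * (sin (z.1 - z.2) * (a z.1 - a z.2) / versine z).
have u2 : u ^+ 2 <= 18 * (`|s| * L) ^+ 2 * versine z.
  rewrite /u !exprMn real_normK ?num_real//.
  have -> : 18 * (s ^+ 2 * L ^+ 2) * versine z = s ^+ 2 * (18 * L ^+ 2 * versine z) by ring.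
  by rewrite ler_wpM2l ?sqr_ge0// slope_chord_lip.
have he : `|e| <= 36 * (`|s| * L) ^+ 2.
  rewrite /e normrM normfV (gtr0_norm N1) ler_pdivrMr//.
  have h1 : `|cos (z.1 - z.2) * (1 - cos u)| <= 1 * u ^+ 2.
    by rewrite normrM; apply: ler_pM; rewrite ?cos_max// ger0_norm ?onem_cos_ge0// onem_cos_le.
  have h2 : `|sin (z.1 - z.2) * (sin u - u)| <= 1 * u ^+ 2.
    by rewrite normrM; apply: ler_pM; rewrite ?sin_max// sin_sub_le.
  apply: (le_trans (ler_normD _ _)); rewrite !mul1r in h1 h2.
  move: (`|s| * L) h1 h2 u2 => k h1 h2 u2; have := lerD h1 h2; nra.
have hS : `|S| <= 6 * (`|s| * L).
  by rewrite /S normrM mulrCA ler_wpM2l// slope_sigma.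
have hT : versine (z.1 + s * a z.1, z.2 + s * a z.2) = versine z * (1 + S + e).
  have -> : versine z * (1 + S + e) = versine z + sin (z.1 - z.2) * u
      + (cos (z.1 - z.2) * (1 - cos u) + sin (z.1 - z.2) * (sin u - u)).
    by rewrite /S /e /u; field.
  rewrite {1}/versine /=.
  have -> : z.1 + s * a z.1 - (z.2 + s * a z.2) = (z.1 - z.2) + u by rewrite /u; ring.
  by rewrite cosD /versine; ring.
have hp : `|s * da z.1| <= `|s| * L by rewrite normrM ler_wpM2l.
have hq : `|s * da z.2| <= `|s| * L by rewrite normrM ler_wpM2l.
rewrite hT divff// mulr1.
have h := @quotient_expansion _ _ S e (`|s| * L) _ hp hq hS he.
have -> : (1 + s * da z.1) * (1 + s * da z.2) * (versine z / (versine z * (1 + S + e))) =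
   (1 + s * da z.1) * (1 + s * da z.2) / (1 + S + e).
  by rewrite invfM (mulrA (versine z)) divff// mul1r.
move: h; rewrite l0 sL => /(_ isT).
have -> // : s * da z.1 + s * da z.2 - S =
  s * (da z.1 + da z.2 - sin (z.1 - z.2) * (a z.1 - a z.2) / versine z).
by rewrite /S; ring.
Qed.

Lemma lift_symbol_near1 s z : `|s| * L <= 100^-1 -> versine z != 0 ->
  2^-1 <= lift_symbol (fun x => x + s * a x) (fun x => 1 + s * da x) z <= 2.
Proof.
move=> sL N0; have := symbol_estimate z sL; rewrite divff//.
have := field_symbol_le z; move: (field_symbol _ _ _) (lift_symbol _ _ _) => d m hd.
have sd : `|s * d| <= 8 * (`|s| * L) by rewrite normrM mulrCA ler_wpM2l.
move: sd (normr_ge0 s) L0 => sd s0 L0'.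
have : 0 <= `|s| * L by exact: mulr_ge0.
move: (`|s| * L) sL sd => k kL; rewrite !ler_norml => /andP[a1 a2] ekernel /andP[b1 b2].
by apply/andP; split; nra.
Qed.

Lemma lift_near_id s : `|s| * L <= 100^-1 -> continuous da ->
  circle_lift (fun x => x + s * a x) (fun x => 1 + s * da x).
Proof.
move=> sL c; split.
- by move=> x; apply: is_deriveD; apply: is_derive_scale.
- by move=> x; apply: cvgD; [exact: cvg_cst|exact: continuous_scale].
- move=> x; have h : `|s * da x| <= `|s| * L by rewrite normrM ler_wpM2l.
  by move: (le_trans h sL); rewrite ler_norml => /andP[h1 _]; lra.
- by move=> x; rewrite pa; ring.
Qed.

Lemma dlift_near1 s x : `|s| * L <= 100^-1 -> 2^-1 <= 1 + s * da x <= 2.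
Proof.
move=> sL; have h : `|s * da x| <= `|s| * L by rewrite normrM ler_wpM2l.
move: (le_trans h sL); rewrite ler_norml => /andP[h1 h2].
by apply/andP; split; lra.
Qed.

End Slope.
End Variation.

(** * Infinitesimal invariance of the energy form *)

Section Commutator.
Variable R : realType.
Implicit Types (f g : R -> R) (x y : R) (m : R * R -> R).
Local Notation tau := (2 * @pi R).
Hint Resolve bsym1 : core.

Lemma taylor1 g (dg ddg : R -> R) K x h : (forall x, is_derive x 1 g (dg x)) ->
  (forall x, is_derive x 1 dg (ddg x)) -> (forall x, `|ddg x| <= K) ->
  `|g (x + h) - g x - h * dg x| <= K * h ^+ 2.
Proof.
move=> d1 d2 b; have K0 : 0 <= K by apply: le_trans (b 0).
have cg := is_derive_continuous d1.
have lip c : `|c - x| <= `|h| -> `|dg c - dg x| <= K * `|h|.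
  by move=> ch; apply: (le_trans (derive_bound_lip c x d2 b)); rewrite ler_wpM2l.
have key c : `|c - x| <= `|h| -> `|dg c * h - h * dg x| <= K * h ^+ 2.
  move=> /lip hc; rewrite -(mulrC h) -mulrBr normrM -(real_normK (num_real h)).
  by rewrite expr2 mulrCA ler_wpM2l.
have [h0|h0|->] := ltgtP h 0; last by rewrite addr0 subrr mul0r subr0 normr0 expr0n mulr0.
- have xh : x + h < x by rewrite gtrDl.
  have [|c /[!in_itv]/= /andP[c1 c2] e] := @MVT R g dg (x + h) x xh.
    exact/continuous_subspaceT.
  have -> : g (x + h) - g x = dg c * h by rewrite -opprB e; ring.
  by apply: key; rewrite (ltr0_norm h0) ltr0_norm ?subr_lt0//; lra.
- have xh : x < x + h by rewrite ltrDl.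
  have [|c /[!in_itv]/= /andP[c1 c2] e] := @MVT R g dg x (x + h) xh.
    exact/continuous_subspaceT.
  have -> : g (x + h) - g x = dg c * h by rewrite e; ring.
  by apply: key; rewrite (gtr0_norm h0) gtr0_norm ?subr_gt0//; lra.
Qed.

Lemma bound_Hhalf f (df : R -> R) L : per f -> (forall x, is_derive x 1 f (df x)) ->
  (forall x, `|df x| <= L) -> Hhalf f /\ energy f <= 9 * L ^+ 2 * tau ^+ 2.
Proof.
move=> pf d b; have c := derive_bound_chord_lip pf d b.
have lf : L2p f by apply: L2p_continuous => //; exact: is_derive_continuous d.
split; first exact: chord_lip_Hhalf lf c.
by have := chord_lip_energy lf c; rewrite (_ : 18 * L ^+ 2 / 2 = 9 * L ^+ 2)//; field.
Qed.

Definition small_energy (C : R) f := Hhalf f /\ energy f <= C.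

Lemma small_energy_eform M m C f g : bsym M m -> small_energy C f -> small_energy C g -> `|eform m f g| <= M * C.
Proof.
move=> hm [hf fC] [hg gC]; have M0 : 0 <= M by case: hm => _ /(_ (0, 0)); apply: le_trans.
have C0 : 0 <= C by apply: le_trans fC; exact: energy_ge0.
apply: sqr_le_abs; first exact: mulr_ge0.
apply: (le_trans (eform_CS hm hf hg)); rewrite exprMn ler_wpM2l ?sqr_ge0// expr2.
by apply: ler_pM => //; exact: energy_ge0.
Qed.

Lemma small_eq0 (X s0 D : R) : 0 < s0 ->
  (forall s, 0 < s -> s <= s0 -> `|X| <= s * D) -> X = 0.
Proof.
move=> s00 h; apply/eqP; rewrite -normr_eq0 eq_le normr_ge0 andbT.
apply/ler_addgt0Pr => e e0; rewrite add0r.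
have D1 : 0 < `|D| + 1 by rewrite ltr_wpDl.
pose s := Num.min s0 (e / (`|D| + 1)).
have s1 : 0 < s by rewrite lt_min s00 divr_gt0.
apply: (le_trans (h s s1 _)); first by rewrite ge_min lexx.
apply: (@le_trans _ _ (s * (`|D| + 1))).
  by rewrite ler_wpM2l ?ltW//; have := ler_norm D; lra.
by rewrite -ler_pdivlMr// ge_min lexx orbT.
Qed.

Section Flow.
Variables (a da : R -> R) (K : R).
Hypotheses (pa : per a) (daP : forall x, is_derive x 1 a (da x)).
Hypotheses (K1 : 1 <= K) (aK : forall x, `|a x| <= K) (daK : forall x, `|da x| <= K).
(* 2 K^3 bounds the first derivatives of all the functions expanded below. *)
Let C := 9 * (2 * K ^+ 3) ^+ 2 * tau ^+ 2.

Let K0 : 0 < K. Proof. by apply: lt_le_trans K1. Qed.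

Lemma bound_small_energy f (df : R -> R) : per f -> (forall x, is_derive x 1 f (df x)) ->
  (forall x, `|df x| <= 2 * K ^+ 3) -> small_energy C f.
Proof. exact: bound_Hhalf. Qed.

(** Second order Taylor expansion of f along the flow, f o phi = f + s u and
    u = a f' + s d.  The energies are bounded through the derivatives: those of
    u and d are difference quotients of f', which involves three derivatives
    of f. *)
Lemma flow_expansion f (f1 f2 f3 : R -> R) s :
  per f -> (forall x, is_derive x 1 f (f1 x)) -> (forall x, is_derive x 1 f1 (f2 x)) ->
  (forall x, is_derive x 1 f2 (f3 x)) ->
  (forall x, `|f1 x| <= K) -> (forall x, `|f2 x| <= K) -> (forall x, `|f3 x| <= K) ->
  0 < s -> s * K <= 100^-1 ->
  exists u d : R -> R,
    [/\ f \o (fun x => x + s * a x) = (fun x => f x + s * u x),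
        u = (fun x => a x * f1 x + s * d x),
        small_energy C f, small_energy C (fun x => a x * f1 x) &
        [/\ small_energy C (fun x => f x + s * u x), small_energy C u & small_energy C d]].
Proof.
move=> pf d1 d2 d3 b1 b2 b3 s0 sK.
have Kp := K0; pose phi x := x + s * a x; pose dphi x := 1 + s * da x.
have K2 : K <= K ^+ 2 by rewrite expr2 ler_peMl// ltW.
have K3 : K ^+ 2 <= K ^+ 3 by rewrite [leRHS]exprS ler_peMl// sqr_ge0.
have dphiP x : is_derive x 1 phi (dphi x).
  by apply: is_deriveD; apply: is_derive_scale.
have pf1 := is_derive_per pf d1.
have per_phi g : per g -> per (g \o phi).
  move=> pg x; rewrite /= /phi pa (_ : x + tau + _ = x + s * a x + tau) ?pg//; ring.
have dF x : is_derive x 1 (f \o phi) (f1 (phi x) * dphi x).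
  by have dx := dphiP x; have := d1 (phi x) => dfx; exact: is_derive1_comp.
have daf x : is_derive x 1 (fun x => a x * f1 x) (da x * f1 x + a x * f2 x).
  apply: (is_derive_eq (is_deriveM (daP x) (d2 x))).
  by rewrite /GRing.scale /=; ring.
pose u x := s^-1 * (f (phi x) - f x).
have du x : is_derive x 1 u (s^-1 * (f1 (phi x) * dphi x - f1 x)).
  by apply: is_derive_scale; exact: is_deriveB (dF x) (d1 x).
pose d x := s^-1 * (u x - a x * f1 x).
have dd x : is_derive x 1 d (s^-1 * (s^-1 * (f1 (phi x) * dphi x - f1 x) - (da x * f1 x + a x * f2 x))).
  by apply: is_derive_scale; exact: is_deriveB (du x) (daf x).
have sn : s != 0 by rewrite gt_eqF.
have pF := per_phi _ pf.
have pu : per u by move=> x; rewrite /u pf; have /= -> := pF x.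
have paf : per (fun x => a x * f1 x) by move=> x; rewrite pa pf1.
have pd : per d by move=> x; rewrite /d pu paf.
have Fu : f \o phi = (fun x => f x + s * u x).
  by apply/funext => x; rewrite /u /=; field.
have sda x : `|s * da x| <= 100^-1.
  by rewrite normrM gtr0_norm// (le_trans _ sK)// ler_pM2l.
have e1 x : `|f1 (phi x) - f1 x| <= s * K ^+ 2.
  apply: (le_trans (derive_bound_lip _ _ d2 b2)).
  rewrite /phi addrAC subrr add0r normrM (gtr0_norm s0) mulrCA ler_pM2l// expr2.
  by rewrite ler_wpM2l// ltW.
have e2 x : `|f1 (phi x) - f1 x - s * a x * f2 x| <= s ^+ 2 * K ^+ 3.
  apply: (le_trans (taylor1 x (s * a x) d2 d3 b3)).
  have a2 : a x ^+ 2 <= K ^+ 2.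
    by rewrite -(real_normK (num_real (a x))) ler_sqr ?nnegrE// ltW.
  rewrite exprMn (_ : s ^+ 2 * K ^+ 3 = K * (s ^+ 2 * K ^+ 2)); last by ring.
  by rewrite ler_wpM2l ?(ltW K0)// ler_wpM2l ?sqr_ge0.
exists u, d; split => //.
- by apply/funext => x; rewrite /d; field.
- apply: (bound_small_energy pf d1) => x; have := b1 x; lra.
- apply: (bound_small_energy paf daf) => x; apply: (le_trans (ler_normD _ _)); rewrite !normrM.
  have h1 : `|da x| * `|f1 x| <= K * K by apply: ler_pM.
  have h2 : `|a x| * `|f2 x| <= K * K by apply: ler_pM.
  by rewrite expr2 in K3; lra.
split.
- rewrite -Fu; apply: (bound_small_energy pF dF) => x; rewrite normrM.
  apply: (@le_trans _ _ (K * 2)); last lra.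
  apply: ler_pM => //; rewrite /dphi; apply: (le_trans (ler_normD _ _)).
  by rewrite normr1; have := sda x; lra.
- apply: (bound_small_energy pu du) => x.
  rewrite normrM normfV (gtr0_norm s0) ler_pdivrMl//.
  have -> : f1 (phi x) * dphi x - f1 x = (f1 (phi x) - f1 x) + f1 (phi x) * (s * da x).
    by rewrite /dphi; ring.
  apply: (le_trans (ler_normD _ _)).
  have h : `|f1 (phi x) * (s * da x)| <= s * K ^+ 2.
    rewrite !normrM (gtr0_norm s0) mulrCA ler_pM2l// expr2.
    by apply: ler_pM.
  have := e1 x; have : s * K ^+ 2 <= s * K ^+ 3 by rewrite ler_pM2l.
  by lra.
- apply: (bound_small_energy pd dd) => x.
  have -> : s^-1 * (s^-1 * (f1 (phi x) * dphi x - f1 x) - (da x * f1 x + a x * f2 x)) =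
    s^-2 * ((f1 (phi x) - f1 x - s * a x * f2 x) + (s * da x) * (f1 (phi x) - f1 x)).
    by rewrite /dphi; field.
  rewrite normrM normfV (gtr0_norm (exprn_gt0 2 s0)) ler_pdivrMl ?exprn_gt0//.
  apply: (le_trans (ler_normD _ _)).
  have h : `|s * da x * (f1 (phi x) - f1 x)| <= s ^+ 2 * K ^+ 3.
    rewrite normrM (_ : s ^+ 2 * K ^+ 3 = (s * K) * (s * K ^+ 2)); last by ring.
    apply: ler_pM => //.
    by rewrite normrM gtr0_norm// ler_pM2l.
  by have := e2 x; lra.
Qed.

(** The two symbols differ only where the kernel vanishes by convention. *)
Lemma eform_versine f g : eform (fun z => versine z / versine z) f g = eform (cst 1) f g.
Proof.
rewrite /eform; congr Rintegral; apply/funext => z; rewrite /ker /ekernel -/(versine z) /=.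
have [->|N0] := eqVneq (versine z) 0; first by rewrite !(mulr0, invr0, mul0r).
by rewrite divff.
Qed.

Lemma measurable_versine1 : measurable_fun setT (fun z : R * R => versine z / versine z).
Proof.
apply: measurable_funM; first exact: measurable_versine.
by apply: (measurableT_comp (@measurable_inv R)); exact: measurable_versine.
Qed.

Lemma bsym_versine : bsym 1 (fun z : R * R => versine z / versine z).
Proof.
split; first exact: measurable_versine1.
move=> z; have [->|N0] := eqVneq (versine z) 0; first by rewrite mul0r normr0.
by rewrite divff// normr1.
Qed.

Hypothesis da_cont : continuous da.

(** Differentiate E[m_s](f o phi, w o phi) = E[1](f, w) at s = 0, where
    phi = x + s a(x).  All remainders have order s by the expansions of the
    symbol and of f and w along the flow, so the sum on the left is
    O(s) for all small s. *)
Lemma infinitesimal_invariance f (f1 f2 f3 w w1 w2 w3 : R -> R) :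
  per f -> (forall x, is_derive x 1 f (f1 x)) -> (forall x, is_derive x 1 f1 (f2 x)) ->
  (forall x, is_derive x 1 f2 (f3 x)) ->
  (forall x, `|f1 x| <= K) -> (forall x, `|f2 x| <= K) -> (forall x, `|f3 x| <= K) ->
  per w -> (forall x, is_derive x 1 w (w1 x)) -> (forall x, is_derive x 1 w1 (w2 x)) ->
  (forall x, is_derive x 1 w2 (w3 x)) ->
  (forall x, `|w1 x| <= K) -> (forall x, `|w2 x| <= K) -> (forall x, `|w3 x| <= K) ->
  eform (field_symbol a da) f w + eform (cst 1) (fun x => a x * f1 x) w
    + eform (cst 1) f (fun x => a x * w1 x) = 0.
Proof.
move=> pf d1 d2 d3 b1 b2 b3 pw e1 e2 e3 c1 c2 c3.
(* Six remainder terms, each of them at most 200 K^2 C. *)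
apply: (@small_eq0 _ (100^-1 / K) (1200 * K ^+ 2 * C)); first by rewrite divr_gt0.
move=> s s0; rewrite ler_pdivlMr// => sK.
have [u [d [Fu ud cf caf [cF cu cd]]]] := flow_expansion pf d1 d2 d3 b1 b2 b3 s0 sK.
have [v [e [Wv ve cw caw [cW cv ce]]]] := flow_expansion pw e1 e2 e3 c1 c2 c3 s0 sK.
have sK' : `|s| * K <= 100^-1 by rewrite gtr0_norm.
have l := lift_near_id pa daP daK sK' da_cont.
have sn : s != 0 by rewrite gt_eqF.
pose M := lift_symbol (fun x => x + s * a x) (fun x => 1 + s * da x).
have hmd := bsym_field pa daP daK da_cont.
(* The second order remainder of the symbol. *)
pose n z := s^-1 * (s^-1 * (M z - versine z / versine z) - field_symbol a da z).
have nK : bsym (200 * K ^+ 2) n.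
  split.
    apply: measurable_funM => //; apply: measurable_funB; last by case: hmd.
    apply: measurable_funM => //; apply: measurable_funB; last exact: measurable_versine1.
    exact: measurable_lift_symbol l.
  move=> z; have := symbol_estimate pa daP daK z sK'; rewrite -/M.
  have -> : n z = s^-2 * (M z - versine z / versine z - s * field_symbol a da z).
    by rewrite /n; move: (versine z / versine z) => q; field.
  rewrite normrM normfV (gtr0_norm (exprn_gt0 2 s0)) ler_pdivrMl ?exprn_gt0//.
  by move=> /le_trans; apply; rewrite gtr0_norm// exprMn mulrCA.
have hM : M = (fun z => versine z / versine z + (s * field_symbol a da z + s ^+ 2 * n z)).
  by apply/funext => z; rewrite /n; move: (versine z / versine z) => q; field.
have bM : bsym (1 + (`|s| * (8 * K) + `|s ^+ 2| * (200 * K ^+ 2))) M.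
  by rewrite hM; apply: bsymD; [exact: bsym_versine|apply: bsymD; exact: bsymZ].
have [hf _] := cf; have [hw _] := cw; have [hF _] := cF; have [hW _] := cW.
have [hu _] := cu; have [hv _] := cv; have [hd _] := cd; have [he _] := ce.
have [haf _] := caf; have [haw _] := caw.
have inv : eform M (fun x => f x + s * u x) (fun x => w x + s * v x) = eform (cst 1) f w.
  rewrite -Fu -Wv; apply: (invariance l _ bM hf hw); rewrite ?Fu ?Wv//.
  by exists 2 => x; have /andP[] := dlift_near1 daK x sK'.
have eM : eform M (fun x => f x + s * u x) (fun x => w x + s * v x) =
    eform (cst 1) (fun x => f x + s * u x) (fun x => w x + s * v x)
    + (s * eform (field_symbol a da) (fun x => f x + s * u x) (fun x => w x + s * v x)
    + s ^+ 2 * eform n (fun x => f x + s * u x) (fun x => w x + s * v x)).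
  rewrite hM (eformDm bsym_versine (bsymD (bsymZ s hmd) (bsymZ (s ^+ 2) nK)))// eform_versine.
  by rewrite (eformDm (bsymZ s hmd) (bsymZ (s ^+ 2) nK))// (eformZm _ hmd)// (eformZm _ nK).
have split2 m N0 : bsym N0 m -> eform m (fun x => f x + s * u x) (fun x => w x + s * v x) =
    eform m f w + s * eform m u (fun x => w x + s * v x) + s * eform m f v.
  move=> hm; rewrite (eformDl hm hf (HhalfZ s hu) hW) (eformZl _ hm hu hW).
  by rewrite (eformDr hm hw (HhalfZ s hv) hf) (eformZr _ hm hv hf); ring.
have eu : eform (cst 1) u (fun x => w x + s * v x) = eform (cst 1) (fun x => a x * f1 x) w
   + s * eform (cst 1) (fun x => a x * f1 x) v + s * eform (cst 1) d (fun x => w x + s * v x).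
  rewrite [in LHS]ud (eformDl (bsym1 R) haf (HhalfZ s hd) hW) (eformZl _ (bsym1 R) hd hW).
  by rewrite (eformDr (bsym1 R) hw (HhalfZ s hv) haf) (eformZr _ (bsym1 R) hv haf); ring.
have ev : eform (cst 1) f v = eform (cst 1) f (fun x => a x * w1 x) + s * eform (cst 1) f e.
  by rewrite [in LHS]ve (eformDr (bsym1 R) haw (HhalfZ s he) hf) (eformZr _ (bsym1 R) he hf).
have b_1 := small_energy_eform nK cF cW.
have b_2 := small_energy_eform (bsym1 R) caf cv.
have b_3 := small_energy_eform (bsym1 R) cd cW.
have b_4 := small_energy_eform (bsym1 R) cf ce.
have b_5 := small_energy_eform hmd cu cW.
have b_6 := small_energy_eform hmd cf cv.
have C0 : 0 <= C by case: cf => _; apply: le_trans; exact: energy_ge0.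
move: inv; rewrite eM (split2 _ _ (bsym1 R)) eu ev.
rewrite (split2 _ _ hmd).
move: (eform (cst 1) f w) (eform (field_symbol a da) f w) (eform (cst 1) (fun x => a x * f1 x) w)
  (eform (cst 1) f (fun x => a x * w1 x)) b_1 b_2 b_3 b_4 b_5 b_6 => c0 X1 X2 X3.
move: (eform n _ _) (eform (cst 1) _ v) (eform (cst 1) d _) (eform (cst 1) f e) (eform (field_symbol a da) u _)
  (eform (field_symbol a da) f v) => t1 t2 t3 t4 t5 t6 b_1 b_2 b_3 b_4 b_5 b_6 inv.
have -> : X1 + X2 + X3 = - s * (t1 + t2 + t3 + t4 + t5 + t6).
  by apply: (mulfI sn); lra.
rewrite normrM normrN (gtr0_norm s0) ler_pM2l//.
have Kp := K0; have K1p := K1; have K2 : K <= K ^+ 2 by rewrite expr2 ler_peMl// ltW.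
have k1 : 8 * K * C <= 200 * K ^+ 2 * C.
  by rewrite ler_wpM2r//; lra.
have k2 : 1 * C <= 200 * K ^+ 2 * C by rewrite ler_wpM2r//; lra.
have -> : 1200 * K ^+ 2 * C = 200 * K ^+ 2 * C + 200 * K ^+ 2 * C + 200 * K ^+ 2 * C
  + 200 * K ^+ 2 * C + 200 * K ^+ 2 * C + 200 * K ^+ 2 * C by ring.
clear -b_1 b_2 b_3 b_4 b_5 b_6 k1 k2.
do 4!(apply: (le_trans (ler_normD _ _)); apply: lerD; last lra).
by apply: (le_trans (ler_normD _ _)); lra.
Qed.

End Flow.
End Commutator.

(** * Conjugates of smooth functions *)

Section SmoothConjugate.
Variable R : realType.
Implicit Types (f g : R -> R) (x y : R) (m : R * R -> R).
Local Notation mu := (@lebesgue_measure R).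
Local Notation P := (period R).
Local Notation tau := (2 * @pi R).
Hint Resolve L2p_cosn L2p_sinn L2p_cst Hhalf_cosn Hhalf_sinn bsym1 : core.

Lemma smooth_is_derive f n x : smooth f ->
  is_derive x 1 (derive1n n f) (derive1n n.+1 f x).
Proof.
by move=> sf; apply: DeriveDef; [exact: sf|rewrite derive1nS derive1E].
Qed.

Lemma smooth_continuous f n : smooth f -> continuous (derive1n n f).
Proof. by move=> sf; apply: is_derive_continuous => x; exact: smooth_is_derive. Qed.

Lemma smooth_per f n : smooth f -> per f -> per (derive1n n f).
Proof.
move=> sf pf; elim: n => [//|n IH].
by apply: is_derive_per IH _ => x; exact: smooth_is_derive.
Qed.

Lemma smooth_bounded f n : smooth f -> per f -> exists2 M : R, 0 <= M & forall x, `|derive1n n f x| <= M.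
Proof.
by move=> sf pf; apply: per_continuous_bounded; [exact: smooth_per|exact: smooth_continuous].
Qed.

Lemma smooth_Hhalf f n : smooth f -> per f -> Hhalf (derive1n n f).
Proof.
move=> sf pf; apply: (derive_Hhalf (smooth_per n sf pf) (fun x => smooth_is_derive n x sf)).
exact: smooth_continuous.
Qed.

Lemma smooth_chain (y : nat -> R -> R) :
  (forall n x, is_derive x 1 (y n) (y n.+1 x)) ->
  smooth (y 0%N) /\ forall n, derive1n n (y 0%N) = y n.
Proof.
move=> d; have e n : derive1n n (y 0%N) = y n.
  elim: n => [//|n IH]; rewrite derive1nS IH; apply/funext => x.
  by rewrite derive1E; have dx := d n x; rewrite derive_val.
by split=> // n x; rewrite e; have dx := d n x; exact: ex_derive.
Qed.

Lemma L2p_continuous_prim f : L2p f -> ccoef f 0 = 0 -> continuous (prim f).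
Proof.
rewrite ccoef0E => lf f0 x; have [pf mf _] := lf.
by apply: (continuous_prim pf mf _ f0); exact: L2p_itg.
Qed.

Lemma L2p_is_derive_prim f x : L2p f -> ccoef f 0 = 0 -> continuous f ->
  is_derive x 1 (prim f) (f x).
Proof.
rewrite ccoef0E => lf f0 cf; have [pf mf _] := lf.
apply: (is_derive_prim pf mf _ f0); [exact: L2p_itg|exact: cf].
Qed.

(** Taking the conjugate commutes with differentiation. *)
Lemma conj_prim f (df v : R -> R) : per f -> (forall x, is_derive x 1 f (df x)) ->
  continuous df -> L2p v -> ccoef v 0 = 0 -> conjugate df v -> conjugate f (prim v).
Proof.
move=> pf d c lv v0 h i; have [h1 h2] := h i.
have n0 : i.+1%:R != 0 :> R by rewrite pnatr_eq0.
have v0' : \int[mu]_(x in P) v x = 0 by rewrite -ccoef0E.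
have e1 := ccoef_prim i.+1 lv v0'; have e2 := scoef_prim i.+1 lv v0'.
split; apply: (mulfI n0).
  by rewrite e1 h2 (ccoef_derive _ pf d c) mulrN.
by rewrite e2 h1 (scoef_derive _ pf d c) mulNr opprK.
Qed.

Definition demean f x := f x - ccoef f 0 / tau.

Lemma ccoef0_demean f : L2p f -> ccoef (demean f) 0 = 0.
Proof.
move=> lf; rewrite /demean /ccoef (ipBl lf (L2p_cst _)) // -!/(ccoef _ _) ccoef0_cst divfK ?subrr//.
by rewrite gt_eqF// tau_gt0.
Qed.

Lemma L2p_demean f : L2p f -> L2p (demean f).
Proof. by move=> lf; exact: (L2pB lf (L2p_cst _)). Qed.

Lemma demean_coef f i : L2p f -> ccoef (demean f) i.+1 = ccoef f i.+1 /\ scoef (demean f) i.+1 = scoef f i.+1.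
Proof.
move=> lf; rewrite /demean /ccoef /scoef !(ipBl lf (L2p_cst _)) //.
by rewrite -!/(ccoef _ _) -!/(scoef _ _) ccoef_cst// scoef_cst !subr0.
Qed.

Lemma conj_demean f v : L2p v -> conjugate f v -> conjugate f (demean v).
Proof. by move=> lv h i; have [-> ->] := demean_coef i lv; exact: h. Qed.

Let continuous_chain f : smooth f -> per f ->
  exists v : nat -> R -> R,
    [/\ forall n, L2p (v n), forall n, ccoef (v n) 0 = 0,
        forall n, continuous (v n) & forall n, conjugate (derive1n n f) (v n)].
Proof.
move=> sf pf.
have /choice[g hg] n : exists g, [/\ L2p g, ccoef g 0 = 0 & conjugate (derive1n n f) g].
  have [g [h1 h2 h3]] := has_symbol_exists (bsym1 R) (smooth_Hhalf n sf pf).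
  exists g; split; [exact: Hhalf_L2p|exact: h2|].
  by apply/conj_has_symbol; [exact: smooth_Hhalf|exact: h3].
have lp n : L2p (prim (g n)) by have [h1 h2 _] := hg n; apply: L2p_prim; rewrite -?ccoef0E.
exists (fun n => demean (prim (g n.+1))); split=> n.
- exact: L2p_demean.
- exact: ccoef0_demean.
- have [h1 h2 _] := hg n.+1; have c := L2p_continuous_prim h1 h2.
  by move=> x; apply: cvgB; [exact: c|exact: cvg_cst].
- apply: conj_demean; first exact: lp.
  have [h1 h2 h3] := hg n.+1.
  exact: (conj_prim (smooth_per n sf pf) (fun x => smooth_is_derive n x sf) (smooth_continuous sf) h1 h2 h3).
Qed.

Let C1_chain f : smooth f -> per f ->
  exists v dv : nat -> R -> R,
    [/\ forall n, L2p (v n), forall n, ccoef (v n) 0 = 0,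
        forall n x, is_derive x 1 (v n) (dv n x), forall n, continuous (dv n) &
        forall n, conjugate (derive1n n f) (v n)].
Proof.
move=> sf pf; have [g [lg g0 cg jg]] := continuous_chain sf pf.
have lp n : L2p (prim (g n)) by apply: L2p_prim; rewrite -?ccoef0E.
exists (fun n => demean (prim (g n.+1))), (fun n => g n.+1); split=> n.
- exact: L2p_demean.
- exact: ccoef0_demean.
- move=> x; rewrite -[X in is_derive _ _ _ X]subr0.
  by apply: is_deriveB (L2p_is_derive_prim x (lg _) (g0 _) (cg _)) (is_derive_cst _ _ _).
- exact: cg.
- apply: conj_demean; first exact: lp.
  exact: (conj_prim (smooth_per n sf pf) (fun x => smooth_is_derive n x sf) (smooth_continuous sf)
    (lg _) (g0 _) (jg _)).
Qed.

(** The conjugate of a smooth function is smooth: the conjugate of f is a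
    twofold primitive of the conjugate of f'', hence of class C^1, and
    conjugates of successive derivatives are primitives of each other. *)
Lemma smooth_conj f : smooth f -> per f ->
  exists v : nat -> R -> R,
    [/\ forall n x, is_derive x 1 (v n) (v n.+1 x), forall n, per (v n),
        forall n, ccoef (v n) 0 = 0 & forall n, conjugate (derive1n n f) (v n)].
Proof.
move=> sf pf; have [v [dv [lv v0 dvP cdv jv]]] := C1_chain sf pf.
have cv n : continuous (v n) by exact: is_derive_continuous (dvP n).
have pv n : per (v n) by have [] := lv n.
exists v; split => // n x.
have lp : L2p (prim (v n.+1)) by apply: L2p_prim; rewrite -?ccoef0E.
have dp y : is_derive y 1 (prim (v n.+1)) (v n.+1 y).
  exact: L2p_is_derive_prim (lv _) (v0 _) (cv _).
have jp : conjugate (derive1n n f) (prim (v n.+1)).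
  exact: (conj_prim (smooth_per n sf pf) (fun x => smooth_is_derive n x sf) (smooth_continuous sf)
    (lv _) (v0 _) (jv _)).
have pp : per (prim (v n.+1)) by have [] := lp.
move: (prim _) lp dp jp pp => q lp dp jp pp.
pose D y := v n y - q y.
have dD y : is_derive y 1 D (dv n y - v n.+1 y) by exact: is_deriveB (dvP n y) (dp y).
have pD : per D by move=> y; rewrite /D pv pp.
have cD : continuous (fun y => dv n y - v n.+1 y) by move=> y; apply: cvgB; [exact: cdv|exact: cv].
have [C _ hC] := C1_chord_lip pD dD cD.
have lD : L2p D by exact: L2pB.
have D0 : D = cst (ccoef D 0 / tau).
  apply: (chord_lip_uniqueness lD hC) => -[//|k] _.
  rewrite /D /ccoef /scoef !(ipBl (lv n) lp)// -!/(ccoef _ _) -!/(scoef _ _).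
  by have [-> ->] := jv n k; have [-> ->] := jp k; rewrite !subrr.
have -> : v n = (fun x => q x + ccoef D 0 / tau).
  apply/funext => y; have := congr1 (fun h => h y) D0; rewrite /= => <-.
  by rewrite /D addrC subrK.
by rewrite -[X in is_derive _ _ _ X]addr0; apply: is_deriveD (dp _) (is_derive_cst _ _ _).
Qed.

(** For smooth w, integrating by parts, tau <a v', w'> = - tau <v, (a w')'> is
    E[1](f, a w') and tau <k, w'> is - E[1](a f', w); their difference is
    - E[m](f, w) by infinitesimal invariance, m being the derivative of the
    symbols. *)
Lemma commutator_symbol (a f v k : R -> R) (v1 : R -> R) : smooth a -> per a ->
  smooth f -> per f -> per v -> ccoef v 0 = 0 -> conjugate f v ->
  (forall x, is_derive x 1 v (v1 x)) -> continuous v1 ->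
  Hhalf k -> ccoef k 0 = 0 -> conjugate (fun x => a x * derive1n 1 f x) k ->
  has_symbol (field_symbol a (derive1n 1 a)) f (fun x => a x * v1 x - k x).
Proof.
move=> sa pa sf pf pv v0 fv dv cv1 hk k0 jk.
have da x : is_derive x 1 a (derive1n 1 a x) := smooth_is_derive 0 x sa.
have dda x : is_derive x 1 (derive1n 1 a) (derive1n 2 a x) := smooth_is_derive 1 x sa.
have cda : continuous (derive1n 1 a) by exact: smooth_continuous.
have ca : continuous a := @smooth_continuous a 0 sa.
have hf : Hhalf f := smooth_Hhalf 0 sf pf.
have hv : Hhalf v by apply: derive_Hhalf dv _.
have pda : per (derive1n 1 a) by exact: smooth_per.
have caf : continuous (fun x => a x * derive1n 1 f x).
  by move=> x; apply: cvgM; [exact: ca|exact: smooth_continuous].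
have haf : Hhalf (fun x => a x * derive1n 1 f x).
  have p1 : per (fun x => a x * derive1n 1 f x).
    by move=> x; rewrite pa (smooth_per 1 sf pf).
  have p2 x : is_derive x 1 (fun x => a x * derive1n 1 f x)
      (derive1n 1 a x * derive1n 1 f x + a x * derive1n 2 f x).
    apply: (is_derive_eq (is_deriveM (da x) (smooth_is_derive 1 x sf))).
    by rewrite /GRing.scale /=; ring.
  apply: (derive_Hhalf p1 p2) => x; apply: cvgD; apply: cvgM.
  - exact: cda.
  - exact: smooth_continuous.
  - exact: ca.
  - exact: smooth_continuous.
have key (w w1 w2 w3 w4 : R -> R) : per w -> (forall x, is_derive x 1 w (w1 x)) ->
  (forall x, is_derive x 1 w1 (w2 x)) -> (forall x, is_derive x 1 w2 (w3 x)) ->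
  continuous w3 -> (forall x, is_derive x 1 w3 (w4 x)) ->
  tau * ip (fun x => a x * v1 x - k x) w1 = - eform (field_symbol a (derive1n 1 a)) f w.
  move=> pw d1 d2 d3 c3 d4.
  have c1 := is_derive_continuous d2; have c2 := is_derive_continuous d3.
  have pw1 := is_derive_per pw d1; have pw2 := is_derive_per pw1 d2.
  have pw3 := is_derive_per pw2 d3.
  have hw1 : Hhalf w1 by exact: derive_Hhalf d2 c2.
  have lav : L2p (fun x => a x * v1 x).
    apply: L2p_continuous; first by move=> x; rewrite pa (is_derive_per pv dv).
    by move=> x; apply: cvgM; [exact: ca|exact: cv1].
  rewrite (ipBl lav (Hhalf_L2p hk) (Hhalf_L2p hw1)) mulrBr.
  rewrite (conj_parts haf hk k0 jk pw d1 c1 hw1).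
  pose u x := a x * w1 x; pose u1 x := derive1n 1 a x * w1 x + a x * w2 x.
  have du x : is_derive x 1 u (u1 x).
    apply: (is_derive_eq (is_deriveM (da x) (d2 x))).
    by rewrite /u1 /GRing.scale /=; ring.
  have pu : per u by move=> x; rewrite /u pa pw1.
  have cu1 : continuous u1.
    move=> x; apply: cvgD; apply: cvgM; [exact: cda|exact: c1|exact: ca|exact: c2].
  have hu1 : Hhalf u1.
    have p2 x : is_derive x 1 u1
        (derive1n 2 a x * w1 x + derive1n 1 a x * w2 x *+ 2 + a x * w3 x).
      have e1 := is_deriveM (dda x) (d2 x); have e2 := is_deriveM (da x) (d3 x).
      apply: (is_derive_eq (is_deriveD e1 e2)).
      by rewrite /GRing.scale /=; ring.
    apply: (derive_Hhalf (is_derive_per pu du) p2).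
    - move=> x; apply: cvgD; last by apply: cvgM; [exact: ca|exact: c3].
      apply: cvgD; first by apply: cvgM; [exact: smooth_continuous|exact: c1].
      by apply: cvgMn; apply: cvgM; [exact: cda|exact: c2].
  have -> : ip (fun x => a x * v1 x) w1 = - ip v u1.
    rewrite -(ip_parts pv pu dv du cv1 cu1) /ip.
    by apply: eq_Rintegral => x _; rewrite /u; ring.
  rewrite mulrN (conj_parts hf hv v0 fv pu du cu1 hu1).
  have [Ma Ma0 ha] := per_continuous_bounded pa ca.
  have [Mda Mda0 hda] := per_continuous_bounded pda cda.
  have [F1 F10 hF1] := smooth_bounded 1 sf pf.
  have [F2 F20 hF2] := smooth_bounded 2 sf pf.
  have [F3 F30 hF3] := smooth_bounded 3 sf pf.
  have [W1 W10 hW1] := per_continuous_bounded pw1 c1.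
  have [W2 W20 hW2] := per_continuous_bounded pw2 c2.
  have [W3 W30 hW3] := per_continuous_bounded pw3 c3.
  pose K := 1 + Ma + Mda + F1 + F2 + F3 + W1 + W2 + W3.
  have hK (g : R -> R) b : (forall x, `|g x| <= b) -> b <= K -> forall x, `|g x| <= K.
    by move=> h bK x; exact: le_trans (h x) bK.
  have := @infinitesimal_invariance R a (derive1n 1 a) K pa da _
    (hK _ _ ha _) (hK _ _ hda _) cda
    f (derive1n 1 f) (derive1n 2 f) (derive1n 3 f) w w1 w2 w3 pf
    (fun x => smooth_is_derive 0 x sf) (fun x => smooth_is_derive 1 x sf)
    (fun x => smooth_is_derive 2 x sf)
    (hK _ _ hF1 _) (hK _ _ hF2 _) (hK _ _ hF3 _) pw d1 d2 d3
    (hK _ _ hW1 _) (hK _ _ hW2 _) (hK _ _ hW3 _).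
  have [k1 k2 k3 k4] : [/\ 1 <= K, Ma <= K, Mda <= K & F1 <= K] by rewrite /K; split; lra.
  have [k5 k6 k7 k8] : [/\ F2 <= K, F3 <= K, W1 <= K & W2 <= K] by rewrite /K; split; lra.
  have k9 : W3 <= K by rewrite /K; lra.
  move=> /(_ k1 k2 k3 k4 k5 k6 k7 k8 k9).
  by rewrite /u opprK; lra.
have lg : L2p (fun x => a x * v1 x - k x).
  apply: L2pB (Hhalf_L2p hk); apply: L2p_continuous; first by move=> x; rewrite pa (is_derive_per pv dv).
  by move=> x; apply: cvgM; [exact: ca|exact: cv1].
move=> i; have n1 := @is_derive_cosn R i.+1; have n2 := @is_derive_sinn R i.+1.
have sc c (g dg : R -> R) : (forall x, is_derive x 1 g (dg x)) ->
  forall x, is_derive x 1 (fun x => c * g x) (c * dg x).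
  by move=> h x; apply: is_derive_scale.
have hc := key _ _ _ _ _ (@per_cosn R i.+1) n1 (sc _ _ _ n2) (sc _ _ _ (sc _ _ _ n1))
  _ (sc _ _ _ (sc _ _ _ (sc _ _ _ n2))).
have hs := key _ _ _ _ _ (@per_sinn R i.+1) n2 (sc _ _ _ n1) (sc _ _ _ (sc _ _ _ n2))
  _ (sc _ _ _ (sc _ _ _ (sc _ _ _ n1))).
have cs c g : continuous g -> continuous (fun x => c * g x) by move=> h; exact: continuous_scale.
have := hc (cs _ _ (cs _ _ (cs _ _ (@continuous_sinn R i.+1)))).
have := hs (cs _ _ (cs _ _ (cs _ _ (@continuous_cosn R i.+1)))).
rewrite !ipZr// => {}hs {}hc.
split; first by rewrite -hs /ccoef; ring.
by rewrite -[RHS]opprK -hc /scoef; ring.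
Qed.

End SmoothConjugate.

(** * Functions on the circle *)

Section CircleFunctions.
Variable R : realType.
Implicit Types (f g : R -> R) (x y : R).
Local Notation mu := (@lebesgue_measure R).
Local Notation P := (period R).
Local Notation tau := (2 * @pi R).
Local Notation itg f := (mu.-integrable P (EFin \o f)).
Local Notation C := R[i].
Implicit Types (u v : S1 R -> C).
Hint Resolve L2p_cosn L2p_sinn L2p_cst Hhalf_cosn Hhalf_sinn : core.

Lemma expi_val x : val (expi x) = Complex (cos x) (sin x). Proof. by []. Qed.

Lemma expi_per : per (@expi R).
Proof. by move=> x; apply: val_inj; rewrite !expi_val cos_per sin_per. Qed.

Lemma cos_eq1 x : cos x = 1 -> exists k : int, x = k%:~R * tau.
Proof.
move=> cx; have := onem_cos_half (fold x).
rewrite (fold_per x (@cos_per R)) cx subrr => /esym/eqP.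
rewrite mulf_eq0 pnatr_eq0/= sqrf_eq0 => /eqP s0.
have /andP[f0 ft] := fold_itv x.
have f00 : fold x = 0.
  apply/eqP; rewrite eq_le f0 andbT leNgt; apply/negP => fp.
  have : 0 < sin (fold x / 2) by rewrite sin_gt0_pi// divr_gt0//= ltr_pdivrMr// mulrC.
  by rewrite s0 ltxx.
by move/eqP: f00; rewrite /fold subr_eq0 => /eqP e; exists (Num.floor (x / tau)).
Qed.

Lemma expi_eq x y : expi x = expi y -> exists k : int, x = y + k%:~R * tau.
Proof.
move=> /(congr1 val); rewrite !expi_val => -[c s].
have [|k e] := @cos_eq1 (x - y).
  by rewrite cosB c s -!expr2 cos2Dsin2.
by exists k; rewrite -e addrC subrK.
Qed.

(** Inverse of [ang] on periodic functions. *)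
Definition of_angle (T : Type) (g : R -> T) (z : S1 R) : T := g (xget 0 [set x | expi x = z]).

Lemma ang_of_angle (T : Type) (g : R -> T) : per g -> ang (of_angle g) = g.
Proof.
move=> pg; apply/funext => x; rewrite /ang /of_angle.
case: xgetP => [y _ /= e|/(_ x) []//].
by have [k ->] := expi_eq e; rewrite per_int.
Qed.

Lemma ang_per (T : Type) (w : S1 R -> T) : per (ang w).
Proof. by move=> x; rewrite /ang expi_per. Qed.

Definition re_ang u x := complex.Re (ang u x).
Definition im_ang u x := complex.Im (ang u x).

Lemma re_ang_per u : per (re_ang u). Proof. by move=> x; rewrite /re_ang ang_per. Qed.
Lemma im_ang_per u : per (im_ang u). Proof. by move=> x; rewrite /im_ang ang_per. Qed.

Definition circle_fun (f g : R -> R) : S1 R -> C := of_angle (fun x => Complex (f x) (g x)).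

Lemma circle_funE f g : per f -> per g -> re_ang (circle_fun f g) = f /\ im_ang (circle_fun f g) = g.
Proof.
move=> pf pg; have p : per (fun x => Complex (f x) (g x)) by move=> x; rewrite pf pg.
by split; apply/funext => x; rewrite /re_ang /im_ang /circle_fun ang_of_angle.
Qed.

(** * Square integrable functions *)
Lemma L2P u : L2 u <-> L2p (re_ang u) /\ L2p (im_ang u).
Proof.
split=> [[m1 m2 i]|[[p1 m1 i1] [p2 m2 i2]]].
- have M1 := per_measurable (re_ang_per u) m1; have M2 := per_measurable (im_ang_per u) m2.
  split; split; [exact: re_ang_per| |
    |exact: im_ang_per| |]; rewrite //.
  + apply: (@itg_le _ _ (fun x => sqnormc (ang u x))) i; first exact: measurable_funX.
    by move=> x _; rewrite ger0_norm ?sqr_ge0// /sqnormc lerDl sqr_ge0.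
  + apply: (@itg_le _ _ (fun x => sqnormc (ang u x))) i; first exact: measurable_funX.
    by move=> x _; rewrite ger0_norm ?sqr_ge0// /sqnormc lerDr sqr_ge0.
- split; [exact: measurable_funTS|exact: measurable_funTS|exact: itgD i1 i2].
Qed.

(** The boolean is the sign of the frequency. *)
Lemma fourierE u (n : nat) (b : bool) : L2 u ->
  let k : int := if b then - n%:Z else n%:Z in
  let e : R := (-1) ^+ b in
  tau * complex.Re (fourier u k) = ccoef (re_ang u) n + e * scoef (im_ang u) n /\
  tau * complex.Im (fourier u k) = ccoef (im_ang u) n - e * scoef (re_ang u) n.
Proof.
move=> /L2P[lr li] k e.
have hk x : k%:~R * x = e * (n%:R * x).
  by rewrite /k /e; case: (b) => /=; rewrite ?mulrNz ?expr1 ?expr0 ?mulN1r ?mul1r ?mulNr.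
have cE x : cos (k%:~R * x) = cosn n x.
  by rewrite hk /e /cosn; case: (b); rewrite ?expr1 ?expr0 ?mulN1r ?mul1r ?cosN.
have sE x : sin (k%:~R * x) = e * sinn n x.
  by rewrite hk /e /sinn; case: (b); rewrite ?expr1 ?expr0 ?mulN1r ?mul1r ?sinN.
have tn : tau != 0 by rewrite gt_eqF// tau_gt0.
have R1 x : complex.Re (ang u x * val (expi (- (k%:~R * x)))) =
    re_ang u x * cosn n x + e * (im_ang u x * sinn n x).
  rewrite expi_val cosN sinN cE sE /re_ang /im_ang.
  by case: (ang u x) => p q /=; ring.
have I1 x : complex.Im (ang u x * val (expi (- (k%:~R * x)))) =
    im_ang u x * cosn n x - e * (re_ang u x * sinn n x).
  rewrite expi_val cosN sinN cE sE /re_ang /im_ang.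
  by case: (ang u x) => p q /=; ring.
have mP := measurable_period R.
split; rewrite /fourier /cint /=.
- under eq_Rintegral do rewrite R1.
  rewrite mul0r subr0 mulrA divff// mul1r RintegralD//.
  + by rewrite RintegralZl//; exact: L2pM.
  + exact: L2pM.
  + by apply: itgZ; exact: L2pM.
- rewrite mul0r addr0 mulrA divff// mul1r.
  under eq_Rintegral do rewrite I1.
  rewrite RintegralB//.
  + by rewrite RintegralZl//; exact: L2pM.
  + exact: L2pM.
  + by apply: itgZ; exact: L2pM.
Qed.

Lemma fourier_pos u n : L2 u ->
  tau * complex.Re (fourier u n%:Z) = ccoef (re_ang u) n + scoef (im_ang u) n /\
  tau * complex.Im (fourier u n%:Z) = ccoef (im_ang u) n - scoef (re_ang u) n.
Proof. by move=> h; have /= := fourierE n false h; rewrite expr0 !mul1r. Qed.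

Lemma fourier_neg u n : L2 u ->
  tau * complex.Re (fourier u (- n%:Z)) = ccoef (re_ang u) n - scoef (im_ang u) n /\
  tau * complex.Im (fourier u (- n%:Z)) = ccoef (im_ang u) n + scoef (re_ang u) n.
Proof. by move=> h; have /= := fourierE n true h; rewrite expr1 !mulN1r opprK. Qed.

Lemma sqnormc_ge0 (z : C) : 0 <= sqnormc z.
Proof. by rewrite addr_ge0 ?sqr_ge0. Qed.

Lemma sqnorm_pair u i : L2 u ->
  tau ^+ 2 * (sqnormc (fourier u i.+1%:Z) + sqnormc (fourier u (- i.+1%:Z))) =
  2 * (amp2 (re_ang u) i + amp2 (im_ang u) i).
Proof.
move=> h; have [a b] := fourier_pos i.+1 h; have [c d] := fourier_neg i.+1 h.
rewrite /sqnormc /amp2 [LHS](_ : _ = (tau * complex.Re (fourier u i.+1%:Z)) ^+ 2 +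
  (tau * complex.Im (fourier u i.+1%:Z)) ^+ 2 + (tau * complex.Re (fourier u (- i.+1%:Z))) ^+ 2 +
  (tau * complex.Im (fourier u (- i.+1%:Z))) ^+ 2); last by ring.
by rewrite a b c d; ring.
Qed.

(** The frequencies n and - n are grouped together. *)
Lemma sqnormH_series u : L2 u ->
  sqnormH u = (\sum_(i <oo) (2 / tau ^+ 2 * (i.+1%:R * (amp2 (re_ang u) i + amp2 (im_ang u) i)))%:E)%E.
Proof.
move=> h; have t2 : tau ^+ 2 != 0 by rewrite expf_neq0// gt_eqF// tau_gt0.
pose a (n : int) : \bar R := ((`|n|%N)%:R * sqnormc (fourier u n))%:E.
have a0 n : (0 <= a n)%E by rewrite lee_fin mulr_ge0 ?sqnormc_ge0.
rewrite /sqnormH (esumID [set n : int | 0 < n]); last by move=> n _; exact: a0.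
have -> : [set n : int | n != 0] `&` [set n : int | 0 < n] = (fun i : nat => i.+1%:Z) @` setT.
  apply/seteqP; split=> [n [_ /= n0]|_ [i _ <-]]; last by split.
  by case: n n0 => // -[//|n] _; exists n.
have -> : [set n : int | n != 0] `&` ~` [set n : int | 0 < n] = (fun i : nat => - i.+1%:Z) @` setT.
  apply/seteqP; split=> [n [n1 /= n0]|_ [i _ <-]]; last by split.
  by case: n n1 n0 => // [[|n]//|n] _ _; exists n.
rewrite !esum_image; last 2 first.
  by move=> i j _ _ [].
  by move=> i j _ _  [].
rewrite -esumD; try by move=> i _; exact: a0.
rewrite nneseries_esumT; last first.
  by move=> i; rewrite lee_fin !mulr_ge0 ?invr_ge0 ?sqr_ge0// addr_ge0// amp2_ge0.
apply: eq_esum => i _; rewrite /a abszN /= -EFinD; congr EFin.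
apply: (mulfI t2); have := sqnorm_pair i h.
set q := sqnormc (fourier u i.+1%:Z); set p := sqnormc _.
set r := amp2 (re_ang u) i; set s := amp2 _ _ => e.
have -> : tau ^+ 2 * (2 / tau ^+ 2 * (i.+1%:R * (r + s))) =
  (tau ^+ 2 / tau ^+ 2) * (i.+1%:R * (2 * (r + s))) by ring.
rewrite divff// mul1r -e; ring.
Qed.

Lemma H12P u : H12 u <-> Hhalf (re_ang u) /\ Hhalf (im_ang u).
Proof.
split=> [[h fin]|[hr hi]].
- have [lr li] := (L2P u).1 h.
  move: fin; rewrite sqnormH_series// => fin.
  have t0 : 0 < 2 / tau ^+ 2 :> R by rewrite divr_gt0// exprn_gt0// tau_gt0.
  have nn i : (0 <= (2 / tau ^+ 2 * (i.+1%:R * (amp2 (re_ang u) i + amp2 (im_ang u) i)))%:E)%E.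
    by rewrite lee_fin mulr_ge0 ?(ltW t0)// mulr_ge0// addr_ge0// amp2_ge0.
  have bd n : 2 / tau ^+ 2 * (\sum_(i < n) i.+1%:R * (amp2 (re_ang u) i + amp2 (im_ang u) i)) <=
     fine (\sum_(i <oo) (2 / tau ^+ 2 * (i.+1%:R * (amp2 (re_ang u) i + amp2 (im_ang u) i)))%:E)%E.
    rewrite -lee_fin fineK; last by rewrite ge0_fin_numE// nneseries_ge0.
    apply: le_trans (nneseries_lim_ge n _) => //.
    by rewrite big_mkord sumEFin mulr_sumr.
  have wb (f g : R -> R) : (forall n, 2 / tau ^+ 2 * (\sum_(i < n) i.+1%:R * (amp2 f i + amp2 g i)) <= fine
     (\sum_(i <oo) (2 / tau ^+ 2 * (i.+1%:R * (amp2 (re_ang u) i + amp2 (im_ang u) i)))%:E)%E) ->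
     weights_bounded f.
    move=> H; eexists => n; have := H n; rewrite -ler_pdivlMl// => /(le_trans _); apply.
    by apply: ler_sum => i _; rewrite ler_wpM2l// lerDl amp2_ge0.
  split; apply: weights_Hhalf => //; first exact: wb bd.
  by apply: (wb _ (re_ang u)) => n; under eq_bigr do rewrite addrC; exact: bd.
- have h : L2 u by apply/L2P; split; exact: Hhalf_L2p.
  split => //; rewrite sqnormH_series//.
  have [Mr hMr] := Hhalf_weights hr; have [Mi hMi] := Hhalf_weights hi.
  have t0 : 0 < 2 / tau ^+ 2 :> R by rewrite divr_gt0// exprn_gt0// tau_gt0.
  apply: (@le_lt_trans _ _ (2 / tau ^+ 2 * (Mr + Mi))%:E); last exact: ltry.
  apply: lime_le.
    apply: is_cvg_nneseries => i _ _.
    by rewrite lee_fin mulr_ge0 ?(ltW t0)// mulr_ge0// addr_ge0// amp2_ge0.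
  apply: nearW => n; rewrite big_mkord sumEFin lee_fin -mulr_sumr ler_wpM2l ?(ltW t0)//.
  rewrite (eq_bigr (fun i : 'I_n => i.+1%:R * amp2 (re_ang u) i + i.+1%:R * amp2 (im_ang u) i)); last first.
    by move=> i _; rewrite mulrDr.
  by rewrite big_split /=; apply: lerD; [exact: hMr|exact: hMi].
Qed.

Lemma normHE u : H12 u -> normH u = Num.sqrt ((energy (re_ang u) + energy (im_ang u)) / tau ^+ 2).
Proof.
move=> h; have [hr hi] := (H12P u).1 h; have [l _] := h.
rewrite /normH sqnormH_series//; congr Num.sqrt.
rewrite -[RHS]/(fine _%:E); congr fine; apply: cvg_lim => //.
rewrite [X in X @ \oo --> _](_ : _ = EFin \o (fun n =>
  (2 * (\sum_(i < n) i.+1%:R * amp2 (re_ang u) i) + 2 * (\sum_(i < n) i.+1%:R * amp2 (im_ang u) i)) / tau ^+ 2)).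
  apply/cvg_EFin; first exact: nearW.
  by apply: cvgMl; apply: cvgD; exact: energy_cvg.
apply/funext => n /=; rewrite big_mkord sumEFin; congr EFin.
rewrite -mulrDr -big_split /= -mulr_sumr mulrAC; congr (_ * _).
by congr (_ * _); apply: eq_bigr => i _; rewrite mulrDr.
Qed.

Lemma normH_sqr u : H12 u -> normH u ^+ 2 = (energy (re_ang u) + energy (im_ang u)) / tau ^+ 2.
Proof.
by move=> h; rewrite normHE// sqr_sqrtr// divr_ge0 ?sqr_ge0// addr_ge0// energy_ge0.
Qed.

(** * Equality of classes *)
Definition same_coef f g := forall i, ccoef f i.+1 = ccoef g i.+1 /\ scoef f i.+1 = scoef g i.+1.

Lemma ae_same_coef f g c : L2p f -> L2p g ->
  {ae mu, forall x, P x -> f x = g x + c} -> same_coef f g.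
Proof.
move=> lf lg fg i; have lc : L2p (fun x => g x + c) by exact: L2pD lg (L2p_cst _).
rewrite /ccoef /scoef !(ip_ae lf lc _ fg)// !(ipDl lg (L2p_cst _))//.
by rewrite -!/(ccoef _ _) -!/(scoef _ _) ccoef_cst// scoef_cst !addr0.
Qed.

(** Functions with equal nonconstant coefficients differ by a constant almost
    everywhere, separately for the real and imaginary parts. *)
Lemma eqH_coef u v : L2 u -> L2 v ->
  eqH u v <-> same_coef (re_ang u) (re_ang v) /\ same_coef (im_ang u) (im_ang v).
Proof.
move=> /L2P[lru liu] /L2P[lrv liv]; split=> [[[c d] uv]|[h1 h2]].
- split.
  + apply: (@ae_same_coef _ _ c) => //; apply: filterS uv => [|x /[apply]].
      exact: (ae_filter_ringOfSetsType mu).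
    by rewrite /re_ang => ->; case: (ang v x).
  + apply: (@ae_same_coef _ _ d) => //; apply: filterS uv => [|x /[apply]].
      exact: (ae_filter_ringOfSetsType mu).
    by rewrite /im_ang => ->; case: (ang v x).
- have [|c hc] := fourier_uniqueness_cst lru lrv; first by case.
  have [|d hd] := fourier_uniqueness_cst liu liv; first by case.
  exists (Complex c d); have F := ae_filter_ringOfSetsType mu.
  apply: filterS2 hc hd => x h h' Px; have := h Px; have := h' Px.
  rewrite /re_ang /im_ang; case: (ang u x) (ang v x) => a b [a' b'] /= -> ->.
  by [].
Qed.

End CircleFunctions.

(** * Symbols and bounded operators *)

Section SymbolOperators.
Variable R : realType.
Implicit Types (f g : R -> R) (x y : R) (m : R * R -> R).
Local Notation mu := (@lebesgue_measure R).
Local Notation P := (period R).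
Local Notation tau := (2 * @pi R).
Local Notation C := R[i].
Local Notation fct := (S1 R -> C).
Implicit Types (u v w : fct) (T : fct -> fct).

Lemma complex_ext (z w : C) : complex.Re z = complex.Re w -> complex.Im z = complex.Im w -> z = w.
Proof. by case: z w => a b [c d] /= -> ->. Qed.

Lemma re_ang_lin (a : C) u v : re_ang (a *: u + v) =
  (fun x => complex.Re a * re_ang u x + - complex.Im a * im_ang u x + re_ang v x).
Proof.
apply/funext => x; rewrite /re_ang /im_ang /ang.
have -> : (a *: u + v) (expi x) = a * u (expi x) + v (expi x) by [].
by case: (u _) (v _) a => p q [p' q'] [a b] /=; ring.
Qed.

Lemma im_ang_lin (a : C) u v : im_ang (a *: u + v) =
  (fun x => complex.Re a * im_ang u x + complex.Im a * re_ang u x + im_ang v x).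
Proof.
apply/funext => x; rewrite /re_ang /im_ang /ang.
have -> : (a *: u + v) (expi x) = a * u (expi x) + v (expi x) by [].
by case: (u _) (v _) a => p q [p' q'] [a b] /=; ring.
Qed.

Lemma re_ang_comb (c : R) u v w : re_ang (c%:C%C *: (u - v) - w) =
  (fun x => c * (re_ang u x + -1 * re_ang v x) + -1 * re_ang w x).
Proof.
apply/funext => x; rewrite /re_ang /ang.
have -> : (c%:C%C *: (u - v) - w) (expi x) =
  Complex c 0 * (u (expi x) - v (expi x)) - w (expi x) by [].
by case: (u _) (v _) (w _) => p q [p' q'] [a b] /=; ring.
Qed.

Lemma im_ang_comb (c : R) u v w : im_ang (c%:C%C *: (u - v) - w) =
  (fun x => c * (im_ang u x + -1 * im_ang v x) + -1 * im_ang w x).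
Proof.
apply/funext => x; rewrite /im_ang /ang.
have -> : (c%:C%C *: (u - v) - w) (expi x) =
  Complex c 0 * (u (expi x) - v (expi x)) - w (expi x) by [].
by case: (u _) (v _) (w _) => p q [p' q'] [a b] /=; ring.
Qed.

Lemma re_ang_sub u v : re_ang (u - v) = (fun x => re_ang u x - re_ang v x).
Proof.
apply/funext => x; rewrite /re_ang /ang.
have -> : (u - v) (expi x) = u (expi x) - v (expi x) by [].
by case: (u _) (v _) => p q [p' q'].
Qed.

Lemma im_ang_sub u v : im_ang (u - v) = (fun x => im_ang u x - im_ang v x).
Proof.
apply/funext => x; rewrite /im_ang /ang.
have -> : (u - v) (expi x) = u (expi x) - v (expi x) by [].
by case: (u _) (v _) => p q [p' q'].
Qed.

Lemma has_symbol_lin3 M m c d f g k F G K : bsym M m ->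
  Hhalf f -> Hhalf g -> Hhalf k -> Hhalf F -> Hhalf G -> Hhalf K ->
  has_symbol m f F -> has_symbol m g G -> has_symbol m k K ->
  has_symbol m (fun x => c * f x + d * g x + k x) (fun x => c * F x + d * G x + K x).
Proof.
move=> hm hf hg hk hF hG hK w1 w2 w3.
have a1 := has_symbolZ c hm hf (Hhalf_L2p hF) w1; have a2 := has_symbolZ d hm hg (Hhalf_L2p hG) w2.
have b1 := HhalfZ c hf; have b2 := HhalfZ d hg; have d1 := HhalfZ c hF; have d2 := HhalfZ d hG.
have a12 := has_symbolD hm b1 b2 (Hhalf_L2p d1) (Hhalf_L2p d2) a1 a2.
exact: (has_symbolD hm (HhalfD b1 b2) hk (Hhalf_L2p (HhalfD d1 d2)) (Hhalf_L2p hK) a12 w3).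
Qed.

(** [T] acts as the operator with real symbol [m] on real and imaginary
    parts. *)
Definition symbol_op m T := forall u, H12 u ->
  [/\ H12 (T u), has_symbol m (re_ang u) (re_ang (T u)) & has_symbol m (im_ang u) (im_ang (T u))].

Lemma H12_lin (a : C) u v : H12 u -> H12 v -> H12 (a *: u + v).
Proof.
move=> /H12P[a1 a2] /H12P[b1 b2]; apply/H12P; rewrite re_ang_lin im_ang_lin.
by split; apply: HhalfD => //; apply: HhalfD; apply: HhalfZ.
Qed.

Lemma symbol_op_normH M m T u : bsym M m -> symbol_op m T -> H12 u ->
  normH (T u) <= M * normH u.
Proof.
move=> hm hT hu; have [h1 h2 h3] := hT u hu.
have M0 : 0 <= M by case: hm => _ /(_ (0, 0)); apply: le_trans.
have t0 : 0 < tau ^+ 2 :> R by rewrite exprn_gt0// tau_gt0.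
have [u1 u2] := (H12P u).1 hu; have [v1 v2] := (H12P _).1 h1.
have k1 := has_symbol_energy hm u1 (Hhalf_L2p v1) h2; have k2 := has_symbol_energy hm u2 (Hhalf_L2p v2) h3.
have a0 : 0 <= normH (T u) := sqrtr_ge0 _; have b0 : 0 <= normH u := sqrtr_ge0 _.
have e1 := normH_sqr hu; have e2 := normH_sqr h1.
move: (normH (T u)) (normH u) a0 b0 e1 e2 => p q p0 q0 e1 e2.
have c0 := mulr_ge0 M0 q0.
suff : p ^+ 2 <= (M * q) ^+ 2 by rewrite ler_sqr.
rewrite exprMn e1 e2 mulrA ler_pM2r ?invr_gt0// mulrDr.
exact: lerD k1 k2.
Qed.

Lemma symbol_op_bounded M m T : bsym M m -> symbol_op m T -> bounded_op T.
Proof.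
move=> hm hT; split.
- by move=> u hu; have [] := hT u hu.
- move=> u v hu hv uv; have [a1 a2 a3] := hT u hu; have [b1 b2 b3] := hT v hv.
  have [lu _] := hu; have [lv _] := hv; have [lTu _] := a1; have [lTv _] := b1.
  have [c1 c2] := (eqH_coef lu lv).1 uv.
  have [ru iu] := (H12P u).1 hu; have [rv iv] := (H12P v).1 hv.
  have tr f g F : Hhalf f -> Hhalf g -> same_coef f g -> has_symbol m g F -> has_symbol m f F.
    move=> hf hg fg h i; have [h1 h2] := h i.
    by rewrite !(eform_coef hm hf hg _ fg)//; [exact: Hhalf_cosn|exact: Hhalf_sinn].
  apply/eqH_coef; [exact: lTu|exact: lTv|split=> i].
    exact: has_symbol_coef a2 (tr _ _ _ ru rv c1 b2).
  exact: has_symbol_coef a3 (tr _ _ _ iu iv c2 b3).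
- move=> a u v hu hv; have [a1 a2 a3] := hT u hu; have [b1 b2 b3] := hT v hv.
  have hw := H12_lin a hu hv; have [d1 d2 d3] := hT _ hw.
  have [ru iu] := (H12P u).1 hu; have [rv iv] := (H12P v).1 hv.
  have [rTu iTu] := (H12P _).1 a1; have [rTv iTv] := (H12P _).1 b1.
  have [lw1 _] := d1; have [lw2 _] := H12_lin a a1 b1.
  apply/eqH_coef; [exact: lw1|exact: lw2|split=> i].
    apply: has_symbol_coef d2 _; rewrite !re_ang_lin.
    exact: (has_symbol_lin3 _ _ hm ru iu rv rTu iTu rTv a2 a3 b2).
  apply: has_symbol_coef d3 _; rewrite !im_ang_lin.
  exact: (has_symbol_lin3 _ _ hm iu ru iv iTu rTu iTv a3 a2 b3).
- by exists M => u; exact: symbol_op_normH hm hT.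
Qed.

Lemma op_norm_le M m T : bsym M m -> symbol_op m T -> (op_norm T <= M%:E)%E.
Proof.
move=> hm hT; apply: ge_ereal_sup => _ [u [hu u1] <-]; rewrite lee_fin.
apply: (le_trans (symbol_op_normH hm hT hu)).
have M0 : 0 <= M by case: hm => _ /(_ (0, 0)); apply: le_trans.
by rewrite -[leRHS]mulr1 ler_wpM2l.
Qed.

Lemma H12_0 : H12 (0 : fct).
Proof.
apply/H12P; have e : re_ang (0 : fct) = cst 0 /\ im_ang (0 : fct) = cst 0 by split; apply/funext.
by have [-> ->] := e; split; exact: Hhalf_cst.
Qed.

Lemma op_norm_ge0 T : (0 <= op_norm T)%E.
Proof.
apply: (@le_trans _ _ (normH (T 0))%:E); first by rewrite lee_fin sqrtr_ge0.
apply: ereal_sup_ubound; exists 0 => //; split; first exact: H12_0.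
have e : re_ang (0 : fct) = cst 0 /\ im_ang (0 : fct) = cst 0 by split; apply/funext.
rewrite normHE; last exact: H12_0.
have [-> ->] := e; rewrite energy_coef0; first by rewrite addr0 mul0r sqrtr0.
  exact: Hhalf_cst.
by move=> i; rewrite ccoef_cst// scoef_cst.
Qed.

Lemma symbol_op_exists M m : bsym M m -> exists T, symbol_op m T.
Proof.
move=> hm.
have /choice[T hT] u : exists v, H12 u ->
    [/\ H12 v, has_symbol m (re_ang u) (re_ang v) & has_symbol m (im_ang u) (im_ang v)].
  have [hu|nu] := pselect (H12 u); last by exists 0.
  have [ru iu] := (H12P u).1 hu.
  have [g [hg _ wg]] := has_symbol_exists hm ru; have [k [hk _ wi]] := has_symbol_exists hm iu.
  have [pg _ _] := Hhalf_L2p hg; have [pk _ _] := Hhalf_L2p hk.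
  have [e1 e2] := circle_funE pg pk.
  have hv : H12 (circle_fun g k) by apply/H12P; rewrite e1 e2.
  by exists (circle_fun g k) => _; rewrite e1 e2.
by exists T.
Qed.

Lemma symbol_op_comb M1 M2 M3 m1 m2 m3 T1 T2 T3 (c : R) :
  bsym M1 m1 -> bsym M2 m2 -> bsym M3 m3 ->
  symbol_op m1 T1 -> symbol_op m2 T2 -> symbol_op m3 T3 ->
  symbol_op (fun z => c * (m1 z + -1 * m2 z) + -1 * m3 z)
    (fun u => c%:C%C *: (T1 u - T2 u) - T3 u).
Proof.
move=> h1 h2 h3 o1 o2 o3 u hu.
have [a1 b1 c1] := o1 u hu; have [a2 b2 c2] := o2 u hu; have [a3 b3 c3] := o3 u hu.
have [ru iu] := (H12P u).1 hu.
have [x1 y1] := (H12P _).1 a1; have [x2 y2] := (H12P _).1 a2; have [x3 y3] := (H12P _).1 a3.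
have key f f1 f2 f3 : Hhalf f -> Hhalf f1 -> Hhalf f2 -> Hhalf f3 ->
  has_symbol m1 f f1 -> has_symbol m2 f f2 -> has_symbol m3 f f3 ->
  Hhalf (fun x => c * (f1 x + -1 * f2 x) + -1 * f3 x) /\
  has_symbol (fun z => c * (m1 z + -1 * m2 z) + -1 * m3 z) f (fun x => c * (f1 x + -1 * f2 x) + -1 * f3 x).
  move=> hf hf1 hf2 hf3 w1 w2 w3; split.
    by apply: HhalfD; apply: HhalfZ => //; apply: HhalfD => //; exact: HhalfZ.
  have n2 := bsymZ (-1) h2; have n12 := bsymD h1 n2; have nc := bsymZ c n12; have n3 := bsymZ (-1) h3.
  have l2 : L2p (fun x => -1 * f2 x) by exact: Hhalf_L2p (HhalfZ _ hf2).
  have v2 : has_symbol (fun z => -1 * m2 z) f (fun x => -1 * f2 x).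
    by apply: (has_symbolZm _ h2) => //; exact: Hhalf_L2p.
  have v3 : has_symbol (fun z => -1 * m3 z) f (fun x => -1 * f3 x).
    by apply: (has_symbolZm _ h3) => //; exact: Hhalf_L2p.
  have v12 := has_symbolDm h1 n2 hf (Hhalf_L2p hf1) l2 w1 v2.
  have l12 : L2p (fun x => f1 x + -1 * f2 x) by exact: L2pD (Hhalf_L2p hf1) l2.
  have vc := has_symbolZm c n12 hf l12 v12.
  exact: (has_symbolDm nc n3 hf (L2pZ c l12) (Hhalf_L2p (HhalfZ _ hf3)) vc v3).
have [k1 k2] := key _ _ _ _ ru x1 x2 x3 b1 b2 b3.
have [k3 k4] := key _ _ _ _ iu y1 y2 y3 c1 c2 c3.
have hw : H12 (c%:C%C *: (T1 u - T2 u) - T3 u).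
  by apply/H12P; rewrite re_ang_comb im_ang_comb.
by split; [exact: hw|rewrite re_ang_comb|rewrite im_ang_comb].
Qed.

(** * The Hilbert transform *)
Lemma mulNi_pos (z : C) : complex.Re (- Complex 0 1 * 1%:~R * z) = complex.Im z /\
  complex.Im (- Complex 0 1 * 1%:~R * z) = - complex.Re z.
Proof. by rewrite mulr1z mulr1; case: z => a b /=; split; ring. Qed.

Lemma mulNi_neg (z : C) : complex.Re (- Complex 0 1 * (-1)%:~R * z) = - complex.Im z /\
  complex.Im (- Complex 0 1 * (-1)%:~R * z) = complex.Re z.
Proof. by rewrite mulrNz mulr1z mulrN1 opprK; case: z => a b /=; split; ring. Qed.

Definition hilb_coef u v := [/\ conjugate (re_ang u) (re_ang v), conjugate (im_ang u) (im_ang v),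
  ccoef (re_ang v) 0 = 0 & ccoef (im_ang v) 0 = 0].

Lemma hilb_fourier u v : L2 u -> L2 v ->
  (forall n : int, fourier v n = - Complex 0 1 * (sgz n)%:~R * fourier u n) <-> hilb_coef u v.
Proof.
move=> lu lv; have tn : tau != 0 by rewrite gt_eqF// tau_gt0.
split=> [h|[h1 h2 h3 h4]].
- have pos i : (tau * complex.Re (fourier v i.+1%:Z) = tau * complex.Im (fourier u i.+1%:Z)) /\
     (tau * complex.Im (fourier v i.+1%:Z) = - (tau * complex.Re (fourier u i.+1%:Z))).
    by rewrite h; have [-> ->] := mulNi_pos (fourier u i.+1%:Z); rewrite mulrN.
  have neg i : (tau * complex.Re (fourier v (- i.+1%:Z)) = - (tau * complex.Im (fourier u (- i.+1%:Z)))) /\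
     (tau * complex.Im (fourier v (- i.+1%:Z)) = tau * complex.Re (fourier u (- i.+1%:Z))).
    by rewrite h; have [-> ->] := mulNi_neg (fourier u (- i.+1%:Z)); rewrite mulrN.
  have fp i := fourier_pos i.+1 lu; have gp i := fourier_pos i.+1 lv.
  have fn i := fourier_neg i.+1 lu; have gn i := fourier_neg i.+1 lv.
  have all i : [/\ ccoef (re_ang v) i.+1 = - scoef (re_ang u) i.+1, scoef (re_ang v) i.+1 = ccoef (re_ang u) i.+1,
      ccoef (im_ang v) i.+1 = - scoef (im_ang u) i.+1 & scoef (im_ang v) i.+1 = ccoef (im_ang u) i.+1].
    have [p1 p2] := pos i; have [n1 n2] := neg i.
    have [a1 a2] := fp i; have [b1 b2] := gp i; have [c1 c2] := fn i; have [d1 d2] := gn i.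
    move: p1 p2 n1 n2; rewrite a1 a2 b1 b2 c1 c2 d1 d2.
    move: (ccoef (re_ang u) _) (scoef (re_ang u) _) (ccoef (im_ang u) _) (scoef (im_ang u) _)
      (ccoef (re_ang v) _) (scoef (re_ang v) _) (ccoef (im_ang v) _) (scoef (im_ang v) _); clear.
    by move=> a b c d a' b' c' d' p1 p2 n1 n2; split; lra.
  have z0 : fourier v 0 = 0 by rewrite h sgz0 mulr0 mul0r.
  have [e1 e2] := fourier_pos 0 lv.
  split=> [i|i||]; try by have [] := all i.
    by move: e1; rewrite z0 scoef0 addr0 mulr0 => <-.
  by move: e2; rewrite z0 scoef0 subr0 mulr0 => <-.
- have split_n (n : int) : [\/ n = 0, exists i, n = i.+1%:Z | exists i, n = - i.+1%:Z].
    by case: n => [[|i]|i]; [exact: Or31|apply: Or32; exists i|apply: Or33; exists i].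
  move=> n; case: (split_n n) => [->|[i ->]|[i ->]].
  + rewrite sgz0 mulr0 mul0r; have [e1 e2] := fourier_pos 0 lv.
    apply: complex_ext; apply: (mulfI tn).
      by rewrite [LHS]e1 h3 scoef0 addr0 mulr0.
    by rewrite [LHS]e2 h4 scoef0 subr0 mulr0.
  + rewrite (_ : sgz i.+1%:Z = 1)//; have [e1 e2] := mulNi_pos (fourier u i.+1%:Z).
    have [a1 a2] := fourier_pos i.+1 lu; have [b1 b2] := fourier_pos i.+1 lv.
    have [c1 c2] := h1 i; have [d1 d2] := h2 i.
    apply: complex_ext; apply: (mulfI tn).
      by rewrite e1 b1 a2 c1 d2; ring.
    by rewrite e2 mulrN b2 a1 c2 d1; ring.
  + rewrite (_ : sgz (- i.+1%:Z) = -1)//; have [e1 e2] := mulNi_neg (fourier u (- i.+1%:Z)).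
    have [a1 a2] := fourier_neg i.+1 lu; have [b1 b2] := fourier_neg i.+1 lv.
    have [c1 c2] := h1 i; have [d1 d2] := h2 i.
    apply: complex_ext; apply: (mulfI tn).
      by rewrite e1 mulrN b1 a2 c1 d2; ring.
    by rewrite e2 b2 a1 c2 d1; ring.
Qed.

Lemma HilbP u : H12 u -> H12 (Hilb u) /\ hilb_coef u (Hilb u).
Proof.
move=> hu; have [ru iu] := (H12P u).1 hu; have [lu _] := hu.
have ex : exists v : fct, H12 v /\
    forall n : int, fourier v n = - Complex 0 1 * (sgz n)%:~R * fourier u n.
  have [g [hg g0 wg]] := has_symbol_exists (bsym1 R) ru; have [k [hk k0 wi]] := has_symbol_exists (bsym1 R) iu.
  have [pg _ _] := Hhalf_L2p hg; have [pk _ _] := Hhalf_L2p hk.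
  have [e1 e2] := circle_funE pg pk.
  have hv : H12 (circle_fun g k) by apply/H12P; rewrite e1 e2.
  exists (circle_fun g k); split => //; apply/hilb_fourier => //; first by case: hv.
  by rewrite /hilb_coef e1 e2; split => //; apply/conj_has_symbol.
have [h1 h2] := xgetPex 0 ex; rewrite -/(Hilb u) in h1 h2.
by split => //; apply/hilb_fourier => //; case: h1.
Qed.

(** * Composition with a circle diffeomorphism *)
Lemma Vinv_comp (h k : S1 R -> S1 R) u : cancel h k -> cancel k h -> Vinv h u = u \o k.
Proof.
move=> hk kh; rewrite /Vinv; case: xgetP => [v _ /= e|/(_ (u \o k))/= []]; last first.
  by apply/funext => z; rewrite /V /= hk.
by rewrite -e; apply/funext => z; rewrite /V /= kh.
Qed.

Lemma J_symbol (h k : S1 R -> S1 R) (phi dphi psi dpsi ddpsi : R -> R) :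
  cancel h k -> cancel k h -> (forall x, h (expi x) = expi (phi x)) ->
  (forall x, k (expi x) = expi (psi x)) ->
  circle_lift phi dphi -> (forall x, 2^-1 <= dphi x <= 2) ->
  (forall z, versine z != 0 -> 2^-1 <= lift_symbol phi dphi z <= 2) ->
  cancel phi psi -> cancel psi phi ->
  (forall x, is_derive x 1 psi (dpsi x)) -> (forall x, is_derive x 1 dpsi (ddpsi x)) ->
  continuous ddpsi -> symbol_op (lift_symbol phi dphi) (J h).
Proof.
move=> hk kh hl kl l db mb c1 c2 d1 d2 cd u hu.
have [ru iu] := (H12P u).1 hu.
pose uk := Vinv h u.
have e1 : re_ang uk = re_ang u \o psi.
  by apply/funext => x; rewrite /uk (Vinv_comp _ hk kh) /re_ang /ang /= kl.
have e2 : im_ang uk = im_ang u \o psi.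
  by apply/funext => x; rewrite /uk (Vinv_comp _ hk kh) /im_ang /ang /= kl.
have huk : H12 uk.
  by apply/H12P; rewrite e1 e2; split; apply: (Hhalf_unlift l db mb c1 c2 d1).
have [hv [v1 v2 v3 v4]] := HilbP huk; have [rv iv] := (H12P _).1 hv.
have f1 : re_ang (J h u) = re_ang (Hilb uk) \o phi.
  by apply/funext => x; rewrite /J /V /re_ang /ang /= hl.
have f2 : im_ang (J h u) = im_ang (Hilb uk) \o phi.
  by apply/funext => x; rewrite /J /V /im_ang /ang /= hl.
have hJ : H12 (J h u) by apply/H12P; rewrite f1 f2; split; apply: (Hhalf_lift l db mb).
rewrite f1 f2; split; first exact: hJ.
- by apply: (conjugation_symbol l db mb c1 c2 d1 d2 cd) => //; rewrite -e1.
- by apply: (conjugation_symbol l db mb c1 c2 d1 d2 cd) => //; rewrite -e2.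
Qed.

End SymbolOperators.

(** * The derivative of the conjugated Hilbert transform *)

Section Conclusion.
Variable R : realType.
Implicit Types (f g : R -> R) (x y : R) (m : R * R -> R).
Local Notation mu := (@lebesgue_measure R).
Local Notation P := (period R).
Local Notation tau := (2 * @pi R).
Local Notation C := R[i].
Local Notation fct := (S1 R -> C).
Implicit Types (u v w : fct).

(** Such a D has sin o D = 0 and cos o D = 1; differentiating the former gives
    D' = 0. *)
Lemma expi_lock (D dD : R -> R) : (forall x, is_derive x 1 D (dD x)) ->
  (forall x, expi (D x) = expi 0) -> forall x y, D x = D y.
Proof.
move=> d h x y.
have sc z : cos (D z) = 1 /\ sin (D z) = 0.
  by have := congr1 val (h z); rewrite !expi_val cos0 sin0 => -[].
have d0 z : dD z = 0.
  have [c s] := sc z.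
  have dz := d z.
  have e : is_derive z 1 (@sin R \o D) (cos (D z) * dD z).
    exact: (@is_derive1_comp _ (@sin R) D z _ _ (is_derive_sin _) dz).
  have e0 : @sin R \o D = cst 0 by apply/funext => t /=; have [] := sc t.
  rewrite e0 in e; have [_] := e; rewrite derive_cst c mul1r.
  by move=> <-.
have := @derive_bound_lip R D dD 0 x y d.
have b z : `|dD z| <= 0 by rewrite d0 normr0.
by move=> /(_ b); rewrite mul0r normr_le0 subr_eq0 => /eqP.
Qed.

(** The lift of the inverse of h provided by [diffp] inverses phi only up to a
    multiple of 2pi, which does not depend on the point and is subtracted. *)
Lemma J_near (h : S1 R -> S1 R) (phi a da : R -> R) (s L : R) :
  diffp h -> smooth_lift h phi -> phi = (fun x => x + s * a x) -> per a ->
  (forall x, is_derive x 1 a (da x)) -> continuous da ->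
  (forall x, `|da x| <= L) -> `|s| * L <= 100^-1 ->
  symbol_op (lift_symbol (fun x => x + s * a x) (fun x => 1 + s * da x)) (J h).
Proof.
move=> [k [hk kh _ [psi [sp pp kp]]]] [sphi pphi hphi] ephi pa d c b sL.
have l := lift_near_id pa d b sL c.
have dp x : is_derive x 1 psi (derive1n 1 psi x) := smooth_is_derive 0 x sp.
have dphi x : is_derive x 1 phi (derive1n 1 phi x) := smooth_is_derive 0 x sphi.
pose D x := psi (phi x) - x.
have dD x : is_derive x 1 D (derive1n 1 psi (phi x) * derive1n 1 phi x - 1).
  have e1 := dphi x; have e2 := dp (phi x).
  by apply: is_deriveB; exact: (@is_derive1_comp _ psi phi x _ _ e2 e1).
have eD x : expi (D x) = expi 0.
  have e : expi (psi (phi x)) = expi x by rewrite -kp -hphi hk.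
  have [n ne] := expi_eq e.
  apply: val_inj; rewrite !expi_val /D ne.
  have -> : x + n%:~R * tau - x = 0 + n%:~R * tau by ring.
  by rewrite (per_int n 0 (@cos_per R)) (per_int n 0 (@sin_per R)).
have Dc x : psi (phi x) = x + D 0.
  by rewrite (expi_lock dD eD 0 x) /D addrC subrK.
pose q x := psi x - D 0.
have qK : cancel phi q by move=> x; rewrite /q Dc addrK.
have Kq : cancel q phi.
  move=> y; have [x <-] := circle_lift_onto l y.
  by have := qK x; rewrite ephi => ->.
have dq x : is_derive x 1 q (derive1n 1 psi x).
  rewrite -[X in is_derive _ _ _ X]subr0.
  by apply: is_deriveB (dp x) (is_derive_cst _ _ _).
have kq x : k (expi x) = expi (q x).
  have [n ne] := expi_eq (eD 0); rewrite add0r in ne.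
  rewrite kp /q ne; apply: val_inj; rewrite !expi_val.
  have -> : psi x - n%:~R * tau = psi x + (- n)%:~R * tau by rewrite mulrNz mulNr.
  by rewrite (per_int (- n) _ (@cos_per R)) (per_int (- n) _ (@sin_per R)).
rewrite ephi in qK Kq hphi.
apply: (J_symbol hk kh hphi kq l _ _ qK Kq dq (fun x => smooth_is_derive 1 x sp)).
- by move=> x; have H := dlift_near1 b x sL; exact: H.
- by move=> z; exact: lift_symbol_near1 pa d b s z sL.
- exact: smooth_continuous.
Qed.

Lemma smooth_mul_derive_Hhalf (a f : R -> R) : smooth a -> per a -> smooth f -> per f ->
  Hhalf (fun x => a x * derive1n 1 f x).
Proof.
move=> sa pa sf pf.
have p1 : per (fun x => a x * derive1n 1 f x).
  by move=> x; rewrite pa (smooth_per 1 sf pf).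
have p2 x : is_derive x 1 (fun x => a x * derive1n 1 f x)
    (derive1n 1 a x * derive1n 1 f x + a x * derive1n 2 f x).
  apply: (is_derive_eq (is_deriveM (smooth_is_derive 0 x sa) (smooth_is_derive 1 x sf))).
  by rewrite /GRing.scale /=; ring.
apply: (derive_Hhalf p1 p2) => x; apply: cvgD; apply: cvgM.
- exact: smooth_continuous.
- exact: smooth_continuous.
- exact: (@smooth_continuous R a 0 sa).
- exact: smooth_continuous.
Qed.

(** The smooth representatives chosen for f and for its conjugate are determined
    up to constants only, hence the two functions f and f0 with the same
    nonconstant coefficients. *)
Lemma commutator_coef (a f f0 v0 v k F : R -> R) : smooth a -> per a ->
  smooth f -> per f -> Hhalf f0 -> same_coef f f0 -> conjugate f0 v0 ->
  smooth v -> per v -> same_coef v v0 ->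
  Hhalf k -> ccoef k 0 = 0 -> conjugate (fun x => a x * derive1n 1 f x) k ->
  has_symbol (field_symbol a (derive1n 1 a)) f0 F ->
  same_coef F (fun x => a x * derive1n 1 v x - k x).
Proof.
move=> sa pa sf pf hf0 ff0 jf0 sv pv vv0 hk k0 jk wF i.
have lv : L2p v by apply: Hhalf_L2p; exact: (smooth_Hhalf 0 sv pv).
have hf : Hhalf f := smooth_Hhalf 0 sf pf.
have dv x : is_derive x 1 v (derive1n 1 v x) := smooth_is_derive 0 x sv.
have ddv x : is_derive x 1 (demean v) (derive1n 1 v x).
  rewrite -[X in is_derive _ _ _ X]subr0.
  by apply: is_deriveB (dv x) (is_derive_cst _ _ _).
have pdv : per (demean v) by have [] := L2p_demean lv.
have jdv : conjugate f (demean v).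
  move=> j; have [-> ->] := demean_coef j lv; have [-> ->] := vv0 j.
  by have [-> ->] := ff0 j; exact: jf0.
have cdv : continuous (derive1n 1 v) by exact: smooth_continuous.
have w1 := commutator_symbol sa pa sf pf pdv (ccoef0_demean lv) jdv ddv cdv hk k0 jk.
have [Ma Ma0 hMa] := smooth_bounded 1 sa pa.
have hm := bsym_field pa (fun x => smooth_is_derive 0 x sa) hMa (smooth_continuous (n:=1) sa).
have w2 : has_symbol (field_symbol a (derive1n 1 a)) f F.
  move=> j; rewrite !(eform_coef hm hf hf0 _ ff0); [exact: wF|exact: Hhalf_cosn|exact: Hhalf_sinn].
exact: has_symbol_coef w2 w1.
Qed.

Lemma smoothC_H12 u : smoothC u -> H12 u.
Proof.
move=> [s1 s2]; apply/H12P; split.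
  exact: (smooth_Hhalf 0 s1 (re_ang_per u)).
exact: (smooth_Hhalf 0 s2 (im_ang_per u)).
Qed.

Lemma Hilb_smooth u : smoothC u -> smooth_class (Hilb u).
Proof.
move=> su; have [s1 s2] := su; have hu := smoothC_H12 su.
have [v [dv pv v0 jv]] := smooth_conj s1 (re_ang_per u).
have [w [dw pw w0 jw]] := smooth_conj s2 (im_ang_per u).
have [e1 e2] := circle_funE (pv 0%N) (pw 0%N).
have [sv _] := smooth_chain dv; have [sw _] := smooth_chain dw.
have sg : smoothC (circle_fun (v 0%N) (w 0%N)).
  have E1 : smooth (re_ang (circle_fun (v 0%N) (w 0%N))) by rewrite e1.
  have E2 : smooth (im_ang (circle_fun (v 0%N) (w 0%N))) by rewrite e2.
  by split; [exact: E1|exact: E2].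
exists (circle_fun (v 0%N) (w 0%N)) => //.
have [hH [h1 h2 _ _]] := HilbP hu.
have [lg _] := smoothC_H12 sg; have [lH _] := hH.
apply/eqH_coef => //; rewrite e1 e2; split=> i.
  by have [-> ->] := jv 0%N i; have [-> ->] := h1 i.
by have [-> ->] := jw 0%N i; have [-> ->] := h2 i.
Qed.

(** Any smooth representative chosen by [MAd] has the coefficients of u. *)
Lemma MAdP (A : S1 R -> R) u : smoothR A -> H12 u -> smooth_class u ->
  exists f : fct, [/\ smoothC f, same_coef (re_ang f) (re_ang u), same_coef (im_ang f) (im_ang u),
    re_ang (MAd A u) = (fun x => ang A x * derive1n 1 (re_ang f) x) &
    im_ang (MAd A u) = (fun x => ang A x * derive1n 1 (im_ang f) x)].
Proof.
move=> sA hu [f0 sf0 fu].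
have pA : per (ang A) by exact: ang_per.
have pd (g : fct) : smoothC g -> per (fun t => (ang A t)%:C%C * cderive (ang g) t).
  move=> [s1 s2] t; rewrite pA /cderive.
  have := smooth_per 1 s1 (re_ang_per g) t; have := smooth_per 1 s2 (im_ang_per g) t.
  by rewrite /re_ang /im_ang /derive1n /= => -> ->.
have ex : exists v : fct, exists f : fct, [/\ smoothC f, eqH f u &
    forall t, ang v t = (ang A t)%:C%C * cderive (ang f) t].
  exists (of_angle (fun t => (ang A t)%:C%C * cderive (ang f0) t)), f0; split => //.
  by move=> t; rewrite ang_of_angle//; exact: pd.
have [f [sf fe E]] := xgetPex 0 ex; rewrite -/(MAd A u) in E.
have [lf _] := smoothC_H12 sf; have [lu _] := hu.
have [c1 c2] := (eqH_coef lf lu).1 fe.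
exists f; split => //; apply/funext => t; rewrite /re_ang /im_ang E /cderive /=.
  by rewrite mul0r subr0.
by rewrite mul0r addr0.
Qed.

Lemma commutator_extension (A : S1 R -> R) (JA : fct -> fct) u : smoothR A ->
  symbol_op (field_symbol (ang A) (derive1n 1 (ang A))) JA -> smoothC u ->
  eqH (JA u) (commMAdH A u).
Proof.
move=> sA hJ su; have hu := smoothC_H12 su; have [lu _] := hu.
have pA : per (ang A) by exact: ang_per.
have [hJu w1 w2] := hJ u hu; have [lJ _] := hJu.
have cu : smooth_class u.
  by exists u => //; apply/eqH_coef.
have [hH [j1 j2 _ _]] := HilbP hu.
have [f [[sf1 sf2] f1 f2 f3 f4]] := MAdP sA hu cu.
have [v [[sv1 sv2] v1 v2 v3 v4]] := MAdP sA hH (Hilb_smooth su).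
have hM : H12 (MAd A u).
  apply/H12P; rewrite f3 f4; split.
    exact: (smooth_mul_derive_Hhalf sA pA sf1 (re_ang_per f)).
  exact: (smooth_mul_derive_Hhalf sA pA sf2 (im_ang_per f)).
have hMH : H12 (MAd A (Hilb u)).
  apply/H12P; rewrite v3 v4; split.
    exact: (smooth_mul_derive_Hhalf sA pA sv1 (re_ang_per v)).
  exact: (smooth_mul_derive_Hhalf sA pA sv2 (im_ang_per v)).
have [hK [k1 k2 k3 k4]] := HilbP hM.
have [rK iK] := (H12P _).1 hK; have [rM iM] := (H12P _).1 hMH.
have [ru iu] := (H12P u).1 hu.
have lc : L2 (commMAdH A u).
  apply/L2P; rewrite /commMAdH re_ang_sub im_ang_sub.
  by split; apply: L2pB; exact: Hhalf_L2p.
apply/eqH_coef => //; rewrite /commMAdH re_ang_sub im_ang_sub v3 v4 f3 in k1 *.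
rewrite f4 in k2; split.
- exact: (commutator_coef sA pA sf1 (re_ang_per f) ru f1 j1 sv1 (re_ang_per v) v1 rK k3 k1 w1).
- exact: (commutator_coef sA pA sf2 (im_ang_per f) iu f2 j2 sv2 (im_ang_per v) v2 iK k4 k2 w2).
Qed.

Lemma difference_quotient_le (t L e o m d1 d2 : R) : t != 0 ->
  `|m - o - t * d1| <= 200 * (`|t| * L) ^+ 2 -> `|t| * (200 * L ^+ 2) <= e / 2 ->
  `|d1 - d2| <= 8 * (e / 16) -> `|t^-1 * (m + -1 * o) + -1 * d2| <= e.
Proof.
move=> tn h1 ts h2.
have -> : t^-1 * (m + -1 * o) + -1 * d2 = t^-1 * (m - o - t * d1) + (d1 - d2) by field.
apply: (le_trans (ler_normD _ _)).
have h3 : `|t^-1 * (m - o - t * d1)| <= e / 2.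
  rewrite normrM normfV ler_pdivrMl ?normr_gt0//; apply: (le_trans h1).
  have -> : 200 * (`|t| * L) ^+ 2 = `|t| * (`|t| * (200 * L ^+ 2)) by ring.
  by rewrite ler_pM2l ?normr_gt0.
by lra.
Qed.

End Conclusion.

Theorem theorem4p1 (R : realType) (A : S1 R -> R) (h : R -> S1 R -> S1 R)
    (smoothA : smoothR A) (smooth_h : smooth_path h) (h0 : h 0%R = id)
    (hA : initial_field h A) :
  exists JA : (S1 R -> complex R) -> (S1 R -> complex R),
    is_op_derivative0 (fun t => J (h t)) JA /\
    is_bounded_extension_comm A JA.
Proof.
have pA : per (ang A) by exact: ang_per.
have [MA MA0 hMA] := smooth_bounded 1 smoothA pA.
have dA (x : R) : is_derive x (1 : R) (ang A) (derive1n 1 (ang A) x) := smooth_is_derive 0 x smoothA.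
have cdA : continuous (derive1n 1 (ang A)) by exact: smooth_continuous.
have hmA := bsym_field pA dA hMA cdA.
have [JA hJA] := symbol_op_exists hmA.
have [eps eps0 [hdiff _]] := smooth_h.
have [phi [lifts phi0 cphi]] := hA.
pose L := MA + 1; have L0 : 0 < L by rewrite ltr_wpDl.
(* phi t x = x + t a(x) with a close to A in C^1. *)
pose a t x := t^-1 * (phi t x - x).
pose da t x := t^-1 * (derive1n 1 (phi t) x - 1).
pose M t := lift_symbol (fun x => x + t * a t x) (fun x => 1 + t * da t x).
pose good t := [/\ phi t = (fun x => x + t * a t x), per (a t),
  forall x : R, is_derive x (1 : R) (a t) (da t x), continuous (da t) & diffp (h t)].
have nsmall (e : R) : 0 < e -> \forall t \near (0 : R), `|t| < e.
  move=> e0; near=> t; near: t.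
  by exists e => //= t /=; rewrite sub0r normrN.
have ngood : \forall t \near (0 : R)^', good t /\ smooth_lift (h t) (phi t).
  near=> t; have tn : t != 0 by near: t; exact: nbhs_dnbhs_neq.
  have [sp pp hp] : smooth_lift (h t) (phi t) by near: t; exact: nbhs_dnbhs.
  have te : `|t| < eps by near: t; apply: nbhs_dnbhs; exact: nsmall.
  have dphi (x : R) : is_derive x (1 : R) (phi t) (derive1n 1 (phi t) x) := smooth_is_derive 0 x sp.
  split; last by split.
  split.
  - by apply/funext => x; rewrite /a; field.
  - by move=> x; rewrite /a pp; ring.
  - by move=> x; apply: is_derive_scale.
  - apply: continuous_scale => x; apply: cvgB; [exact: smooth_continuous|exact: cvg_cst].
  - exact: hdiff.
have nslope (e : R) : 0 < e -> \forall t \near (0 : R)^', forall x, `|da t x - derive1n 1 (ang A) x| <= e.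
  move=> e0; have := cphi 1%N e e0 => nc.
  near=> t; have [[_ _ dat _ _] _] : good t /\ smooth_lift (h t) (phi t) by near: t; exact: ngood.
  have : forall x, `|derive1n 1 (fun y => t^-1 * (phi (0 + t) y - phi 0 y) - ang A y) x| <= e.
    by near: t; exact: nc.
  move=> H x; have := H x.
  have -> // : derive1n 1 (fun y => t^-1 * (phi (0 + t) y - phi 0 y) - ang A y) x =
    da t x - derive1n 1 (ang A) x.
  rewrite /derive1n /= derive1E add0r phi0.
  by have [_ <-] := is_deriveB (dat x) (dA x).
(* At t = 0 the symbol is 1, written as a quotient in order to vanish on the
   diagonal like the others. *)
have sym0 : symbol_op (fun z => versine z / versine z) (J (h 0)).
  have l0 : smooth_lift (h 0) (phi 0) := nbhs_singleton lifts.
  have d0 : diffp (h 0) by apply: hdiff; rewrite normr0.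
  have := @J_near R (h 0) (phi 0) (cst 0) (cst 0) 0 0 d0 l0.
  have -> : lift_symbol (fun x : R => x + 0 * cst 0 x) (fun x => 1 + 0 * cst 0 x) =
    (fun z => versine z / versine z).
    by apply/funext => z; rewrite /lift_symbol /versine /= !mul0r !addr0 !mul1r.
  apply.
  - by rewrite phi0; apply/funext => x; rewrite mul0r addr0.
  - by [].
  - by move=> x; exact: cst_continuous.
  - by move=> x /=; rewrite normr0.
  - by rewrite mulr0 invr_ge0.
have bounds t : good t -> smooth_lift (h t) (phi t) -> `|t| * L <= 100^-1 ->
    (forall x, `|da t x - derive1n 1 (ang A) x| <= 1) ->
    [/\ forall x, `|da t x| <= L, symbol_op (M t) (J (h t)) & bsym 2 (M t)].
  move=> [e1 e2 e3 e4 e5] lt tL b1.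
  have bL x : `|da t x| <= L.
    rewrite -(subrK (derive1n 1 (ang A) x) (da t x)).
    by apply: (le_trans (ler_normD _ _)); rewrite /L addrC lerD.
  split; [exact: bL|exact: (J_near e5 lt e1 e2 e3 e4 bL tL)|].
  apply: bsym_lift.
  - have l := lift_near_id e2 e3 bL tL e4; exact: l.
  - by move=> z zn; have H := lift_symbol_near1 e2 e3 bL tL zn; exact: H.
have nbounds : \forall t \near (0 : R)^', [/\ good t, `|t| * L <= 100^-1, forall x, `|da t x| <= L,
    symbol_op (M t) (J (h t)) & bsym 2 (M t)].
  near=> t; have [gt lt] : good t /\ smooth_lift (h t) (phi t) by near: t; exact: ngood.
  have tL : `|t| * L <= 100^-1.
    rewrite -ler_pdivlMr// ltW//; near: t; apply: nbhs_dnbhs; apply: nsmall.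
    by rewrite divr_gt0.
  have b1 : forall x, `|da t x - derive1n 1 (ang A) x| <= 1 by near: t; exact: nslope.
  have [x1 x2 x3] := bounds t gt lt tL b1.
  by split; [exact: gt|exact: tL|exact: x1|exact: x2|exact: x3].
exists JA; split; last first.
  split; first exact: symbol_op_bounded hmA hJA.
  move=> f sf; split; first exact: Hilb_smooth.
  exact: commutator_extension.
split.
- have : \forall t \near (0 : R)^', bounded_op (J (h t)).
    by apply: filterS nbounds => t [_ _ _ s b]; exact: symbol_op_bounded b s.
  rewrite /dnbhs /within /= => H; near=> t.
  have [->|tn] := eqVneq t 0; first exact: symbol_op_bounded (bsym_versine R) sym0.
  by move: tn; near: t.
- exact: symbol_op_bounded hmA hJA.
have key (e : R) : 0 < e -> \forall t \near (0 : R)^',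
    (op_norm (fun u => (t^-1)%:C%C *: (J (h t) u - J (h 0) u) - JA u)%R <= e%:E)%E.
  move=> e0; near=> t.
  have tn : t != 0 by near: t; exact: nbhs_dnbhs_neq.
  have [[_ e2 e3 e4 _] tL bL sM bM] : [/\ good t, `|t| * L <= 100^-1, forall x, `|da t x| <= L,
    symbol_op (M t) (J (h t)) & bsym 2 (M t)] by near: t; exact: nbounds.
  have sl : forall x, `|da t x - derive1n 1 (ang A) x| <= e / 16.
    by near: t; apply: nslope; rewrite divr_gt0.
  have ts : `|t| * (200 * L ^+ 2) <= e / 2.
    rewrite -ler_pdivlMr ?mulr_gt0 ?exprn_gt0// ltW//; near: t; apply: nbhs_dnbhs; apply: nsmall.
    by rewrite !divr_gt0// mulr_gt0// exprn_gt0.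
  have sn := symbol_op_comb t^-1 bM (bsym_versine R) hmA sM sym0 hJA.
  apply: (op_norm_le _ sn); split.
    have n0 := bsymZ (-1) (bsym_versine R); have n1 := bsymD bM n0; have n2 := bsymZ t^-1 n1.
    by have [] := bsymD n2 (bsymZ (-1) hmA).
  move=> z; have h1 := symbol_estimate e2 e3 bL z tL.
  have pb : per (fun x => a t x - ang A x) by move=> x; rewrite e2 pA.
  have db (x : R) : is_derive x (1 : R) (fun x => a t x - ang A x) (da t x - derive1n 1 (ang A) x).
    exact: is_deriveB (e3 x) (dA x).
  have h2 := field_symbol_le pb db sl z; rewrite -field_symbolB in h2.
  exact: (@difference_quotient_le _ t L e (versine z / versine z) (M t z) _ _ tn h1 ts h2).
apply/fine_cvgP; split.
  by apply: filterS (key 1 ltr01) => t h1; rewrite ge0_fin_numE ?op_norm_ge0// (le_lt_trans h1)// ltry.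
apply/cvgrPdist_le => e e0; apply: filterS (key e e0) => t h1.
rewrite /= sub0r normrN ger0_norm ?fine_ge0 ?op_norm_ge0//.
rewrite -lee_fin fineK// ge0_fin_numE ?op_norm_ge0// (le_lt_trans h1)// ltry.
Unshelve. all: by end_near. Qed.
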